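(* For every $n\in\mathbb{N}$ let $Z_{n1},\ldots,Z_{nn}$ be i.i.d. random variables in $l^2$. Assume that: (1) $\mathbb{E}[Z_{n1}^{(i)}]=0$ and $\mathbb{E}[(Z_{n1}^{(i)})^2]<\infty$ for all $i\in\mathbb{N}$ and all $n\in\mathbb{N}$; (2) for all $k,l\in\mathbb{N}$, $\Gamma_n(k,l):=\mathbb{E}[Z_{n1}^{(k)}Z_{n1}^{(l)}]\to\Gamma(k,l)\in\mathbb{R}$ as $n\to\infty$; (3) $\limsup_{n\to\infty}\sum_{k\ge1}\Gamma_n(k,k)\le\sum_{k\ge1}\Gamma(k,k)<\infty$; (4) for all $l\in\mathbb{N}$ and all rational $\epsilon>0$, $\mathbb{E}\big[\|\gamma_l(Z_{n1})\|_l^2\,1_{\{\|\gamma_l(Z_{n1})\|_l>\epsilon\sqrt{n}\}}\big]\to0$ as $n\to\infty$. Then $$\frac{1}{\sqrt{n}}\sum_{i=1}^nZ_{ni}\stackrel{\mathcal{D}}{\longrightarrow}N(0,\Gamma)\quad\text{in }l^2,$$ where $\Gamma=(\Gamma(k,l))_{k,l\in\mathbb{N}}$.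
   Context: $l^2$ is the Hilbert space of square-summable real sequences $x=(x^{(i)})_{i\in\mathbb{N}}$ with norm $\|\cdot\|$; $\|\cdot\|_l$ is the Euclidean norm on $\mathbb{R}^l$; $\gamma_l:l^2\to\mathbb{R}^l$ is $\gamma_l(x)=(x^{(1)},\ldots,x^{(l)})$. $N(0,\Gamma)$ denotes the centered Gaussian distribution on $l^2$ (or a random element with it) whose components have covariances $\Gamma(k,l)$, $k,l\in\mathbb{N}$. $\stackrel{\mathcal{D}}{\to}$ in $l^2$ is convergence in distribution (weak convergence of laws) with respect to the norm topology. Independence is only required within each row $n$. *)

(* Defs.v *)
From HB Require Import structures.
From mathcomp Require Import all_boot all_order all_algebra.
From mathcomp Require Import all_classical all_reals all_analysis.

Set Implicit Arguments.
Unset Strict Implicit.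
Unset Printing Implicit Defensive.

Import Order.TTheory GRing.Theory Num.Theory.
Import numFieldNormedType.Exports.

Local Open Scope classical_set_scope.
Local Open Scope ring_scope.

Lemma l2_exponent_ge1 (R : realType) : (1%:E <= 2%:E :> \bar R)%E.
Proof. by rewrite lee_fin ler1n. Qed.

(* The square-summable sequences x : nat -> R, as the functions with finite
   L^2-norm for the counting measure on nat (every x is measurable, and no two
   of them are almost everywhere equal unless they are equal).  Components are
   numbered from 0. *)
Definition l2 (R : realType) : Type :=
  LfunType (counting : {measure set nat -> \bar R}) (l2_exponent_ge1 R).

Section l2_structure.
Variable R : realType.

HB.instance Definition _ := GRing.Lmodule.on (l2 R).

Definition l2_norm (x : l2 R) : R :=
  fine ('N[(counting : {measure set nat -> \bar R})]_(2%:E)[EFin \o x])%E.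

Lemma l2_norm_sqr (x : l2 R) :
  ((l2_norm x ^+ 2)%:E = \sum_(k <oo) ((x k ^+ 2)%:E))%E.
Proof.
have s0 : (0 <= \sum_(k <oo) ((x k ^+ 2)%:E))%E.
  by apply: nneseries_ge0 => k _ _; rewrite lee_fin sqr_ge0.
have H : (l2_norm x)%:E = ((\sum_(k <oo) ((x k ^+ 2)%:E)) `^ 2^-1)%E.
  rewrite /l2_norm finite_norm_fine Lnorm_counting//; congr (_ `^ _)%E.
  apply: eq_eseriesr => k _ /=.
  by rewrite powR_mulrn// real_normK ?num_real.
have n0 : 0 <= l2_norm x by rewrite -lee_fin H poweR_ge0.
by rewrite -powR_mulrn// -poweR_EFin H -poweRrM mulVf// poweRe1.
Qed.

Lemma l2_normD (x y : l2 R) : l2_norm (x + y) <= l2_norm x + l2_norm y.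
Proof. exact: ler_LnormD. Qed.

Lemma l2_normZ (a : R) (x : l2 R) : l2_norm (a *: x) = `|a| * l2_norm x.
Proof.
by apply/EFin_inj; rewrite EFinM /l2_norm !finite_norm_fine; exact: LnormZ.
Qed.

Lemma l2_norm0_eq0 (x : l2 R) : l2_norm x = 0 -> x = 0.
Proof.
move=> x0; apply/LfuneqP => k.
have x2_ge0 i : (0 <= (x i ^+ 2)%:E)%E by rewrite lee_fin sqr_ge0.
have : (\sum_(0 <= i < k.+1) (x i ^+ 2)%:E <= 0)%E.
  apply: (le_trans (nneseries_lim_ge _ (fun i _ _ => x2_ge0 i))).
  by rewrite -l2_norm_sqr x0 expr0n.
rewrite big_nat_recr//= => sum_le0.
have : ((x k ^+ 2)%:E <= 0)%E.
  apply: le_trans sum_le0; rewrite leeDr//.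
  by apply: sume_ge0 => i _; exact: x2_ge0.
by rewrite lee_fin real_exprn_even_le0 ?num_real//= => /eqP.
Qed.

HB.instance Definition _ := Lmodule_isNormed.Build R (l2 R)
  l2_normD l2_normZ l2_norm0_eq0.

HB.instance Definition _ := @isMeasurable.Build
  (sigma_display (@open (l2 R))) (l2 R) <<s @open (l2 R) >>
  (@sigma_algebra0 _ setT _) (@sigma_algebraC _ _)
  (@sigma_algebra_bigcup _ setT _).

End l2_structure.

Definition gamma (R : realType) (l : nat) (x : l2 R) : 'rV[R]_l :=
  \row_(i < l) x i.

(* The library's norm on row vectors is the sup norm. *)
Definition euclidean_norm (R : realType) (l : nat) (v : 'rV[R]_l) : R :=
  Num.sqrt (\sum_(i < l) v ord0 i ^+ 2).

Section probability_notions.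
Context {R : realType}.

Definition mutually_independent {d d'} {T : measurableType d}
    {T' : measurableType d'} (P : probability T R) (I : finType)
    (X : I -> {RV P >-> T'}) : Prop :=
  forall (J : {set I}) (A : I -> set T'), (forall i, measurable (A i)) ->
  (P (\bigcap_(i in [set` J]) (X i @^-1` A i)) =
   \prod_(i in J) P (X i @^-1` A i))%E.

Definition identically_distributed {d d'} {T : measurableType d}
    {T' : measurableType d'} (P : probability T R) (I : finType)
    (X : I -> {RV P >-> T'}) : Prop :=
  forall (i j : I) (A : set T'), measurable A ->
  distribution P (X i) A = distribution P (X j) A.

Definition iid {d d'} {T : measurableType d} {T' : measurableType d'}
    (P : probability T R) (I : finType) (X : I -> {RV P >-> T'}) : Prop :=
  mutually_independent X /\ identically_distributed X.

Definition mixed_moment {d} {T : measurableType d} (P : probability T R)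
    (X : T -> l2 R) (k l : nat) : \bar R :=
  'E_P[fun t => (X t k * X t l)%R].

(* [normal_prob 0 0] is not the point mass at 0 but the uniform law on [0, 1],
   hence the separate case. *)
Definition centered_normal (s : R) : set R -> \bar R :=
  if s == 0 then dirac (0 : R) else normal_prob 0 s.

(* The components being centered, their mixed moments are their covariances. *)
Definition centered_gaussian (mu : probability (l2 R) R)
    (Gamma : nat -> nat -> R) : Prop :=
  (forall phi : {linear l2 R -> R^o}, continuous phi ->
    exists2 s : R, 0 <= s & forall A : set R, measurable A ->
      pushforward mu phi A = centered_normal s A) /\
  (forall k l, mixed_moment mu idfun k l = (Gamma k l)%:E).

(* The X n may live on different probability spaces; the limit is given by its
   law.  Measurability makes each X n a random element with a law. *)
Definition cvg_in_distribution {d : nat -> measure_display}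
    {T : forall n, measurableType (d n)} (P : forall n, probability (T n) R)
    (X : forall n, T n -> l2 R) (mu : probability (l2 R) R) : Prop :=
  (forall n, measurable_fun [set: T n] (X n)) /\
  (forall f : l2 R -> R, continuous f -> (exists M, forall x, `|f x| <= M) ->
    ('E_(P n)[f \o X n] @[n --> \oo] --> 'E_mu[f])%E).

End probability_notions.

(* Main.v *)
(* Uniqueness and convergence.  A bounded continuous function on l2 is approached from below by
   Lipschitz functions; on a Lipschitz function x may be replaced by finitely many of its coordinates
   (the tails of E|X|^2 are uniformly small by the trace condition), each of them replaced by
   L sin (x_k / L), and the resulting function of finitely many sines is a uniform limit of
   trigonometric polynomials, by Bernstein's approximation in one variable at a time.  So convergence
   of the characteristic functions of the finite linear combinations, together with the uniform
   smallness of the tails, gives convergence in law; no compactness argument is needed.  The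
   characteristic functions converge by Lindeberg's estimate
   n log E exp (i z / sqrt n) -> - Var z / 2 for z a linear combination of l coordinates.

   Existence of N(0, Gamma).  Under the uniform law on [0, 1], the binary digits at even and at odd
   places form two independent uniform variables; iterating, and applying the quantile function of
   N(0, 1), gives independent standard normal variables xi_j.  If Gamma = L L^T is the infinite
   Cholesky decomposition (Gamma is positive semidefinite as a limit of covariances), the sequence
   X_k = sum_(j <= k) L_kj xi_j has the required covariances and is almost surely in l2, the trace of
   Gamma being finite. *)
Require Import Defs.
From HB Require Import structures.
From mathcomp Require Import all_boot all_order all_algebra.
From mathcomp Require Import all_classical all_reals all_analysis.
From mathcomp Require Import measurable_realfun.
From mathcomp Require Import ring lra zify.

Set Implicit Arguments.
Unset Strict Implicit.
Unset Printing Implicit Defensive.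

Import Order.TTheory GRing.Theory Num.Theory.
Import numFieldNormedType.Exports.

Local Open Scope classical_set_scope.
Local Open Scope ring_scope.

(** * Bounded measurable functions *)

(** Characteristic functions are kept real: they are means of [cos (z + th)] with a free phase [th],
    the phase [- (pi / 2)] giving the sine part. Products of such cosines are sums of such cosines,
    and this is what drives the approximation algebra. The obstacle in infinite dimension is that
    mass of |X|^2 may escape along the coordinates. Convergence of each covariance controls every
    finite head, and the limsup of the traces forbids an excess in the tail. Hence the continuity
    theorem asks for second moments of tails, and compares functions in mean rather than pointwise.
    The same theorem, applied to a constant sequence on a line of [l2], gives uniqueness of
    characteristic functions on the real line, by which the laws of functionals are recognized as
    normal. Identities between integrals are checked on indicators or on continuous functions and
    extended to bounded measurable functions in one variable at a time, the other variables entering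
    as a bounded weight; this takes the place of product measures. *)

Section bounded_measurable.
Context {R : realType} {d} {T : measurableType d}.
Implicit Types f g : T -> R.

Definition bmeas f := measurable_fun [set: T] f /\ exists M : R, forall x, `|f x| <= M.

Lemma bmeas_cst c : bmeas (fun _ => c).
Proof. by split => //; exists `|c|. Qed.

Lemma bmeas_indic (A : set T) : measurable A -> bmeas (\1_A : T -> R).
Proof.
move=> mA; split; first exact: measurable_indic.
exists 1 => x; rewrite indicE; case: (_ \in _) => /=; by rewrite ?normr1 ?normr0.
Qed.

Lemma bmeasD f g : bmeas f -> bmeas g -> bmeas (fun x => f x + g x).
Proof.
move=> [mf [M fM]] [mg [N gN]]; split; first exact: measurable_funD.
by exists (M + N) => x; rewrite (le_trans (ler_normD _ _))// lerD.
Qed.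

Lemma bmeasM f g : bmeas f -> bmeas g -> bmeas (fun x => f x * g x).
Proof.
move=> [mf [M fM]] [mg [N gN]]; split; first exact: measurable_funM.
by exists (M * N) => x; rewrite normrM ler_pM.
Qed.

Lemma bmeasZ c f : bmeas f -> bmeas (fun x => c * f x).
Proof. by move=> bf; apply: bmeasM => //; exact: bmeas_cst. Qed.

Lemma bmeas_prod I (s : seq I) (F : I -> T -> R) :
  (forall i, bmeas (F i)) -> bmeas (fun x => \prod_(i <- s) F i x).
Proof.
move=> bF; elim: s => [|i s ih].
  by under eq_fun do rewrite big_nil; exact: bmeas_cst.
by under eq_fun do rewrite big_cons; exact: bmeasM.
Qed.

(** A bounded measurable function is a uniform limit of step functions, the level sets of the
    integer part of [(n + 1) (f + M)] giving an error of at most [1 / (n + 1)]. Uniform rather than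
    monotone limits keep the approximants uniformly bounded, so that identities between integrals
    pass to the limit. *)
Lemma bmeas_ind (H : (T -> R) -> Prop) :
    (forall A, measurable A -> H \1_A) ->
    (forall f g, H f -> H g -> H (fun x => f x + g x)) ->
    (forall c f, H f -> H (fun x => c * f x)) ->
    (forall f (F : nat -> T -> R), (forall n, H (F n)) ->
       (forall n x, `|f x - F n x| <= n.+1%:R^-1) -> H f) ->
  forall f, bmeas f -> H f.
Proof.
move=> Hi HD HZ Hl f [mf [M fM]].
have H0 : H (fun _ => 0).
  suff -> : (fun _ : T => 0 : R) = (\1_set0 : T -> R) by exact: Hi.
  by apply/funext => x; rewrite indicE in_set0.
have H1 c : H (fun _ => c).
  suff -> : (fun _ : T => c : R) = fun x => c * (\1_setT : T -> R) x.
    by apply: HZ; exact: Hi.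
  by apply/funext => x; rewrite indicE in_setT mulr1.
have HS I (s : seq I) (F : I -> T -> R) :
    (forall i, H (F i)) -> H (fun x => \sum_(i <- s) F i x).
  move=> bF; elim: s => [|i s ih]; first by under eq_fun do rewrite big_nil.
  by under eq_fun do rewrite big_cons; exact: HD.
have M0 x : 0 <= f x + M by have := fM x; rewrite ler_norml => /andP[]; lra.
pose A n k := [set x | Num.truncn (n.+1%:R * (f x + M)) = k].
have AE n k : A n k = f @^-1` `[k%:R / n.+1%:R - M, k.+1%:R / n.+1%:R - M[.
  apply/seteqP; split => x /=; rewrite in_itv/=.
    move=> <-; have n0 : 0 < n.+1%:R :> R by [].
    have /truncn_itv : 0 <= n.+1%:R * (f x + M) by rewrite mulr_ge0.
    by rewrite lerBlDr ler_pdivrMr// ltrBrDr ltr_pdivlMr// mulrC.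
  have n0 : 0 < n.+1%:R :> R by [].
  rewrite lerBlDr ler_pdivrMr// ltrBrDr ltr_pdivlMr// mulrC => h.
  by apply/eqP; rewrite truncn_eq// mulr_ge0.
have mA n k : measurable (A n k).
  by rewrite AE -[X in measurable X]setTI; apply: mf.
(* Since [f + M <= M + M], all levels are below [K n]. *)
pose K n := (Num.truncn (n.+1%:R * (M + M))).+1.
apply: (Hl _ (fun n x => \sum_(k <- iota 0 (K n)) k%:R / n.+1%:R * \1_(A n k) x - M)).
  by move=> n; apply: HD => //; apply: HS => k; apply: HZ; exact: Hi.
move=> n x; have n0 : 0 < n.+1%:R :> R by [].
set t := Num.truncn (n.+1%:R * (f x + M)).
have tK : (t < K n)%N.
  rewrite ltnS; apply: le_truncn; rewrite ler_wpM2l// lerD2r.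
  by have := fM x; rewrite ler_norml => /andP[].
rewrite (bigD1_seq t) ?iota_uniq ?mem_iota//= big1 ?addr0; last first.
  move=> k kt; rewrite indicE; case: (boolP (x \in A n k)) => [|_].
    by rewrite inE /A/= -/t => e; rewrite e eqxx in kt.
  by rewrite mulr0.
rewrite indicE mem_set// mulr1.
have /truncn_itv : 0 <= n.+1%:R * (f x + M) by rewrite mulr_ge0.
rewrite -/t => /andP[h1 h2].
have h3 : t%:R / n.+1%:R <= f x + M by rewrite ler_pdivrMr// mulrC.
have h4 : f x + M <= t%:R / n.+1%:R + n.+1%:R^-1.
  have -> : t%:R / n.+1%:R + n.+1%:R^-1 = t.+1%:R / n.+1%:R :> R.
    by rewrite -[t.+1%:R]natr1 mulrDl mul1r.
  by rewrite ler_pdivlMr// mulrC ltW.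
have h5 : 0 <= n.+1%:R^-1 :> R by [].
move: h3 h4 h5; move: (n.+1%:R^-1) => c; move: (t%:R * c) => b h3 h4 h5.
by rewrite ler_norml; apply/andP; split; lra.
Qed.

End bounded_measurable.

(** * Real-valued integrals and expectations *)

Section integral_toolkit.
Context {R : realType} {d} {T : measurableType d} (mu : {measure set T -> \bar R}).
Implicit Types f g h : T -> R.

Local Notation pint f := (mu.-integrable [set: T] (EFin \o f)).

Lemma integrable_dominated f g : measurable_fun [set: T] f -> pint g ->
  (forall x, `|f x| <= g x) -> pint f.
Proof.
move=> mf ig fg; apply: le_integrable ig => //; first exact/measurable_EFinP.
by move=> x _ /=; rewrite lee_fin (le_trans (fg x))// ler_norm.
Qed.

Lemma expectD f g : pint f -> pint g ->
  \int[mu]_x (f x + g x) = \int[mu]_x f x + \int[mu]_x g x.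
Proof. by move=> intf intg; rewrite RintegralD. Qed.

Lemma expectZ (c : R) f : pint f -> \int[mu]_x (c * f x) = c * \int[mu]_x f x.
Proof. by move=> intf; rewrite RintegralZl. Qed.

Lemma pintD f g : pint f -> pint g -> pint (fun x => f x + g x).
Proof. by move=> intf intg; apply: (integrableD _ intf intg). Qed.

Lemma pintZ (c : R) f : pint f -> pint (fun x => c * f x).
Proof. by move=> intf; apply: (integrableZl _ c intf). Qed.

Lemma expect_le f g : pint f -> pint g -> (forall x, f x <= g x) ->
  \int[mu]_x f x <= \int[mu]_x g x.
Proof. by move=> intf intg fg; apply: le_Rintegral. Qed.

Lemma expect_dist f g h : pint f -> pint g -> pint h ->
  (forall x, `|f x - g x| <= h x) ->
  `|\int[mu]_x f x - \int[mu]_x g x| <= \int[mu]_x h x.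
Proof.
move=> intf intg inth fgh; rewrite -RintegralB//.
have ifg : pint (fun x => f x - g x) by apply: (integrableB _ intf intg).
apply: (le_trans (le_normr_Rintegral _ ifg)) => //.
by apply: expect_le => //; exact: (integrable_norm ifg).
Qed.

Lemma expect_cvg (F : nat -> T -> R) f g :
  (forall n, measurable_fun [set: T] (F n)) -> pint g ->
  (forall x, F n x @[n --> \oo] --> f x) -> (forall n x, `|F n x| <= g x) ->
  \int[mu]_x F n x @[n --> \oo] --> \int[mu]_x f x.
Proof.
move=> mF ig Ff Fg; apply: fine_cvg.
have mf : measurable_fun [set: T] f.
  by apply: (measurable_fun_cvg mF) => x _; exact: Ff.
have intf : pint f.
  apply: (integrable_dominated mf ig) => x.
  have h : `|F n x| @[n --> \oo] --> `|f x| by apply: cvg_norm; exact: Ff.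
  rewrite -(cvg_lim _ h)//; apply: limr_le; first exact: cvgP h.
  by apply: nearW => n; exact: Fg.
rewrite fineK; last exact: integrable_fin_num.
apply: (@dominated_cvg _ _ _ mu _ _ (fun n x => (F n x)%:E) _ (EFin \o g)) => //.
- by move=> n; exact/measurable_EFinP.
- by move=> x _; apply: cvg_EFin; [exact: nearW|exact: Ff].
- by move=> n x _; rewrite /= lee_fin; exact: Fg.
Qed.

End integral_toolkit.

Section expectation.
Context {R : realType} {d} {T : measurableType d} (P : probability T R).
Implicit Types f g h : T -> R.

Local Notation pint f := (P.-integrable [set: T] (EFin \o f)).

Lemma bmeas_integrable f : bmeas f -> pint f.
Proof.
move=> [mf [M fM]]; apply: measurable_bounded_integrable => //.
  by rewrite (@le_lt_trans _ _ 1%E)//; [exact: probability_le1|rewrite ltry].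
exists M; split; first exact: num_real.
by move=> N MN x _; exact: (le_trans (fM x) (ltW MN)).
Qed.

Lemma expect_cst (c : R) : \int[P]_x c = c.
Proof.
rewrite Rintegral_cst// -[RHS]mulr1; congr (c * _).
by rewrite -[RHS]/(fine 1%E); congr fine; exact: probability_setT.
Qed.

Lemma pint_sum I (s : seq I) (F : I -> T -> R) :
  (forall i, pint (F i)) -> pint (fun x => \sum_(i <- s) F i x).
Proof.
move=> intF; elim: s => [|i s ih].
  by under eq_fun do rewrite big_nil; apply: bmeas_integrable; exact: bmeas_cst.
by under eq_fun do rewrite big_cons; exact: pintD.
Qed.

Lemma expect_sum I (s : seq I) (F : I -> T -> R) :
  (forall i, pint (F i)) ->
  \int[P]_x (\sum_(i <- s) F i x) = \sum_(i <- s) \int[P]_x F i x.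
Proof.
move=> intF; elim: s => [|i s ih].
  by under eq_Rintegral do rewrite big_nil; rewrite big_nil expect_cst.
under eq_Rintegral do rewrite big_cons.
by rewrite big_cons expectD// ?ih//; exact: pint_sum.
Qed.

Lemma expect_dist_cst f g (e : R) : pint f -> pint g ->
  (forall x, `|f x - g x| <= e) -> `|\int[P]_x f x - \int[P]_x g x| <= e.
Proof.
move=> intf intg fge; rewrite -[leRHS]expect_cst; apply: expect_dist => //.
by apply: bmeas_integrable; exact: bmeas_cst.
Qed.

Lemma expect_norm_le f (e : R) : pint f -> (forall x, `|f x| <= e) ->
  `|\int[P]_x f x| <= e.
Proof.
move=> intf fe; rewrite -[X in `|X|]subr0 -(expect_cst 0).
apply: expect_dist_cst => //; last by move=> x; rewrite subr0.
by apply: bmeas_integrable; exact: bmeas_cst.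
Qed.

Lemma expect_cvg_bounded (F : nat -> T -> R) f (M : R) :
  (forall n, measurable_fun [set: T] (F n)) ->
  (forall x, F n x @[n --> \oo] --> f x) -> (forall n x, `|F n x| <= M) ->
  \int[P]_x F n x @[n --> \oo] --> \int[P]_x f x.
Proof.
move=> mF Ff FM; apply: (@expect_cvg _ _ _ _ _ _ (fun _ => M)) => //.
by apply: bmeas_integrable; exact: bmeas_cst.
Qed.

Lemma expectE f : pint f -> ('E_P[f] = (\int[P]_x f x)%:E)%E.
Proof. by move=> intf; rewrite unlock fineK//; exact: integrable_fin_num. Qed.

End expectation.

(** * The space l2 *)

Lemma lipschitz_continuous (R : realType) (V : normedModType R) (f : V -> R) (K : R) :
  (forall x y, `|f x - f y| <= K * `|x - y|) -> continuous f.
Proof.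
move=> fK x; apply/cvgrPdist_lt => e e0.
(* [K] may be 0; the constant to divide by has to be positive. *)
have K1 : 0 < `|K| + 1 by rewrite ltr_wpDl.
near=> y.
rewrite (le_lt_trans (fK _ _))//.
rewrite (@le_lt_trans _ _ ((`|K| + 1) * `|x - y|))//.
  by rewrite ler_wpM2r// (le_trans (ler_norm _))// lerDl.
rewrite mulrC -ltr_pdivlMr//.
by near: y; apply: (@cvgr_dist_lt _ _ _ _ _ id); rewrite ?divr_gt0.
Unshelve. all: by end_near. Qed.

Section l2_basics.
Context {R : realType}.
Implicit Types (x y : l2 R) (k i l : nat).

(** Summability is a premise inside the existential, so that [to_l2] is total on sequences; the
    default value is 0. *)
Lemma l2_exists (u : nat -> R) : exists x : l2 R,
  (\sum_(k <oo) (u k ^+ 2)%:E < +oo)%E -> forall k, x k = u k.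
Proof.
have [uoo|nuoo] := pselect (\sum_(k <oo) (u k ^+ 2)%:E < +oo)%E; last by exists 0 => /nuoo.
have uL : u \in Lfun (counting : {measure set nat -> \bar R}) 2%:E.
  apply/andP; split; first by rewrite inE.
  rewrite inE /= /finite_norm Lnorm_counting// poweR_lty//.
  under eq_eseriesr do rewrite /= powR_mulrn// real_normK ?num_real//.
  exact: uoo.
by exists (Lfun_Sub (l2_exponent_ge1 R) uL).
Qed.

Definition to_l2 (u : nat -> R) : l2 R := projT1 (cid (l2_exists u)).

Lemma to_l2E u : (\sum_(k <oo) (u k ^+ 2)%:E < +oo)%E ->
  forall k, to_l2 u k = u k.
Proof. exact: projT2 (cid (l2_exists u)). Qed.

Lemma l2_coordD x y k : (x + y) k = x k + y k. Proof. by []. Qed.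
Lemma l2_coordB x y k : (x - y) k = x k - y k. Proof. by []. Qed.
Lemma l2_coordZ (a : R) x k : (a *: x) k = a * x k. Proof. by []. Qed.
Lemma l2_coord0 k : (0 : l2 R) k = 0. Proof. by []. Qed.

Lemma l2_coord_sum I (s : seq I) (p : pred I) (F : I -> l2 R) k :
  (\sum_(i <- s | p i) F i) k = \sum_(i <- s | p i) F i k.
Proof.
elim/big_rec2: _ => [|i a b _ <-]; first exact: l2_coord0.
exact: l2_coordD.
Qed.

Lemma l2_normE x : ((`|x| ^+ 2)%:E = \sum_(k <oo) (x k ^+ 2)%:E)%E.
Proof. exact: l2_norm_sqr. Qed.

Lemma l2_coord_le x k : `|x k| <= `|x|.
Proof.
rewrite -(@ler_pXn2r _ 2)// ?nnegrE//.
rewrite -lee_fin l2_normE real_normK ?num_real//.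
rewrite (@nneseriesD1 _ _ k)// => [|i _]; last by rewrite lee_fin sqr_ge0.
by rewrite leeDl//; apply: nneseries_ge0 => i _ _; rewrite lee_fin sqr_ge0.
Qed.

Definition l2_unit k : l2 R := to_l2 (fun i => (i == k)%:R).

Lemma l2_unitE k i : l2_unit k i = (i == k)%:R.
Proof.
apply: to_l2E; rewrite (@nneseriesD1 _ _ k)//.
rewrite eseries0; last by move=> j _ jk; rewrite /= (negbTE jk) expr0n.
by rewrite adde0 ltry.
Qed.

Lemma l2_norm_unit k : `|l2_unit k| = 1.
Proof.
apply/eqP; rewrite -(@eqrXn2 _ 2)// expr1n; apply/eqP/EFin_inj.
rewrite l2_normE (@nneseriesD1 _ _ k)//; last by move=> *; rewrite lee_fin sqr_ge0.
rewrite eseries0; last by move=> j _ jk; rewrite l2_unitE /= (negbTE jk) expr0n.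
by rewrite adde0 l2_unitE eqxx expr1n.
Qed.

Definition l2_trunc l x : l2 R := \sum_(k < l) x k *: l2_unit k.

Lemma l2_truncE l x i : l2_trunc l x i = if (i < l)%N then x i else 0.
Proof.
rewrite l2_coord_sum; under eq_bigr do rewrite l2_coordZ l2_unitE.
case: ltnP => il.
  rewrite (bigD1 (Ordinal il))//= eqxx mulr1 big1 ?addr0// => j ji.
  rewrite (_ : (i == j) = false) ?mulr0//.
  by apply: contraNF ji => /eqP e; apply/eqP/val_inj.
rewrite big1// => j _; rewrite gtn_eqF ?mulr0//.
exact: leq_trans (ltn_ord j) il.
Qed.

Lemma l2_norm_tail l x :
  ((`|x - l2_trunc l x| ^+ 2)%:E = \sum_(l <= k <oo) (x k ^+ 2)%:E)%E.
Proof.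
rewrite l2_normE (nneseries_split 0 l); last by move=> *; rewrite lee_fin sqr_ge0.
rewrite add0n big_nat_cond big1 ?add0e; last first.
  by move=> i /andP[/andP[_ il] _]; rewrite l2_coordB l2_truncE il subrr expr0n.
rewrite [LHS]eseries_cond [RHS]eseries_cond; apply: eq_eseriesr => i li.
by rewrite l2_coordB l2_truncE ltnNge (_ : (l <= i)%N) ?subr0.
Qed.

Lemma l2_trunc_cvg x : l2_trunc l x @[l --> \oo] --> x.
Proof.
apply/cvgrPdist_lt => e e0.
have xoo : (\sum_(k <oo) (x k ^+ 2)%:E < +oo)%E by rewrite -l2_normE ltry.
have x0 k : (0 <= (x k ^+ 2)%:E)%E by rewrite lee_fin sqr_ge0.
have /fine_cvgP[_ /cvgrPdist_lt h] := nneseries_tail_cvg xoo (fun k _ => x0 k).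
have /h : 0 < e ^+ 2 by rewrite exprn_gt0.
apply: filterS => l.
rewrite sub0r normrN /= -l2_norm_tail ger0_norm ?exprn_ge0// => hl.
by rewrite -(@ltr_pXn2r _ 2) ?nnegrE// ltW.
Qed.

Lemma l2_coord_continuous (k : nat) : continuous (fun x : l2 R => x k : R).
Proof.
apply: (@lipschitz_continuous _ (l2 R) _ 1) => x y.
by rewrite mul1r -l2_coordB l2_coord_le.
Qed.

Lemma l2_continuous_measurable (V : normedModType R) (f : l2 R -> V) :
  continuous f -> forall A : set V, open A -> measurable (f @^-1` A).
Proof. by move=> /continuousP cf A oA; apply: sub_sigma_algebra; exact: cf. Qed.

Lemma l2_continuous_measurable_fun (f : l2 R -> R) :
  continuous f -> measurable_fun [set: l2 R] f.
Proof.
move=> cf; apply: (measurability _ (RGenOpens.measurableE R)) => _ [_ [a [b ->] <-]].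
rewrite setTI; apply: l2_continuous_measurable => //; exact: interval_open.
Qed.

Lemma l2_coord_measurable (k : nat) : measurable_fun [set: l2 R] (fun x : l2 R => x k : R).
Proof.
apply: (@l2_continuous_measurable_fun (fun x : l2 R => x k : R)).
exact: l2_coord_continuous.
Qed.

End l2_basics.

(** * Measurability of maps into l2 *)

Section l2_measurability.
Context {R : realType} {d} {T : measurableType d}.
Implicit Types (X Y : T -> l2 R).

Lemma measurable_coord X (k : nat) : measurable_fun [set: T] X ->
  measurable_fun [set: T] (fun t => X t k : R).
Proof. by move=> mX; apply: (measurableT_comp (l2_coord_measurable k)). Qed.

Lemma l2_dist_measurable X (c : l2 R) :
  (forall k : nat, measurable_fun [set: T] (fun t => X t k : R)) ->
  measurable_fun [set: T] (fun t => (`|X t - c| ^+ 2)%:E).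
Proof.
move=> mX; under eq_fun do rewrite l2_normE.
apply: ge0_emeasurable_sum => [k t _ _|k _]; first by rewrite lee_fin sqr_ge0.
apply/measurable_EFinP; apply: measurable_funX.
under eq_fun do rewrite l2_coordB.
exact: measurable_funB.
Qed.

Lemma l2_norm_sqr_measurable X :
  (forall k : nat, measurable_fun [set: T] (fun t => X t k : R)) ->
  measurable_fun [set: T] (fun t => `|X t| ^+ 2).
Proof.
move=> mX; apply/measurable_EFinP.
rewrite (_ : _ \o _ = fun t => (`|X t - 0| ^+ 2)%:E); first exact: l2_dist_measurable.
by apply/funext => t; rewrite subr0.
Qed.

(** Finitely supported rational sequences: a dense set indexed by the countable type [seq rat]. *)
Definition l2_rational (s : seq rat) : l2 R :=
  \sum_(k < size s) ratr s`_k *: l2_unit k.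

Lemma l2_rational_dense (x : l2 R) (e : R) : 0 < e ->
  exists s, `|x - l2_rational s| < e.
Proof.
move=> e0; have e2 : 0 < e / 2 by rewrite divr_gt0.
have /cvgrPdist_lt/(_ _ e2)[l _ /(_ l (leqnn l)) hl] := @l2_trunc_cvg _ x.
(* The truncation costs [e / 2], and each of the [l] kept coordinates at most this much. *)
have el : 0 < e / 2 / l.+1%:R by rewrite divr_gt0.
have /choice[q hq] : forall k : nat, exists q : rat,
    x k < ratr q < x k + e / 2 / l.+1%:R.
  move=> k; have /rat_in_itvoo[q qx] : x k < x k + e / 2 / l.+1%:R by rewrite ltrDl.
  by exists q; move: qx; rewrite in_itv.
exists (mkseq q l); rewrite -(subrKA (l2_trunc l x)) (le_lt_trans (ler_normD _ _))//.
rewrite (splitr e) ltr_leD//.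
rewrite /l2_rational size_mkseq /l2_trunc -sumrB (le_trans (ler_norm_sum _ _ _))//.
rewrite (@le_trans _ _ (\sum_(k < l) e / 2 / l.+1%:R))//.
  apply: ler_sum => k _; rewrite nth_mkseq// -scalerBl normrZ l2_norm_unit mulr1.
  have /andP[h1 h2] := hq k.
  by rewrite ler0_norm ?subr_le0 ?(ltW h1)// opprB lerBlDl ltW.
rewrite sumr_const card_ord -mulrnAr -[leRHS]mulr1 ler_wpM2l ?(ltW e2)//.
by rewrite -mulr_natl ler_pdivrMr// mul1r ler_nat.
Qed.

(** By separability an open set is a countable union of balls with rational centers and radii, and a
    ball has a measurable preimage because the squared distance to its center is a series of
    measurable functions of the coordinates. *)
Lemma measurable_l2 X :
  (forall k : nat, measurable_fun [set: T] (fun t => X t k : R)) ->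
  measurable_fun [set: T] X.
Proof.
move=> mX.
apply: (@measurability _ _ _ _ setT X (@open (l2 R))) => //.
move=> _ [U oU <-]; rewrite setTI.
pose B (p : seq rat * rat) := [set t | (`|X t - l2_rational p.1| ^+ 2)%:E < (ratr p.2 ^+ 2)%:E]%E.
have mB p : measurable (B p).
  rewrite /B -[X in measurable X]setTI; apply: emeasurable_fun_infty_o => //.
  exact: l2_dist_measurable.
have -> : X @^-1` U = \bigcup_(p in [set p | 0 < p.2 /\
    (forall y, `|y - l2_rational p.1| < ratr p.2 -> U y)]) B p.
  apply/seteqP; split => t /=.
    move=> Ut; have /nbhs_ballP[e /= e0 eU] : nbhs (X t) U by apply: open_nbhs_nbhs.
    have e2 : 0 < e / 2 by rewrite divr_gt0.
    have /rat_in_itvoo[q] := e2; rewrite in_itv/= => /andP[q0 qe].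
    have [s hs] := l2_rational_dense (X t) q0.
    exists (s, q) => /=; last by rewrite /B/= lte_fin ltr_pXn2r ?nnegrE// ltW.
    split; first by rewrite -(ltr0q R).
    move=> y hy; apply: eU; rewrite -ball_normE /ball_ /=.
    rewrite -(subrKA (l2_rational s)) (le_lt_trans (ler_normD _ _))//.
    rewrite (splitr e) ltrD// ?(lt_trans hs)//.
    by rewrite distrC (lt_trans hy).
  move=> [[s q] /= [q0 h]]; rewrite /B/= lte_fin => hs; apply: h.
  by rewrite -(@ltr_pXn2r _ 2) ?nnegrE// ler0q ltW.
rewrite bigcup_mkcond; apply: countable_bigcupT_measurable => [|p].
  exact: countableP.
by case: ifPn.
Qed.

End l2_measurability.

(** * Independence *)

(** These three facts are what bounded convergence consumes in the limit clause of [bmeas_ind]. *)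
Lemma bmeas_unif {R : realType} {d} {T : measurableType d} (f : T -> R)
    (F : nat -> T -> R) :
  (forall n, bmeas (F n)) -> (forall n x, `|f x - F n x| <= n.+1%:R^-1) ->
  [/\ bmeas f, exists M : R, forall n x, `|F n x| <= M &
    forall x, F n x @[n --> \oo] --> f x].
Proof.
move=> bF fF.
have Ff x : F n x @[n --> \oo] --> f x.
  apply/cvgrPdist_le => e e0.
  near=> n; rewrite (le_trans (fF n x))// -[leRHS]invrK lef_pV2 ?posrE ?invr_gt0//.
  by rewrite -natr1 ler_wpDr//; near: n; exact: nbhs_infty_ger.
have mf : measurable_fun [set: T] f.
  by apply: (measurable_fun_cvg (fun n => (bF n).1)) => x _; exact: Ff.
have i1 n : n.+1%:R^-1 <= 1 :> R by rewrite invf_le1// ler1n.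
have [_ [M FM]] := bF 0.
have fM x : `|f x| <= M + 1.
  rewrite -[f x](subrK (F 0 x)) addrC (le_trans (ler_normD _ _))// lerD//.
  exact: le_trans (fF 0 x) (i1 0).
split => //; first by split => //; exists (M + 1).
exists (M + 1 + 1) => n x.
rewrite -[F n x](subrK (f x)) addrC (le_trans (ler_normD _ _))// lerD//.
by rewrite distrC (le_trans (fF n x)).
Unshelve. all: by end_near. Qed.

Lemma bmeas_comp {R : realType} {d d'} {T : measurableType d}
    {T' : measurableType d'} (X : T -> T') (g : T' -> R) :
  measurable_fun [set: T] X -> bmeas g -> bmeas (fun t => g (X t)).
Proof.
move=> mX [mg [M gM]]; split; first exact: measurableT_comp.
by exists M => t.
Qed.

Section independence.
Context {R : realType} {d d'} {T : measurableType d} {T' : measurableType d'}.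
Variables (P : probability T R) (I : finType) (X : I -> {RV P >-> T'}).
Hypothesis indepX : mutually_independent X.

Let mX i : measurable_fun [set: T] (X i). Proof. exact: measurable_funPT. Qed.

Let prod_formula (g : I -> T' -> R) :=
  \int[P]_t (\prod_i g i (X i t)) = \prod_i \int[P]_t g i (X i t).

Let prod_formula_indic (A : I -> set T') : (forall i, measurable (A i)) ->
  prod_formula (fun i => \1_(A i)).
Proof.
move=> mA; rewrite /prod_formula.
have mXA i : measurable (X i @^-1` A i).
  by rewrite -[Y in measurable Y]setTI; exact: mX.
have -> : (fun t => \prod_i \1_(A i) (X i t)) =
    \1_(\bigcap_(i in [set` [set: I]%SET]) (X i @^-1` A i)) :> (T -> R).
  apply/funext => t; rewrite indicE; case: (boolP (t \in _)).
    rewrite inE => At; rewrite big1// => i _; rewrite indicE mem_set//.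
    by apply: At; rewrite /= finset.in_setT.
  move=> nAt; have [i nAi] : exists i, ~ A i (X i t).
    apply: contrapT => h; move/negP: nAt; apply; rewrite inE => i _ /=.
    by apply: contrapT => nAi; apply: h; exists i.
  by rewrite (bigD1 i)//= indicE memNset// mul0r.
have mcap : measurable (\bigcap_(i in [set` [set: I]%SET]) (X i @^-1` A i)).
  by apply: fin_bigcap_measurable => // i _; exact: mXA.
transitivity (fine (P (\bigcap_(i in [set` [set: I]%SET]) (X i @^-1` A i)))).
  by rewrite /Rintegral integral_indic// setIT.
rewrite (indepX _ mA).
rewrite (eq_bigr (fun i => (fine (P (X i @^-1` A i)))%:E)); last first.
  by move=> i _; rewrite fineK// fin_num_measure.
rewrite prodEFin/=; apply: eq_big => [i|i _]; first by rewrite finset.in_setT.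
rewrite /Rintegral -[X in _ = fine X](_ : \int[P]_t (\1_(X i @^-1` A i) t)%:E = _)%E//.
by rewrite integral_indic// setIT.
Qed.

Lemma indep_expect_prod (g : I -> T' -> R) : (forall i, bmeas (g i)) ->
  \int[P]_t (\prod_i g i (X i t)) = \prod_i \int[P]_t g i (X i t).
Proof.
(* The indices in [s] carry arbitrary bounded functions, the others indicators. Induction on [s]
   frees one factor at a time, by [bmeas_ind] in that slot with the remaining product [W] as a fixed
   weight. *)
suff H (s : seq I) : forall g, (forall i, bmeas (g i)) ->
    (forall i, i \notin s -> exists2 A, measurable A & g i = \1_A) ->
    prod_formula g.
  by move=> bg; apply: (H (enum I)) => // i; rewrite mem_enum.
elim: s => [{}g bg g1|i s ih {}g bg g1].
  have /choice[A hA] : forall i, exists A, measurable A /\ g i = \1_A.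
    by move=> i; have [A mA gA] := g1 i isT; exists A.
  have -> : g = fun i => \1_(A i) by apply/funext => i; case: (hA i).
  by apply: prod_formula_indic => i; case: (hA i).
pose G h j := if j == i then h else g j.
have Gj h j : j != i -> G h j = g j by rewrite /G => /negbTE ->.
have Gi h : G h i = h by rewrite /G eqxx.
pose W t := \prod_(j | j != i) g j (X j t).
pose K := \prod_(j | j != i) \int[P]_t g j (X j t).
have bW : bmeas W.
  rewrite /W; under eq_fun do rewrite -big_filter.
  by apply: bmeas_prod => j; apply: bmeas_comp.
have bX (h : T' -> R) : bmeas h -> bmeas (fun t => h (X i t)) by exact: bmeas_comp.
have GE h : prod_formula (G h) <->
    \int[P]_t (h (X i t) * W t) = \int[P]_t h (X i t) * K.
  rewrite /prod_formula (bigD1 i)//= Gi.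
  rewrite [X in _ * X](eq_bigr (fun j => \int[P]_t g j (X j t))); last first.
    by move=> j ji; rewrite Gj.
  under eq_Rintegral => t _.
    rewrite (bigD1 i)//= Gi (eq_bigr (fun j => g j (X j t))); last first.
      by move=> j ji; rewrite Gj.
    over.
  by [].
suff : bmeas (g i) /\ prod_formula (G (g i)).
  by case=> _; congr prod_formula; apply/funext => j; rewrite /G; case: eqP => // ->.
apply: (@bmeas_ind _ _ _ (fun h => bmeas h /\ prod_formula (G h))) => //.
- move=> A mA; split; first exact: bmeas_indic.
  apply: ih => [j|j js].
    by rewrite /G; case: eqP => // _; exact: bmeas_indic.
  rewrite /G; case: eqP => [_|/eqP ji]; first by exists A.
  by apply: g1; rewrite inE negb_or ji.
- move=> f h [bf /GE Hf] [bh /GE Hh]; split; first exact: bmeasD.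
  apply/GE; under eq_Rintegral do rewrite mulrDl.
  rewrite (expectD (bmeas_integrable P (bmeasM (bX _ bf) bW))
    (bmeas_integrable P (bmeasM (bX _ bh) bW))).
  by rewrite (expectD (bmeas_integrable P (bX _ bf))
    (bmeas_integrable P (bX _ bh))) Hf Hh mulrDl.
- move=> c f [bf /GE Hf]; split; first exact: bmeasZ.
  apply/GE; under eq_Rintegral do rewrite -mulrA.
  rewrite (expectZ c (bmeas_integrable P (bmeasM (bX _ bf) bW))) Hf.
  by rewrite (expectZ c (bmeas_integrable P (bX _ bf))) mulrA.
- move=> f F HF fF; have [bf [M FM] Ff] := bmeas_unif (fun n => (HF n).1) fF.
  split => //; apply/GE.
  have [mW [N WN]] := bW.
  have h1 : \int[P]_t (F n (X i t) * W t) @[n --> \oo] --> \int[P]_t (f (X i t) * W t).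
    apply: (@expect_cvg_bounded _ _ _ _ _ _ (M * N)) => [n|t|n t].
    - by case: (bmeasM (bX _ (HF n).1) bW).
    - by apply: cvgM; [exact: Ff|exact: cvg_cst].
    - by rewrite normrM ler_pM.
  have h2 : \int[P]_t (F n (X i t)) * K @[n --> \oo] --> \int[P]_t (f (X i t)) * K.
    apply: cvgM; last exact: cvg_cst.
    apply: (@expect_cvg_bounded _ _ _ _ _ _ M) => [n|t|n t //].
    - by case: (bX _ (HF n).1).
    - exact: Ff.
  have e : (fun n => \int[P]_t (F n (X i t) * W t)) =
           (fun n => \int[P]_t (F n (X i t)) * K).
    by apply/funext => n; apply/GE; case: (HF n).
  by rewrite e in h1; exact: (cvg_unique _ h1 h2).
Qed.

Let indep_expectM_bounded i j (u v : T' -> R) : i != j -> bmeas u -> bmeas v ->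
  \int[P]_t (u (X i t) * v (X j t)) =
  \int[P]_t u (X i t) * \int[P]_t v (X j t).
Proof.
move=> ij bu bv.
have ji : j != i by rewrite eq_sym.
pose g k := if k == i then u else if k == j then v else fun=> 1.
have := @indep_expect_prod g; rewrite (bigD1 i)//= (bigD1 j)//= big1; last first.
  by move=> k /andP[/negbTE ki /negbTE kj]; rewrite /g ki kj expect_cst.
under eq_Rintegral.
  move=> t _; rewrite (bigD1 i)//= (bigD1 j)//= big1; last first.
    by move=> k /andP[/negbTE ki /negbTE kj]; rewrite /g ki kj.
  rewrite /g eqxx (negbTE ji) eqxx mulr1; over.
rewrite /g eqxx (negbTE ji) eqxx mulr1; apply=> k.
by case: eqP => // _; case: eqP => // _; exact: bmeas_cst.
Qed.

(** Both factors are truncated at level [n], where the bounded case applies. The products are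
    dominated by [u ^+ 2 + v ^+ 2], each single factor [w] by [w ^+ 2 + 1]. *)
Lemma indep_expectM i j (u v : T' -> R) : i != j ->
  measurable_fun [set: T'] u -> measurable_fun [set: T'] v ->
  P.-integrable [set: T] (EFin \o (fun t => u (X i t) ^+ 2)) ->
  P.-integrable [set: T] (EFin \o (fun t => v (X j t) ^+ 2)) ->
  \int[P]_t (u (X i t) * v (X j t)) =
  \int[P]_t u (X i t) * \int[P]_t v (X j t).
Proof.
move=> ij mu mv iu iv.
pose tr (w : T' -> R) n x := w x * \1_[set y | `|w y| <= n%:R] x.
have trE (w : T' -> R) n x : `|tr w n x| <= `|w x|.
  by rewrite /tr indicE; case: (_ \in _) => /=; rewrite ?mulr1// mulr0 normr0.
have btr (w : T' -> R) n : measurable_fun [set: T'] w -> bmeas (tr w n).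
  move=> mw; split.
    apply: measurable_funM => //; apply: measurable_indic.
    rewrite (_ : [set y | _] = [set: T'] `&` w @^-1` `[- n%:R, n%:R]); first exact: mw.
    by apply/seteqP; split => y /=; rewrite in_itv/= -ler_norml// => -[].
  exists n%:R => x; rewrite /tr indicE; case: (boolP (x \in _)) => [|_].
    by rewrite inE/= mulr1.
  by rewrite mulr0 normr0.
have trc (w : T' -> R) x : tr w n x @[n --> \oo] --> w x.
  apply: cvg_near_cst; near=> n.
  rewrite /tr indicE mem_set ?mulr1//=.
  by near: n; exact: nbhs_infty_ger.
have mcomp k n (w : T' -> R) : measurable_fun [set: T'] w ->
    measurable_fun [set: T] (fun t => tr w n (X k t)).
  by move=> mw; case: (bmeas_comp (mX k) (btr w n mw)).
have sq_le (a : R) : `|a| <= a ^+ 2 + 1.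
  by rewrite -(real_normK (num_real a)); have := sqr_ge0 (`|a| - 2^-1); lra.
have i1 : P.-integrable [set: T] (EFin \o (fun=> 1 : R)).
  by apply: bmeas_integrable; exact: bmeas_cst.
have cv k (w : T' -> R) : measurable_fun [set: T'] w ->
    P.-integrable [set: T] (EFin \o (fun t => w (X k t) ^+ 2)) ->
    \int[P]_t tr w n (X k t) @[n --> \oo] --> \int[P]_t w (X k t).
  move=> mw iw; apply: (@expect_cvg _ _ _ _ _ _ (fun t => w (X k t) ^+ 2 + 1)) => //.
  - by move=> n; exact: mcomp.
  - exact: pintD.
  - by move=> n t; rewrite (le_trans (trE _ _ _)).
have h1 : \int[P]_t (tr u n (X i t) * tr v n (X j t)) @[n --> \oo] -->
    \int[P]_t (u (X i t) * v (X j t)).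
  apply: (@expect_cvg _ _ _ _ _ _ (fun t => u (X i t) ^+ 2 + v (X j t) ^+ 2)).
  - by move=> n; apply: measurable_funM; exact: mcomp.
  - exact: pintD.
  - by move=> t; apply: cvgM; exact: trc.
  - move=> n t; rewrite normrM (@le_trans _ _ (`|u (X i t)| * `|v (X j t)|))//.
      by rewrite ler_pM.
    rewrite -[leRHS](_ : `|u (X i t)| ^+ 2 + `|v (X j t)| ^+ 2 = _)//; last first.
      by rewrite !real_normK ?num_real.
    move: (normr_ge0 (u (X i t))) (normr_ge0 (v (X j t))).
    move: `|u _| `|v _| => a b a0 b0.
    by have := sqr_ge0 (a - b); have := mulr_ge0 a0 b0; nra.
have h2 : \int[P]_t tr u n (X i t) * \int[P]_t tr v n (X j t) @[n --> \oo] -->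
    \int[P]_t u (X i t) * \int[P]_t v (X j t) by apply: cvgM; exact: cv.
have e : (fun n => \int[P]_t (tr u n (X i t) * tr v n (X j t))) =
         (fun n => \int[P]_t tr u n (X i t) * \int[P]_t tr v n (X j t)).
  by apply/funext => n; rewrite indep_expectM_bounded//; exact: btr.
by rewrite e in h1; exact: (cvg_unique _ h1 h2).
Unshelve. all: by end_near. Qed.

End independence.

(** * Characteristic functions of sums *)

Section trigonometric_bounds.
Context {R : realType}.
Implicit Types x y : R.

(** Bounding the derivative by its largest value, instead of integrating it, is why the cubic and
    quartic bounds have the constant 1/2 where Taylor's formula has 1/6 and 1/24. *)
Let mvt_bound (f df : R -> R) x (K : R) : 0 <= x ->
  (forall y, is_derive y 1 f (df y)) ->
  (forall y, 0 <= y <= x -> `|df y| <= K) -> `|f x - f 0| <= K * x.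
Proof.
move=> x0 dfE dfK.
have cf : {within `[0, x], continuous f}.
  by apply: derivable_within_continuous => y _; case: (dfE y).
have [c] := MVT_segment x0 (fun y _ => dfE y) cf.
rewrite in_itv/= => cx ->.
by rewrite subr0 normrM (ger0_norm x0) ler_wpM2r// dfK.
Qed.

Lemma sin_norm_le x : `|sin x| <= `|x|.
Proof.
wlog x0 : x / 0 <= x => [h|].
  have [/h//|x0] := leP 0 x.
  have := h (- x); rewrite sinN !normrN; apply.
  by rewrite oppr_ge0 ltW.
have := @mvt_bound sin cos x 1 x0 (@is_derive_sin R) (fun y _ => cos_max y).
by rewrite sin0 subr0 mul1r (ger0_norm x0).
Qed.

Lemma cos_sub1_bound x : `|cos x - 1| <= x ^+ 2 / 2.
Proof.
have -> : cos x - 1 = - (sin (x / 2) ^+ 2 *+ 2).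
  have {1}-> : x = (x / 2) *+ 2 by rewrite -mulr_natr divfK.
  by rewrite cos_mulr2n cos2sin2; ring.
rewrite normrN ger0_norm ?mulrn_wge0 ?sqr_ge0//.
have := sin_norm_le (x / 2).
rewrite -(@ler_pXn2r _ 2) ?nnegrE// !real_normK ?num_real// exprMn.
by rewrite -mulr_natr; lra.
Qed.

Let sin_cubic x : `|sin x - x| <= `|x| ^+ 3 / 2.
Proof.
wlog x0 : x / 0 <= x => [h|].
  have [/h//|x0] := leP 0 x.
  have := h (- x); rewrite sinN -opprD !normrN; apply.
  by rewrite oppr_ge0 ltW.
have dE y : is_derive y 1 (fun z => sin z - z) (cos y - 1) by exact: is_deriveB.
have := @mvt_bound _ _ x (x ^+ 2 / 2) x0 dE.
rewrite sin0 !subr0 (ger0_norm x0) => h.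
rewrite (le_trans (h _))//; last by rewrite le_eqVlt; apply/orP; left; apply/eqP; ring.
move=> y /andP[y0 yx]; rewrite (le_trans (cos_sub1_bound y))// ler_wpM2r//.
by rewrite ler_pXn2r.
Qed.

Lemma cos_quartic x : `|cos x - (1 - x ^+ 2 / 2)| <= x ^+ 4 / 2.
Proof.
wlog x0 : x / 0 <= x => [h|].
  have [/h//|x0] := leP 0 x.
  have e4 : (- x) ^+ 4 = x ^+ 4 by ring.
  have := h (- x); rewrite cosN sqrrN e4; apply.
  by rewrite oppr_ge0 ltW.
have dE y : is_derive y 1 (fun z => cos z - (1 - z ^+ 2 / 2)) (- (sin y - y)).
  apply: is_derive_eq; rewrite /GRing.scale/=; lra.
have := @mvt_bound _ _ x (x ^+ 3 / 2) x0 dE.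
rewrite cos0 expr0n /= mul0r !subr0 subrr subr0 => h.
rewrite (le_trans (h _))//; last by rewrite le_eqVlt; apply/orP; left; apply/eqP; ring.
move=> y /andP[y0 yx]; rewrite normrN (le_trans (sin_cubic y))// ler_wpM2r//.
by rewrite (ger0_norm y0) ler_pXn2r.
Qed.

(** Lindeberg's dichotomy. If [|x| <= e <= 1] then [x^2 <= e], and the quartic error is at most
    [e x^2]; beyond [e] the crude quadratic error is charged to the truncated second moment. *)
Lemma cos_taylor_bound (e : R) x : 0 < e -> e <= 1 ->
  `|cos x - (1 - x ^+ 2 / 2)| <= e * x ^+ 2 + x ^+ 2 * (e < `|x|)%R%:R.
Proof.
move=> e0 e1; case: ltP => xe /=; last first.
  rewrite mulr0 addr0 (le_trans (cos_quartic _))//.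
  have h : `|x| * `|x| <= e * 1 by rewrite ler_pM// (le_trans xe).
  rewrite -expr2 (real_normK (num_real x)) mulr1 in h.
  have h4 : 0 <= x ^+ 2 * (e - x ^+ 2) by rewrite mulr_ge0 ?sqr_ge0// subr_ge0.
  have h5 : 0 <= e * x ^+ 2 by rewrite mulr_ge0 ?sqr_ge0// ltW.
  by rewrite (_ : x ^+ 4 = x ^+ 2 * x ^+ 2); [lra|ring].
rewrite mulr1.
have -> : cos x - (1 - x ^+ 2 / 2) = (cos x - 1) + x ^+ 2 / 2 by lra.
rewrite (le_trans (ler_normD _ _))//.
have := cos_sub1_bound x; have x2 := sqr_ge0 x.
rewrite (ger0_norm (_ : 0 <= x ^+ 2 / 2)) ?divr_ge0// => h.
have : 0 <= e * x ^+ 2 by rewrite mulr_ge0// ltW.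
lra.
Qed.

(** The cubic error is absorbed as for the cosine; the factor 2 comes from
    [|sin x - x| <= 2 |x| <= 2 x^2] when [|x| > 1]. *)
Lemma sin_taylor_bound (e : R) x : 0 < e -> e <= 1 ->
  `|sin x - x| <= e * x ^+ 2 + 2 * (x ^+ 2 * (e < `|x|)%R%:R).
Proof.
move=> e0 e1; rewrite -(real_normK (num_real x)).
have h3 := sin_cubic x; have a0 := normr_ge0 x.
case: ltP => xe /=; last first.
  rewrite !mulr0 addr0 (le_trans h3)//.
  move: xe a0; move: `|x| => a xe a0.
  have : 0 <= a ^+ 2 * (e - a) by rewrite mulr_ge0 ?sqr_ge0// subr_ge0.
  have : 0 <= e * a ^+ 2 by rewrite mulr_ge0 ?sqr_ge0// ltW.
  by rewrite (_ : a ^+ 3 = a ^+ 2 * a); [lra|ring].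
rewrite mulr1.
have : 0 <= e * `|x| ^+ 2 by rewrite mulr_ge0 ?sqr_ge0// ltW.
have [x1|x1] := leP `|x| 1.
  have : 0 <= `|x| ^+ 2 * (1 - `|x|) by rewrite mulr_ge0 ?sqr_ge0// subr_ge0.
  have := sqr_ge0 `|x|.
  move: h3; rewrite (_ : `|x| ^+ 3 = `|x| ^+ 2 * `|x|); last by ring.
  by lra.
have : 0 <= (`|x| - 1) * `|x| by rewrite mulr_ge0// subr_ge0 ltW.
have := ler_normB (sin x) x; have := sin_norm_le x.
by rewrite (_ : `|x| ^+ 2 = `|x| * `|x|); [lra|ring].
Qed.

Lemma expR_bound y : 0 <= y -> `|1 - y - expR (- y)| <= y ^+ 2.
Proof.
move=> y0; have h1 := expR_ge1Dx (- y); have h2 := expR_ge1Dx y.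
have y1 : 0 < 1 + y by rewrite ltr_wpDr.
have h3 : expR (- y) <= 1 - y + y ^+ 2.
  rewrite expRN; apply: (@le_trans _ _ (1 + y)^-1).
    by rewrite lef_pV2 ?posrE// expR_gt0.
  rewrite -[leLHS]mul1r ler_pdivrMr//.
  have -> : (1 - y + y ^+ 2) * (1 + y) = 1 + y ^+ 3 by ring.
  by rewrite lerDl exprn_ge0.
by rewrite ler_norml; have := sqr_ge0 y; lra.
Qed.

Lemma exprB_bound (a b : R) n : `|a| <= 1 -> `|b| <= 1 ->
  `|a ^+ n - b ^+ n| <= n%:R * `|a - b|.
Proof.
move=> a1 b1; elim: n => [|n ih]; first by rewrite !expr0 subrr normr0 mul0r.
have -> : a ^+ n.+1 - b ^+ n.+1 = a * (a ^+ n - b ^+ n) + (a - b) * b ^+ n.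
  by rewrite !exprS; ring.
rewrite (le_trans (ler_normD _ _))// !normrM -natr1 mulrDl mul1r lerD//.
  by rewrite (le_trans _ ih)// ler_piMl.
by rewrite ler_piMr// normrX exprn_ile1.
Qed.

(** With [N = n + 1], the base is compared with [expR (- v n / (2 N))]. The [N]-th powers differ by
    at most [N (v n / (2 N))^2], which is of order [1 / N]. *)
Lemma cvg_exprn_expR (v : nat -> R) (l : R) : (forall n, 0 <= v n) ->
  v n @[n --> \oo] --> l ->
  (1 - v n / (2 * n.+1%:R)) ^+ n.+1 @[n --> \oo] --> expR (- (l / 2)).
Proof.
move=> v0 vl.
have h1 : expR (- (v n / 2)) @[n --> \oo] --> expR (- (l / 2)).
  apply: continuous_cvg; first exact: continuous_expR.
  by apply: cvgN; apply: cvgMl.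
have i0 : (n.+1%:R^-1 : R) @[n --> \oo] --> (0 : R) by exact: cvg_harmonic.
have h2 : (v n / 2) ^+ 2 * n.+1%:R^-1 @[n --> \oo] --> (l / 2) ^+ 2 * 0.
  apply: cvgM => //; apply: (@cvg_comp _ _ _ _ (fun x : R => x ^+ 2)) (@sqr_continuous R _).
  by apply: cvgMl.
rewrite mulr0 in h2.
have h3 : v n * n.+1%:R^-1 @[n --> \oo] --> (0 : R).
  by rewrite -(mulr0 l); apply: cvgM.
pose D n := (1 - v n / (2 * n.+1%:R)) ^+ n.+1 - expR (- (v n / 2)).
have D0 : D n @[n --> \oo] --> (0 : R).
  apply/cvgr0Pnorm_le => e e0; near=> n.
  have n0 : n.+1%:R != 0 :> R by [].
  have y0 : 0 <= v n / (2 * n.+1%:R) by rewrite divr_ge0.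
  have y1 : v n / (2 * n.+1%:R) <= 1.
    rewrite invfM mulrCA -[leRHS](@mulVf _ 2)// ler_wpM2l//.
    rewrite (@le_trans _ _ 1) ?ler1n//.
    by near: n; exact: (cvgr_le _ h3).
  rewrite /D; have -> : - (v n / 2) = - (v n / (2 * n.+1%:R)) * n.+1%:R.
    by field.
  rewrite expRM_natr (le_trans (exprB_bound _ _ _))//.
  - move: y0 y1; move: (v n / _) => y y0 y1.
    by rewrite ler_norml; apply/andP; split; lra.
  - by rewrite ger0_norm ?expR_ge0// expR_le1 oppr_le0.
  rewrite (@le_trans _ _ ((v n / 2) ^+ 2 * n.+1%:R^-1))//; last first.
    by near: n; exact: (cvgr_le _ h2).
  rewrite (@le_trans _ _ (n.+1%:R * (v n / (2 * n.+1%:R)) ^+ 2))//.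
    by rewrite ler_wpM2l// expR_bound.
  by rewrite le_eqVlt; apply/orP; left; apply/eqP; field.
rewrite -[X in _ --> X]add0r.
apply: cvg_trans (cvgD D0 h1); apply: near_eq_cvg; apply: nearW => n /=.
by rewrite /D subrK.
Unshelve. all: by end_near. Qed.

End trigonometric_bounds.

Section bmeas_trig.
Context {R : realType} {d} {T : measurableType d}.

Lemma bmeas_cos (u : T -> R) : measurable_fun [set: T] u -> bmeas (fun t => cos (u t)).
Proof.
move=> mu; split; last by exists 1 => t; exact: cos_max.
by apply: measurableT_comp => //; apply: continuous_measurable_fun; exact: continuous_cos.
Qed.

Lemma bmeas_sin (u : T -> R) : measurable_fun [set: T] u -> bmeas (fun t => sin (u t)).
Proof.
move=> mu; split; last by exists 1 => t; exact: sin_max.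
by apply: measurableT_comp => //; apply: continuous_measurable_fun; exact: continuous_sin.
Qed.

End bmeas_trig.

(* The characteristic function [c + i s] of a sum of independent variables is
   the product of theirs; [prod_formula] is all that is used of independence. *)
Section cos_sum.
Context {R : realType} {d d'} {T : measurableType d} {T' : measurableType d'}.
Variables (P : probability T R) (I : finType) (X : I -> T -> T').
Hypothesis mX : forall i, measurable_fun [set: T] (X i).
Variable u : I -> T' -> R.
Hypothesis mu : forall i, measurable_fun [set: T'] (u i).
Hypothesis prod_formula : forall g : I -> T' -> R,
  (forall i, bmeas (g i)) ->
  \int[P]_t (\prod_i g i (X i t)) = \prod_i \int[P]_t g i (X i t).

Let c i := \int[P]_t cos (u i (X i t)).
Let s i := \int[P]_t sin (u i (X i t)).

Fixpoint char_prod (c s : I -> R) (l : seq I) : R * R :=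
  if l is i :: l' then let p := char_prod c s l' in
    (p.1 * c i - p.2 * s i, p.2 * c i + p.1 * s i) else (1, 0).

(** The extra factors [g], equal to 1 on [l], make the induction close: expanding the cosine or sine
    of the sum at the head [i] leaves a factor [cos (u i)] or [sin (u i)], which is moved into slot
    [i] of [g]. *)
Let char_sum (l : seq I) (g : I -> T' -> R) : uniq l ->
  (forall i, bmeas (g i)) -> (forall i, i \in l -> g i = fun=> 1) ->
  \int[P]_t (cos (\sum_(i <- l) u i (X i t)) * \prod_i g i (X i t)) =
    (char_prod c s l).1 * \prod_i \int[P]_t g i (X i t) /\
  \int[P]_t (sin (\sum_(i <- l) u i (X i t)) * \prod_i g i (X i t)) =
    (char_prod c s l).2 * \prod_i \int[P]_t g i (X i t).
Proof.
have mS (r : seq I) : measurable_fun [set: T] (fun t => \sum_(i <- r) u i (X i t)).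
  by apply: measurable_sum => i; apply: measurableT_comp.
elim: l g => [|i l ih] g.
  move=> _ bg _; split.
    under eq_Rintegral do rewrite big_nil cos0 mul1r.
    by rewrite mul1r prod_formula.
  under eq_Rintegral do rewrite big_nil sin0 mul0r.
  by rewrite mul0r expect_cst.
move=> /= /andP[il ul] bg g1.
pose G (h : T' -> R) j := if j == i then h else g j.
have bG h : bmeas h -> forall j, bmeas (G h j).
  by move=> bh j; rewrite /G; case: eqP.
have Gl h j : j \in l -> G h j = fun=> 1.
  move=> jl; rewrite /G; case: eqP => [ji|_]; first by rewrite -ji jl in il.
  by apply: g1; rewrite inE jl orbT.
have gi : g i = fun=> 1 by apply: g1; rewrite mem_head.
have GE h t : \prod_j G h j (X j t) = h (X i t) * \prod_j g j (X j t).
  rewrite (bigD1 i)//= [in RHS](bigD1 i)//= gi mul1r /G eqxx; congr (_ * _).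
  by apply: eq_bigr => j /negbTE ->.
have GI h : \prod_j \int[P]_t G h j (X j t) =
    \int[P]_t h (X i t) * \prod_j \int[P]_t g j (X j t).
  rewrite (bigD1 i)//= [in RHS](bigD1 i)//= gi expect_cst mul1r /G eqxx; congr (_ * _).
  by apply: eq_bigr => j /negbTE ->.
have bc := bmeas_cos (mu i); have bs := bmeas_sin (mu i).
have [cc sc] := ih _ ul (bG _ bc) (Gl _).
have [cs ss] := ih _ ul (bG _ bs) (Gl _).
have bp h : bmeas h -> bmeas (fun t => \prod_j G h j (X j t)).
  by move=> bh; apply: bmeas_prod => j; apply: bmeas_comp => //; exact: bG.
have icc := bmeas_integrable P (bmeasM (bmeas_cos (mS l)) (bp _ bc)).
have isc := bmeas_integrable P (bmeasM (bmeas_sin (mS l)) (bp _ bc)).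
have ics := bmeas_integrable P (bmeasM (bmeas_cos (mS l)) (bp _ bs)).
have iss := bmeas_integrable P (bmeasM (bmeas_sin (mS l)) (bp _ bs)).
split.
- rewrite (@eq_Rintegral _ _ _ P _ (fun t =>
    cos (\sum_(i <- l) u i (X i t)) * \prod_j G (cos \o u i) j (X j t) +
    -1 * (sin (\sum_(i <- l) u i (X i t)) * \prod_j G (sin \o u i) j (X j t)))); last first.
    by move=> t _; rewrite big_cons cosD !GE /=; ring.
  rewrite (expectD icc (pintZ (-1) iss)) (expectZ (-1) iss) cc ss !GI /c /s; ring.
- rewrite (@eq_Rintegral _ _ _ P _ (fun t =>
    sin (\sum_(i <- l) u i (X i t)) * \prod_j G (cos \o u i) j (X j t) +
    cos (\sum_(i <- l) u i (X i t)) * \prod_j G (sin \o u i) j (X j t))); last first.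
    by move=> t _; rewrite big_cons sinD !GE /=; ring.
  rewrite (expectD isc ics) sc cs !GI /c /s; ring.
Qed.

Lemma expect_cos_sum (l : seq I) : uniq l ->
  \int[P]_t cos (\sum_(i <- l) u i (X i t)) = (char_prod c s l).1.
Proof.
move=> ul; have [] := @char_sum l (fun _ _ => 1) ul.
- by move=> _; exact: bmeas_cst.
- by [].
under [X in X = _ -> _]eq_Rintegral do rewrite big1_eq mulr1.
by move=> -> _; rewrite big1 ?mulr1// => i _; rewrite expect_cst.
Qed.

Lemma expect_sin_sum (l : seq I) : uniq l ->
  \int[P]_t sin (\sum_(i <- l) u i (X i t)) = (char_prod c s l).2.
Proof.
move=> ul; have [] := @char_sum l (fun _ _ => 1) ul.
- by move=> _; exact: bmeas_cst.
- by [].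
move=> _; under [X in X = _ -> _]eq_Rintegral do rewrite big1_eq mulr1.
by move=> ->; rewrite big1 ?mulr1// => i _; rewrite expect_cst.
Qed.

End cos_sum.

(** Telescoping of a product of complex numbers close to the real number [a], on real and imaginary
    parts. The partial products over suffixes have to stay bounded; in the application they are
    means of a cosine and of a sine. *)
Lemma char_prod_bound {R : realType} {I : finType} (c s : I -> R) (a e e' : R)
    (l : seq I) : `|a| <= 1 ->
  (forall i, `|c i - a| <= e) -> (forall i, `|s i| <= e') ->
  (forall i, `|c i| <= 1) ->
  (forall r : seq I, suffix r l -> `|(char_prod c s r).1| <= 1 /\ `|(char_prod c s r).2| <= 1) ->
  `|(char_prod c s l).1 - a ^+ size l| <= (size l)%:R * (e + e') /\
  `|(char_prod c s l).2| <= (size l)%:R * e'.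
Proof.
move=> a1 ce se c1; elim: l => [_|i l ih H].
  by rewrite /= expr0 subrr !normr0 !mul0r.
have [] := ih _; first by move=> r rl; apply: H; exact: suffix_trans rl (suffix_cons _ _ ).
have [] := H l (suffix_cons _ _); move=> /=.
move: (char_prod c s l) => [p q] /= p1 q1 hp hq.
have e0 : 0 <= e := le_trans (normr_ge0 _) (ce i).
have e0' : 0 <= e' := le_trans (normr_ge0 _) (se i).
split.
- have -> : p * c i - q * s i - a ^+ (size l).+1 =
      (p * (c i - a) + a * (p - a ^+ size l)) - q * s i by rewrite exprS; ring.
  rewrite (le_trans (ler_normB _ _))// (le_trans (lerD (ler_normD _ _) (lexx _)))//.
  rewrite !normrM -natr1 mulrDl mul1r.
  have h1 : `|p| * `|c i - a| <= e by rewrite -[e]mul1r ler_pM.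
  have h2 : `|a| * `|p - a ^+ size l| <= (size l)%:R * (e + e').
    by rewrite -[leRHS]mul1r ler_pM.
  have h3 : `|q| * `|s i| <= e' by rewrite -[e']mul1r ler_pM.
  by lra.
- rewrite (le_trans (ler_normD _ _))// !normrM -natr1 mulrDl mul1r lerD//.
    by rewrite -[leRHS]mulr1 ler_pM.
  by rewrite -[leRHS]mul1r ler_pM.
Qed.

Section identical_distribution.
Context {R : realType} {d d'} {T : measurableType d} {T' : measurableType d'}.
Variables (P : probability T R) (I : finType) (X : I -> {RV P >-> T'}).
Hypothesis idX : identically_distributed X.

Lemma id_integral i j (h : T' -> \bar R) : measurable_fun [set: T'] h ->
  (forall x, 0 <= h x)%E ->
  (\int[P]_t h (X i t) = \int[P]_t h (X j t))%E.
Proof.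
move=> mh h0.
rewrite -(ge0_integral_distribution (X i) mh h0) -(ge0_integral_distribution (X j) mh h0).
by apply: eq_measure_integral => A mA _; exact: idX.
Qed.

Lemma id_expect_integrable i j (h : T' -> R) : measurable_fun [set: T'] h ->
  (forall k, P.-integrable [set: T] (EFin \o (fun t => h (X k t)))) ->
  \int[P]_t h (X i t) = \int[P]_t h (X j t).
Proof.
move=> mh ih; congr fine.
have mEh : measurable_fun [set: T'] (EFin \o h) by exact/measurable_EFinP.
have := integral_distribution mEh (ih i); have := integral_distribution mEh (ih j).
by move=> <- <-; apply: eq_measure_integral => A mA _; exact: idX.
Qed.

Lemma id_expect i j (h : T' -> R) : bmeas h ->
  \int[P]_t h (X i t) = \int[P]_t h (X j t).
Proof.
move=> bh; apply: id_expect_integrable => [|k]; first by case: bh.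
exact: (bmeas_integrable P (bmeas_comp (measurable_funPT (X k)) bh)).
Qed.

End identical_distribution.

(** Per entry, [e + e'] comes from the cosine of the sum, and a further [e'] from its sine, which
    the phase [th] mixes in. *)
Lemma expect_cos_iid {R : realType} {d d'} {T : measurableType d}
    {T' : measurableType d'} (P : probability T R) (I : finType)
    (X : I -> {RV P >-> T'}) (i0 : I) (u : T' -> R) (a e e' th : R) :
  iid X -> measurable_fun [set: T'] u -> `|a| <= 1 ->
  `|\int[P]_t cos (u (X i0 t)) - a| <= e -> `|\int[P]_t sin (u (X i0 t))| <= e' ->
  `|\int[P]_t cos (\sum_i u (X i t) + th) - cos th * a ^+ #|I| |
    <= #|I|%:R * (e + 2 * e').
Proof.
move=> [indX idX] mu a1 ce se.
have mX i : measurable_fun [set: T] (X i) by exact: measurable_funPT.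
have muX i := measurableT_comp mu (mX i).
pose c i := \int[P]_t cos (u (X i t)); pose s i := \int[P]_t sin (u (X i t)).
have cE l : uniq l -> \int[P]_t cos (\sum_(i <- l) u (X i t)) = (char_prod c s l).1.
  by move=> ul; apply: (expect_cos_sum mX (fun=> mu)) => // g bg; exact: indep_expect_prod.
have sE l : uniq l -> \int[P]_t sin (\sum_(i <- l) u (X i t)) = (char_prod c s l).2.
  by move=> ul; apply: (expect_sin_sum mX (fun=> mu)) => // g bg; exact: indep_expect_prod.
have bc l : bmeas (fun t => cos (\sum_(i <- l) u (X i t))).
  by apply: bmeas_cos; apply: measurable_sum => i; exact: muX.
have bs l : bmeas (fun t => sin (\sum_(i <- l) u (X i t))).
  by apply: bmeas_sin; apply: measurable_sum => i; exact: muX.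
have [] := @char_prod_bound _ _ c s a e e' (index_enum I) a1.
- move=> i; rewrite /c (id_expect idX i i0 (h := fun x => cos (u x)))//; exact: bmeas_cos.
- move=> i; rewrite /s (id_expect idX i i0 (h := fun x => sin (u x)))//; exact: bmeas_sin.
- move=> i; apply: expect_norm_le => [|t]; last exact: cos_max.
  by apply: bmeas_integrable; exact: bmeas_cos (muX i).
- move=> r /suffixP[r' rE].
  have ur : uniq r by have := index_enum_uniq I; rewrite rE cat_uniq => /and3P[].
  rewrite -cE// -sE//; split; apply: expect_norm_le => [|t].
  + exact: bmeas_integrable.
  + exact: cos_max.
  + exact: bmeas_integrable.
  + exact: sin_max.
rewrite -cE ?index_enum_uniq// -sE ?index_enum_uniq//.
rewrite (_ : size _ = #|I|); last by rewrite cardT enumT.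
move=> h1 h2.
have icos := bmeas_integrable P (bc (index_enum I)).
have isin := bmeas_integrable P (bs (index_enum I)).
rewrite (@eq_Rintegral _ _ _ P _ (fun t => cos th * cos (\sum_i u (X i t)) +
    (- sin th) * sin (\sum_i u (X i t)))); last first.
  by move=> t _; rewrite cosD; ring.
rewrite (expectD (pintZ _ icos) (pintZ _ isin)) (expectZ _ icos) (expectZ _ isin).
rewrite addrAC -mulrBr (le_trans (ler_normD _ _))// !normrM normrN.
have h3 := ler_pM (normr_ge0 _) (normr_ge0 _) (cos_max th) h1.
have h4 := ler_pM (normr_ge0 _) (normr_ge0 _) (sin_max th) h2.
by rewrite (le_trans (lerD h3 h4))// !mul1r le_eqVlt; apply/orP; left; apply/eqP; ring.
Qed.

(** With [N = n + 1], [V] the variance and [L] the truncated second moment of one entry, the mean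
    cosine of a scaled entry is within [(e V + L) / N] of [1 - V / (2 N)]. The [N] factors of the
    product multiply this error by [N], so it remains a constant multiple of [e V + L]: small by the
    choice of [e] and then by Lindeberg's condition. *)
Lemma clt_array {R : realType} (d : nat -> measure_display) {d' : measure_display}
    (T : forall n, measurableType (d n)) (T' : measurableType d')
    (P : forall n, probability (T n) R) (Z : forall n, 'I_n.+1 -> {RV (P n) >-> T'})
    (z : T' -> R) (v : R) (th : R) :
  (forall n, iid (Z n)) -> measurable_fun [set: T'] z ->
  (forall n, (P n).-integrable [set: T n] (EFin \o (fun t => z (Z n ord0 t) ^+ 2))) ->
  (forall n, \int[P n]_t z (Z n ord0 t) = 0) ->
  \int[P n]_t (z (Z n ord0 t) ^+ 2) @[n --> \oo] --> v ->
  (forall e : R, 0 < e -> \int[P n]_t (z (Z n ord0 t) ^+ 2 *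
     (e * Num.sqrt n.+1%:R < `|z (Z n ord0 t)|)%R%:R) @[n --> \oo] --> (0 : R)) ->
  \int[P n]_t cos ((Num.sqrt n.+1%:R)^-1 * (\sum_i z (Z n i t)) + th) @[n --> \oo]
    --> cos th * expR (- (v / 2)).
Proof.
move=> iidZ mz iz2 z0 zv lind.
pose V n := \int[P n]_t (z (Z n ord0 t) ^+ 2).
pose L (e : R) n := \int[P n]_t (z (Z n ord0 t) ^+ 2 *
     (e * Num.sqrt n.+1%:R < `|z (Z n ord0 t)|)%R%:R).
have mzZ n : measurable_fun [set: T n] (fun t => z (Z n ord0 t)).
  by apply: measurableT_comp => //; exact: measurable_funPT.
have V0 n : 0 <= V n by apply: Rintegral_ge0 => t _; exact: sqr_ge0.
have i1 n (k : R) : (P n).-integrable [set: T n] (EFin \o (fun=> k)).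
  by apply: bmeas_integrable; exact: bmeas_cst.
have iz n : (P n).-integrable [set: T n] (EFin \o (fun t => z (Z n ord0 t))).
  apply: (integrable_dominated (mzZ n) (pintD (iz2 n) (i1 n 1))) => t.
  by rewrite -(real_normK (num_real (z _))); have := sqr_ge0 (`|z (Z n ord0 t)| - 2^-1); lra.
have iL n (e : R) : (P n).-integrable [set: T n] (EFin \o (fun t => z (Z n ord0 t) ^+ 2 *
     (e * Num.sqrt n.+1%:R < `|z (Z n ord0 t)|)%R%:R)).
  apply: (integrable_dominated _ (iz2 n)) => [|t]; last first.
    by rewrite normrM normrX real_normK ?num_real// ler_piMr ?sqr_ge0//; case: (_ < _); rewrite ?normr1// normr0.
  apply: measurable_funM; first exact: measurable_funX.
  rewrite (_ : (fun t => _) = \1_(~` ((fun t => z (Z n ord0 t)) @^-1`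
      `[- (e * Num.sqrt n.+1%:R), e * Num.sqrt n.+1%:R]))).
    apply: measurable_indic; apply: measurableC.
    by rewrite -[X in measurable X]setTI; exact: mzZ.
  apply/funext => t; rewrite indicE; congr (_%:R); rewrite ltNge ler_norml.
  case: (boolP (t \in _)) => [|]; rewrite ?inE ?notin_setE /=.
    by rewrite in_itv/= => /negP ->.
  by move=> /contrapT; rewrite in_itv/= => ->.
have N0 n : 0 < n.+1%:R :> R by [].
have sN0 n : 0 < Num.sqrt n.+1%:R :> R by rewrite sqrtr_gt0.
pose u n x := (Num.sqrt n.+1%:R)^-1 * z x.
have u2 n x : u n x ^+ 2 = n.+1%:R^-1 * z x ^+ 2.
  by rewrite exprMn exprVn sqr_sqrtr// ltW.
have ult n e x : (e < `|u n x|) = (e * Num.sqrt n.+1%:R < `|z x|).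
  by rewrite normrM gtr0_norm ?invr_gt0// mulrC ltr_pdivlMr.
have mu n : measurable_fun [set: T'] (u n) by exact: measurable_funM.
have muZ n : measurable_fun [set: T n] (fun t => u n (Z n ord0 t)).
  by apply: measurableT_comp => //; exact: measurable_funPT.
have iu n : (P n).-integrable [set: T n] (EFin \o (fun t => u n (Z n ord0 t) ^+ 2)).
  by under eq_fun do rewrite /= u2; exact: pintZ.
have iuL n e : (P n).-integrable [set: T n] (EFin \o (fun t => u n (Z n ord0 t) ^+ 2 *
     (e < `|u n (Z n ord0 t)|)%R%:R)).
  by under eq_fun do rewrite /= u2 ult -mulrA; exact: pintZ.
have EuL n e : \int[P n]_t (u n (Z n ord0 t) ^+ 2 * (e < `|u n (Z n ord0 t)|)%R%:R)
    = n.+1%:R^-1 * L e n.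
  under eq_Rintegral do rewrite u2 ult -mulrA.
  by rewrite expectZ.
have Eu2 n : \int[P n]_t (u n (Z n ord0 t) ^+ 2) = n.+1%:R^-1 * V n.
  by under eq_Rintegral do rewrite u2; rewrite expectZ.
have kc n e : 0 < e -> e <= 1 ->
    `|\int[P n]_t cos (u n (Z n ord0 t)) - (1 - V n / (2 * n.+1%:R))|
      <= (e * V n + L e n) / n.+1%:R.
  move=> e0 e1.
  have i2 : (P n).-integrable [set: T n]
      (EFin \o (fun t => 1 - u n (Z n ord0 t) ^+ 2 / 2)).
    under eq_fun do rewrite /= -mulNr mulrC mulrN -mulNr.
    by apply: pintD => //; exact: pintZ.
  have -> : 1 - V n / (2 * n.+1%:R) = \int[P n]_t (1 - u n (Z n ord0 t) ^+ 2 / 2).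
    under eq_Rintegral do rewrite -mulNr mulrC mulrN -mulNr.
    rewrite (expectD (i1 n 1) (pintZ _ (iu n))) expect_cst (expectZ _ (iu n)) Eu2.
    by rewrite invfM; ring.
  have -> : (e * V n + L e n) / n.+1%:R =
      \int[P n]_t (e * u n (Z n ord0 t) ^+ 2 +
        u n (Z n ord0 t) ^+ 2 * (e < `|u n (Z n ord0 t)|)%R%:R).
    by rewrite (expectD (pintZ e (iu n)) (iuL n e)) (expectZ e (iu n)) Eu2 EuL; ring.
  apply: expect_dist => //.
  - by apply: bmeas_integrable; exact: bmeas_cos (muZ n).
  - by apply: pintD => //; exact: pintZ.
  - by move=> t; exact: cos_taylor_bound.
have ks n e : 0 < e -> e <= 1 ->
    `|\int[P n]_t sin (u n (Z n ord0 t))| <= (e * V n + 2 * L e n) / n.+1%:R.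
  move=> e0 e1.
  (* Centering: the linear term has mean 0 and may be subtracted. *)
  have -> : \int[P n]_t sin (u n (Z n ord0 t)) =
      \int[P n]_t sin (u n (Z n ord0 t)) - \int[P n]_t (u n (Z n ord0 t)).
    by rewrite (expectZ _ (iz n)) z0 mulr0 subr0.
  have -> : (e * V n + 2 * L e n) / n.+1%:R =
      \int[P n]_t (e * u n (Z n ord0 t) ^+ 2 +
        2 * (u n (Z n ord0 t) ^+ 2 * (e < `|u n (Z n ord0 t)|)%R%:R)).
    rewrite (expectD (pintZ e (iu n)) (pintZ 2 (iuL n e))) (expectZ e (iu n)).
    by rewrite (expectZ 2 (iuL n e)) Eu2 EuL; ring.
  apply: expect_dist => //.
  - by apply: bmeas_integrable; exact: bmeas_sin (muZ n).
  - exact: pintZ.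
  - by apply: pintD; exact: pintZ.
  - by move=> t; exact: sin_taylor_bound.
have aE := cvg_exprn_expR V0 zv.
have h3 : V n * n.+1%:R^-1 @[n --> \oo] --> (0 : R).
  by rewrite -(mulr0 v); apply: cvgM => //; exact: cvg_harmonic.
have D0 : \int[P n]_t cos ((Num.sqrt n.+1%:R)^-1 * (\sum_i z (Z n i t)) + th) -
    cos th * (1 - V n / (2 * n.+1%:R)) ^+ n.+1 @[n --> \oo] --> (0 : R).
  apply/cvgr0Pnorm_le => r r0.
  have v1 : 0 < `|v| + 1 by rewrite ltr_wpDl.
  (* The final error is [3 e V + 5 L]: one copy of the cosine bound and two of the sine bound, which
     carries [2 L]. This [e] makes the first term at most [r / 2] as soon as [V <= |v| + 1], and
     [L <= r / 10] does the same for the second. *)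
  pose e := Num.min 1 (r / (6 * (`|v| + 1))).
  have e0 : 0 < e by rewrite lt_min ltr01 divr_gt0// mulr_gt0.
  have e1 : e <= 1 by rewrite ge_min lexx.
  have ev : e * (`|v| + 1) <= r / 6.
    rewrite -ler_pdivlMr// -mulrA -invfM.
    by rewrite ge_min lexx orbT.
  near=> n.
  have a1 : `|1 - V n / (2 * n.+1%:R)| <= 1.
    have y0 : 0 <= V n / (2 * n.+1%:R) by rewrite divr_ge0.
    have y1 : V n / (2 * n.+1%:R) <= 1.
      rewrite invfM mulrCA -[leRHS](@mulVf _ 2)// ler_wpM2l//.
      rewrite (@le_trans _ _ 1) ?ler1n//.
      by near: n; exact: (cvgr_le _ h3).
    move: y0 y1; move: (V n / _) => y y0 y1.
    by rewrite ler_norml; apply/andP; split; lra.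
  have := expect_cos_iid th (iidZ n) (mu n) a1 (kc n e e0 e1) (ks n e e0 e1).
  rewrite card_ord; under eq_Rintegral do rewrite -mulr_sumr.
  move=> h; rewrite (le_trans h)//.
  have -> : n.+1%:R * ((e * V n + L e n) / n.+1%:R + 2 * ((e * V n + 2 * L e n) / n.+1%:R))
      = 3 * (e * V n) + 5 * L e n.
    by have := gt_eqF (N0 n); move: (n.+1%:R : R) => N Nn0; field; rewrite Nn0.
  have Vv : V n <= `|v| + 1.
    near: n; apply: (cvgr_le _ zv).
    by rewrite (le_lt_trans (ler_norm v))// ltrDl.
  have eV : e * V n <= e * (`|v| + 1) by rewrite ler_wpM2l// ltW.
  have Ln : L e n <= r / 10.
    by near: n; apply: (cvgr_le _ (lind e e0)); rewrite divr_gt0.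
  by lra.
rewrite -[X in _ --> X]add0r.
have h4 : cos th * (1 - V n / (2 * n.+1%:R)) ^+ n.+1 @[n --> \oo] --> cos th * expR (- (v / 2)).
  by apply: cvgM => //; exact: cvg_cst.
apply: cvg_trans (cvgD D0 h4); apply: near_eq_cvg; apply: nearW => n /=.
by rewrite !fctE subrK.
Unshelve. all: by end_near. Qed.

(** * Levy's continuity theorem in l2 *)

Section bernstein.
Context {R : realType}.
Implicit Types (y : R) (h : nat -> R) (m : nat).

(* The mean of [h] under the binomial law with parameters [m] and [y], by conditioning on the
   first trial. *)
Fixpoint bernstein m y h : R :=
  if m is m'.+1 then
    (1 - y) * bernstein m' y h + y * bernstein m' y (fun k => h k.+1)
  else h 0.

Lemma bernstein_cst m y (c : R) : bernstein m y (fun=> c) = c.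
Proof. by elim: m => //= m ->; ring. Qed.

Lemma bernsteinD m y h h' :
  bernstein m y (fun k => h k + h' k) = bernstein m y h + bernstein m y h'.
Proof. by elim: m h h' => //= m ih h h'; rewrite ih (ih (h \o S) (h' \o S)); ring. Qed.

Lemma bernsteinZ m y (c : R) h :
  bernstein m y (fun k => c * h k) = c * bernstein m y h.
Proof. by elim: m h => //= m ih h; rewrite ih (ih (h \o S)); ring. Qed.

Lemma bernstein_le m y h h' : 0 <= y <= 1 -> (forall k, h k <= h' k) ->
  bernstein m y h <= bernstein m y h'.
Proof.
move=> /andP[y0 y1]; elim: m h h' => //= m ih h h' hh'.
by rewrite lerD// ler_wpM2l// ?subr_ge0// ih.
Qed.

(** The arbitrary center [a] carries the induction: a success in the first trial replaces [a] by
    [a - 1]. *)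
Lemma bernstein_variance m y (a : R) :
  bernstein m y (fun k => (k%:R - a) ^+ 2) = (m%:R * y - a) ^+ 2 + m%:R * (y * (1 - y)).
Proof.
elim: m a => [|m ih] a /=; first by ring.
have e : (fun k => (k.+1%:R - a) ^+ 2) = (fun k => (k%:R - (a - 1)) ^+ 2).
  by apply/funext => k; rewrite -natr1; ring.
by rewrite e !ih -natr1; ring.
Qed.

(** One degree [m] serves every [G] with the given Lipschitz constant, so that the remaining
    coordinates can enter as parameters. For [c = |y - k / m|] one has [c <= t / 2 + c^2 / (2 t)],
    and the mean of [c^2] is at most [1 / m <= t^2]; hence the mean of [c] is at most [t]. *)
Lemma bernstein_approx (K e : R) : 0 <= K -> 0 < e -> exists m, forall (G : R -> R) y,
  (forall a b, `|G a - G b| <= K * `|a - b|) -> 0 <= y <= 1 ->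
  `|G y - bernstein m y (fun k => G (k%:R / m%:R))| <= e.
Proof.
move=> K0 e0; have K1 : 0 < K + 1 by rewrite ltr_wpDl.
pose t := e / (K + 1); have t0 : 0 < t by rewrite divr_gt0.
have Kt : K * t <= e by rewrite mulrCA ler_piMr ?(ltW e0)// ler_pdivrMr// mul1r lerDl.
pose m := (Num.truncn (t ^+ 2)^-1).+1; exists m => G y GK y01.
have m0 : 0 < m%:R :> R by [].
have hm : (t ^+ 2)^-1 <= m%:R by rewrite ltW// /m truncnS_gt.
have -> : G y - bernstein m y (fun k => G (k%:R / m%:R)) =
    bernstein m y (fun k => G y + -1 * G (k%:R / m%:R)).
  by rewrite bernsteinD bernsteinZ bernstein_cst mulN1r.
suff H h : (forall k, `|h k| <= K * (t / 2 + t^-1 / 2 * (m%:R ^- 2 * (k%:R - m%:R * y) ^+ 2))) ->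
    `|bernstein m y h| <= e.
  apply: H => k; rewrite mulN1r (le_trans (GK _ _))// ler_wpM2l//.
  have -> : m%:R ^- 2 * (k%:R - m%:R * y) ^+ 2 = (y - k%:R / m%:R) ^+ 2.
    by move: (gt_eqF m0); move: (m%:R : R) => M M0; field; rewrite M0.
  rewrite -(real_normK (num_real (y - _))); move: `|y - _| => c.
  have -> : t / 2 + t^-1 / 2 * c ^+ 2 = c + t^-1 / 2 * (c - t) ^+ 2.
    by field; rewrite gt_eqF.
  by rewrite lerDl mulr_ge0 ?sqr_ge0// divr_ge0// invr_ge0 ltW.
move=> hK; have y1y : y * (1 - y) <= 1.
  by move: y01 => /andP[y0 y1]; have := sqr_ge0 (y - 2^-1); rewrite sqrrB; lra.
have B : bernstein m y (fun k => K * (t / 2 + t^-1 / 2 * (m%:R ^- 2 * (k%:R - m%:R * y) ^+ 2))) <= e.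
  rewrite bernsteinZ bernsteinD bernstein_cst !bernsteinZ bernstein_variance subrr expr0n add0r.
  apply: (le_trans _ Kt); rewrite ler_wpM2l//.
  have : m%:R ^- 2 * (m%:R * (y * (1 - y))) <= t ^+ 2.
    have -> : m%:R ^- 2 * (m%:R * (y * (1 - y))) = m%:R^-1 * (y * (1 - y)) :> R.
      by move: (gt_eqF m0); move: (m%:R : R) => M M0; field; rewrite M0.
    rewrite -[leRHS]mulr1 ler_pM//; last first.
      by rewrite -[leRHS]invrK lef_pV2// posrE// invr_gt0 exprn_gt0.
    by rewrite mulr_ge0//; move: y01 => /andP[y0 y1]; rewrite ?subr_ge0.
  have t2 : 0 <= t^-1 / 2 by rewrite divr_ge0 ?invr_ge0 ?(ltW t0).
  move=> /(ler_wpM2l t2).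
  have -> : t^-1 / 2 * t ^+ 2 = t / 2 by field; rewrite gt_eqF.
  by lra.
rewrite ler_norml; apply/andP; split; last first.
  by apply: (le_trans _ B); apply: bernstein_le => // k; rewrite (le_trans (ler_norm _)).
rewrite lerNl -mulN1r -bernsteinZ; apply: (le_trans _ B).
by apply: bernstein_le => // k; rewrite mulN1r (le_trans (ler_norm _))// normrN.
Qed.

End bernstein.

Section trig_closure.
Context {R : realType}.
Implicit Types (f g : l2 R -> R) (t : nat -> R).

(* The uniform closure of the trigonometric polynomials in finitely many coordinates. *)
Inductive trigc : (l2 R -> R) -> Prop :=
| trigc_cos (l : nat) t th : trigc (fun x => cos (\sum_(k < l) t k * x k + th))
| trigcD f g : trigc f -> trigc g -> trigc (fun x => f x + g x)
| trigcZ c f : trigc f -> trigc (fun x => c * f x)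
| trigc_lim f (F : nat -> l2 R -> R) : (forall n, trigc (F n)) ->
    (forall n x, `|f x - F n x| <= n.+1%:R^-1) -> trigc f.

Lemma trigc_cst c : trigc (fun=> c).
Proof.
have := trigcZ c (@trigc_cos 0 (fun=> 0) 0); congr trigc.
by apply/funext => x; rewrite big_ord0 add0r cos0 mulr1.
Qed.

Lemma trigc_approx f :
  (forall e : R, 0 < e -> exists2 g, trigc g & forall x, `|f x - g x| <= e) ->
  trigc f.
Proof.
move=> H; have /choice[F hF] : forall n, exists g, trigc g /\ forall x, `|f x - g x| <= n.+1%:R^-1.
  by move=> n; have [|g tg fg] := H n.+1%:R^-1; [rewrite invr_gt0|exists g].
by apply: (@trigc_lim f F) => n; case: (hF n).
Qed.

Lemma lform_widen (l l' : nat) t (x : l2 R) : (l <= l')%N ->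
  \sum_(k < l) t k * x k = \sum_(k < l') (if (k < l)%N then t k else 0) * x k.
Proof.
move=> ll'; rewrite (big_ord_widen l' (fun k => t k * x k))// big_mkcond.
by apply: eq_bigr => k _; case: ifP => // _; rewrite mul0r.
Qed.

(** Product-to-sum on the generators, after padding both families of coefficients with zeros to a
    common length. The limit clause survives because a cosine has modulus at most 1. *)
Lemma trigcM_cos f (l : nat) t th : trigc f ->
  trigc (fun x => f x * cos (\sum_(k < l) t k * x k + th)).
Proof.
elim => {f} [l' t' th'|f g _ ihf _ ihg|c f _ ihf|f F _ ihF fF].
- pose L := maxn l l'.
  pose a k := if (k < l)%N then t k else 0.
  pose b k := if (k < l')%N then t' k else 0.
  have := trigcD (trigcZ 2^-1 (@trigc_cos L (fun k => b k + a k) (th' + th)))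
                 (trigcZ 2^-1 (@trigc_cos L (fun k => b k - a k) (th' - th))).
  congr trigc; apply/funext => x.
  rewrite (lform_widen t x (leq_maxl l l')) (lform_widen t' x (leq_maxr l l')).
  under eq_bigr do rewrite mulrDl.
  under [X in cos (X + (th' - th))]eq_bigr do rewrite mulrBl.
  rewrite big_split sumrB /=; rewrite -/L.
  move: (\sum_(i < L) b i * x i) (\sum_(i < L) a i * x i) => A B.
  have -> : A + B + (th' + th) = (A + th') + (B + th) by ring.
  have -> : A - B + (th' - th) = (A + th') - (B + th) by ring.
  by rewrite cosD cosB; lra.
- by have := trigcD ihf ihg; congr trigc; apply/funext => x; rewrite mulrDl.
- by have := trigcZ c ihf; congr trigc; apply/funext => x; rewrite mulrA.
- apply: (trigc_lim ihF) => n x; rewrite -mulrBl normrM.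
  by rewrite (le_trans _ (fF n x))// ler_piMr// cos_max.
Qed.

(* [L sin (x / L)] as an affine function of a point of [0, 1]. *)
Definition squash (L : R) (x : R) : R := (1 + sin (x / L)) / 2.

Lemma squash_itv L x : 0 <= squash L x <= 1.
Proof. by rewrite /squash; have := sin_geN1 (x / L); have := sin_le1 (x / L); lra. Qed.

(** A sine is a cosine with phase [- (pi / 2)], so this reduces to [trigcM_cos]. *)
Lemma trigcM_squash f L (j : nat) : trigc f -> trigc (fun x => squash L (x j) * f x).
Proof.
move=> tf; have := trigcD (trigcZ 2^-1 tf)
  (trigcZ 2^-1 (@trigcM_cos f j.+1 (fun k => (k == j)%:R / L) (- (pi / 2)) tf)).
congr trigc; apply/funext => x; rewrite big_ord_recr/= eqxx mul1r big1 ?add0r.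
  by rewrite [L^-1 * _]mulrC cosBpihalf /squash; field.
by move=> i _; rewrite (ltn_eqF (ltn_ord i)) !mul0r.
Qed.

Lemma trigc_bernstein m L (j : nat) (h : nat -> l2 R -> R) : (forall k, trigc (h k)) ->
  trigc (fun x => bernstein m (squash L (x j)) (fun k => h k x)).
Proof.
elim: m h => [|m ih] h th /=; first exact: th.
have t1 := ih _ th; have t2 := ih (fun k => h k.+1) (fun k => th k.+1).
have := trigcD (trigcD t1 (trigcZ (-1) (trigcM_squash L j t1))) (trigcM_squash L j t2).
by congr trigc; apply/funext => x; ring.
Qed.

(** Induction on the number of coordinates, an offset [w] absorbing the last one once it is frozen
    at a Bernstein node. As a function of [squash L (x l)] the value is Lipschitz with constant
    [2 K L], whatever [w] and the other coordinates are, so a single degree gives a uniform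
    error. *)
Lemma trigc_lipschitz f (K L : R) (l : nat) : 0 <= K -> 0 < L ->
  (forall x y, `|f x - f y| <= K * `|x - y|) ->
  trigc (fun x => f (\sum_(i < l) (L * sin (x i / L)) *: l2_unit i)).
Proof.
move=> K0 L0 fK.
suff H w : trigc (fun x => f (w + \sum_(i < l) (L * sin (x i / L)) *: l2_unit i)).
  by have := H 0; congr trigc; apply/funext => x; rewrite add0r.
elim: l w => [|l ih] w.
  by under eq_fun do rewrite big_ord0 addr0; exact: trigc_cst.
apply: trigc_approx => e e0.
have K2 : 0 <= K * (2 * L) by rewrite !mulr_ge0// ltW.
have [m hm] := bernstein_approx K2 e0.
pose h (k : nat) (x : l2 R) := f ((w + (L * (2 * (k%:R / m%:R) - 1)) *: l2_unit l) +
  \sum_(i < l) (L * sin (x i / L)) *: l2_unit i).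
exists (fun x : l2 R => bernstein m (squash L (x l)) (fun k => h k x)).
  by apply: trigc_bernstein => k; exact: ih.
move=> x; pose G y := f ((w + (L * (2 * y - 1)) *: l2_unit l) +
  \sum_(i < l) (L * sin (x i / L)) *: l2_unit i).
have GK a b : `|G a - G b| <= K * (2 * L) * `|a - b|.
  rewrite (le_trans (fK _ _))// -[in leRHS]mulrA ler_wpM2l//.
  rewrite opprD addrACA subrr addr0 opprD addrACA subrr add0r -scalerBl normrZ.
  rewrite l2_norm_unit mulr1 -mulrBr normrM (gtr0_norm L0).
  have -> : 2 * a - 1 - (2 * b - 1) = 2 * (a - b) by ring.
  by rewrite normrM ger0_norm// mulrA [L * _]mulrC.
have sE : L * sin (x l / L) = L * (2 * squash L (x l) - 1).
  by congr (L * _); rewrite /squash; lra.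
rewrite big_ord_recr/= sE [\sum_(i < l) _ + _]addrC addrA.
exact: (hm G _ GK (squash_itv L (x l))).
Qed.

End trig_closure.

Lemma continuousZr_fun {R : realType} {V : normedModType R} (f : V -> R) (c : R) :
  continuous f -> continuous (fun x => c * f x).
Proof. by move=> cf x; apply: cvgMr; exact: cf. Qed.

(** * Lipschitz minorants of a bounded function *)

Section inf_convolution.
Context {R : realType} {V : normedModType R}.
Variables (f : V -> R) (M : R).
Hypothesis fM : forall x, `|f x| <= M.

(** The infimal convolution of [f] with [k] times the norm, which is the largest [k]-Lipschitz
    minorant of [f]. *)
Definition inf_conv (k : nat) (x : V) : R :=
  inf [set f y + k%:R * `|x - y| | y in [set: V]].

Let lb k x : lbound [set f y + k%:R * `|x - y| | y in [set: V]] (- M).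
Proof.
move=> _ [y _ <-]; have := fM y; rewrite ler_norml => /andP[h _].
by rewrite (le_trans h)// lerDl mulr_ge0.
Qed.

Let has_infS k x : has_inf [set f y + k%:R * `|x - y| | y in [set: V]].
Proof. by split; [exists (f x + k%:R * `|x - x|); exists x|exists (- M); exact: lb]. Qed.

Lemma inf_conv_le k x y : inf_conv k x <= f y + k%:R * `|x - y|.
Proof. by apply: ge_inf; [case: (has_infS k x)|exists y]. Qed.

Lemma inf_conv_lef k x : inf_conv k x <= f x.
Proof. by have := inf_conv_le k x x; rewrite subrr normr0 mulr0 addr0. Qed.

Lemma inf_conv_ge k x : - M <= inf_conv k x.
Proof. by apply: lb_le_inf; [case: (has_infS k x)|exact: lb]. Qed.

Lemma inf_conv_norm k x : `|inf_conv k x| <= M.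
Proof.
rewrite ler_norml inf_conv_ge (le_trans (inf_conv_lef k x))//.
exact: le_trans (ler_norm _) (fM x).
Qed.

Lemma inf_conv_lipschitz k x y : `|inf_conv k x - inf_conv k y| <= k%:R * `|x - y|.
Proof.
suff H u v : inf_conv k u - inf_conv k v <= k%:R * `|u - v|.
  by rewrite ler_norml H andbT lerNl opprB distrC H.
rewrite lerBlDl addrC -lerBlDl; apply: lb_le_inf; first by case: (has_infS k v).
move=> _ [z _ <-]; rewrite lerBlDl (le_trans (inf_conv_le k u z))//.
rewrite addrCA lerD2l -mulrDr ler_wpM2l//.
by rewrite -(subrKA v) ler_normD.
Qed.

Lemma inf_conv_cvg x : {for x, continuous f} -> inf_conv k x @[k --> \oo] --> f x.
Proof.
move=> /cvgrPdist_le cf; apply/cvgrPdist_le => e e0.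
have /nbhs_ballP[r /= r0 hr] := cf _ e0.
near=> k.
rewrite ger0_norm ?subr_ge0 ?inf_conv_lef// lerBlDl addrC -lerBlDl.
apply: lb_le_inf; first by case: (has_infS k x).
move=> _ [y _ <-]; have [xy|xy] := ltP `|x - y| r.
  have : `|f x - f y| <= e by apply: hr; rewrite -ball_normE.
  rewrite ler_norml => /andP[_ h]; rewrite (@le_trans _ _ (f y))//; first by lra.
  by rewrite lerDl mulr_ge0.
(* Points at distance at least [r] do not count: there the penalty is at least the oscillation [2 M]
   of [f]. *)
have h1 : M *+ 2 <= k%:R * r.
  by rewrite -ler_pdivrMr//; near: k; exact: nbhs_infty_ger.
have h2 : k%:R * r <= k%:R * `|x - y| by rewrite ler_wpM2l.
have := fM x; have := fM y; rewrite !ler_norml => /andP[h3 _] /andP[_ h4].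
by move: h1; rewrite mulr2n; lra.
Unshelve. all: by end_near. Qed.

End inf_convolution.

(** * Convergence in law from characteristic functions and tails *)

Section levy.
Context {R : realType} {d : nat -> measure_display} {T : forall n, measurableType (d n)}.
Context {d'} {T' : measurableType d'}.
Variables (P : forall n, probability (T n) R) (X : forall n, T n -> l2 R).
Variables (Q : probability T' R) (Y : T' -> l2 R) (B : R).
Arguments X : clear implicits.
Hypothesis mX : forall n, measurable_fun [set: T n] (X n).
Hypothesis mY : measurable_fun [set: T'] Y.
Hypothesis char_cvg : forall l (t : nat -> R) th,
  \int[P n]_s cos (\sum_(k < l) t k * X n s k + th) @[n --> \oo] -->
  \int[Q]_s cos (\sum_(k < l) t k * Y s k + th).
Hypothesis X_bound : \forall n \near \oo,
  (P n).-integrable [set: T n] (EFin \o (fun s => `|X n s| ^+ 2)) /\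
  \int[P n]_s (`|X n s| ^+ 2) <= B.
Hypothesis Y_bound : Q.-integrable [set: T'] (EFin \o (fun s => `|Y s| ^+ 2)) /\
  \int[Q]_s (`|Y s| ^+ 2) <= B.
Hypothesis tails : forall e : R, 0 < e -> exists l,
  (\forall n \near \oo, \int[P n]_s (`|X n s - l2_trunc l (X n s)| ^+ 2) <= e) /\
  \int[Q]_s (`|Y s - l2_trunc l (Y s)| ^+ 2) <= e.

Let conv (f : l2 R -> R) :=
  \int[P n]_s f (X n s) @[n --> \oo] --> \int[Q]_s f (Y s).

Let bcomp (f : l2 R -> R) n : bmeas f ->
  (P n).-integrable [set: T n] (EFin \o (fun s => f (X n s))).
Proof. by move=> bf; apply: bmeas_integrable; exact: bmeas_comp. Qed.

Let bcompY (f : l2 R -> R) : bmeas f ->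
  Q.-integrable [set: T'] (EFin \o (fun s => f (Y s))).
Proof. by move=> bf; apply: bmeas_integrable; exact: bmeas_comp. Qed.

(* [f] need not be close to [g] pointwise: it is enough in mean, uniformly. *)
Let conv_approx (f : l2 R -> R) : bmeas f ->
  (forall e : R, 0 < e -> exists g, [/\ bmeas g, conv g,
    \forall n \near \oo, `|\int[P n]_s f (X n s) - \int[P n]_s g (X n s)| <= e &
    `|\int[Q]_s f (Y s) - \int[Q]_s g (Y s)| <= e]) -> conv f.
Proof.
move=> bf H; apply/cvgrPdist_le => e e0.
have e3 : 0 < e / 3 by rewrite divr_gt0.
have [g [bg cg fgX fgY]] := H _ e3.
near=> n.
have h1 : `|\int[P n]_s f (X n s) - \int[P n]_s g (X n s)| <= e / 3 by near: n.
have h2 : `|\int[Q]_s g (Y s) - \int[P n]_s g (X n s)| <= e / 3.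
  by near: n; move/cvgrPdist_le : cg; exact.
move: h1 h2 fgY; rewrite !ler_norml => /andP[? ?] /andP[? ?] /andP[? ?].
by apply/andP; split; lra.
Unshelve. all: by end_near. Qed.

Let mlform (l : nat) (t : nat -> R) :
  measurable_fun [set: l2 R] (fun x : l2 R => \sum_(k < l) t k * x k).
Proof.
apply: measurable_sum => k; apply: measurable_funM => //.
exact: l2_coord_measurable.
Qed.

Let trigc_conv (f : l2 R -> R) : trigc f -> bmeas f /\ conv f.
Proof.
elim => {f} [l t th|f g _ [bf cf] _ [bg cg]|c f _ [bf cf]|f F _ ihF fF].
- by split; [apply: bmeas_cos; apply: measurable_funD|exact: char_cvg].
- split; first exact: bmeasD.
  rewrite /conv (expectD (bcompY bf) (bcompY bg)).
  under eq_fun do rewrite (expectD (bcomp _ bf) (bcomp _ bg)).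
  exact: cvgD.
- split; first exact: bmeasZ.
  rewrite /conv (expectZ _ (bcompY bf)).
  under eq_fun do rewrite (expectZ _ (bcomp _ bf)).
  by apply: cvgMr.
- have [bf _ _] := bmeas_unif (fun n => (ihF n).1) fF; split => //.
  apply: conv_approx => // e e0.
  pose n := Num.truncn e^-1.
  have ne : n.+1%:R^-1 <= e.
    by rewrite -[leRHS]invrK lef_pV2 ?posrE ?invr_gt0// ltW// truncnS_gt.
  have [bF cF] := ihF n.
  exists (F n); split => //.
  + apply: nearW => m; apply: expect_dist_cst; [exact: bcomp|exact: bcomp|].
    by move=> s; rewrite (le_trans (fF n _)).
  + apply: expect_dist_cst; [exact: bcompY|exact: bcompY|].
    by move=> s; rewrite (le_trans (fF n _)).
Qed.

(** The comparison function [g] keeps [l] coordinates and bends each of them by [L sin (x_k / L)].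
    By the Lipschitz condition [f - g] is at most [K] times the displacement, which [D] bounds by
    squares, hence in mean by second moments. *)
Let lipschitz_conv (f : l2 R -> R) (K M : R) : 0 < K -> (forall x, `|f x| <= M) ->
  (forall x y, `|f x - f y| <= K * `|x - y|) -> conv f.
Proof.
move=> K0 fM fK.
have bf : bmeas f.
  split; last by exists M.
  by apply: l2_continuous_measurable_fun; exact: (lipschitz_continuous fK).
apply: conv_approx => // e e0.
have K4 : 0 < 4 * K by rewrite mulr_gt0.
(* The mean of [D] will be at most [3 K r], that is [3 e / 4]. *)
pose r := e / (4 * K); have r0 : 0 < r by rewrite divr_gt0.
have Kr : K * r = e / 4 by rewrite /r; field; rewrite gt_eqF.
have r2 : 0 < r ^+ 2 by rewrite exprn_gt0.
have [l [tX tY]] := tails r2.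
have B1 : 0 < `|B| + 1 by rewrite ltr_wpDl.
(* By [sin_taylor_bound] at [e = 1] bending moves a coordinate [y] by at most [3 y^2 / L]; this [L]
   makes [3 B / L] at most [r]. *)
pose L := 3 * (`|B| + 1) / r; have L0 : 0 < L by rewrite divr_gt0// mulr_gt0.
pose g (x : l2 R) := f (\sum_(i < l) (L * sin (x i / L)) *: l2_unit i).
have [bg cg] := trigc_conv (trigc_lipschitz l (ltW K0) L0 fK).
(* The distance [a] to the truncation is estimated by [a <= r + a^2 / r]. *)
pose D (x : l2 R) := K * (r + r^-1 * `|x - l2_trunc l x| ^+ 2 + 3 / L * `|x| ^+ 2).
have fgD x : `|f x - g x| <= D x.
  rewrite (le_trans (fK _ _))// /D ler_wpM2l ?(ltW K0)//.
  rewrite -(subrKA (l2_trunc l x)) (le_trans (ler_normD _ _))// lerD//.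
    move: `|x - _| (normr_ge0 (x - l2_trunc l x)) => a a0.
    have -> : r + r^-1 * a ^+ 2 = a + r^-1 * ((a - r) ^+ 2 + a * r).
      by field; rewrite gt_eqF.
    by rewrite lerDl mulr_ge0 ?invr_ge0 ?(ltW r0)// addr_ge0 ?sqr_ge0// mulr_ge0// ltW.
  rewrite /l2_trunc -sumrB (le_trans (ler_norm_sum _ _ _))//.
  rewrite (@le_trans _ _ (\sum_(i < l) 3 / L * (x i) ^+ 2))//.
    apply: ler_sum => i _; rewrite -scalerBl normrZ l2_norm_unit mulr1.
    have -> : x i - L * sin (x i / L) = - (L * (sin (x i / L) - x i / L)).
      by field; rewrite gt_eqF.
    rewrite normrN normrM (gtr0_norm L0).
    have -> : 3 / L * x i ^+ 2 = L * (3 * (x i / L) ^+ 2) by field; rewrite gt_eqF.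
    rewrite ler_wpM2l ?(ltW L0)// (le_trans (sin_taylor_bound _ ltr01 (lexx 1)))//.
    have := sqr_ge0 (x i / L); move: (x i / L) => y y2.
    by case: (_ < _) => /=; rewrite ?mulr1 ?mulr0; lra.
  rewrite -mulr_sumr ler_wpM2l//; first by rewrite divr_ge0 ?(ltW L0).
  rewrite -lee_fin l2_normE -(big_mkord xpredT (fun i => x i ^+ 2)) -sumEFin.
  by apply: nneseries_lim_ge => i _; rewrite lee_fin sqr_ge0.
have r_ge0 : 0 <= r := ltW r0.
have L3 : 3 / L * B <= r.
  rewrite /L; have -> : 3 / (3 * (`|B| + 1) / r) * B = r * (B / (`|B| + 1)).
    by field; rewrite !gt_eqF.
  by rewrite ler_piMr// ler_pdivrMr// mul1r (le_trans (ler_norm B))// lerDl.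
have ED d0 (S : measurableType d0) (p : probability S R) (U : S -> l2 R) :
    measurable_fun [set: S] U ->
    p.-integrable [set: S] (EFin \o (fun s => `|U s| ^+ 2)) ->
    \int[p]_s (`|U s| ^+ 2) <= B ->
    \int[p]_s (`|U s - l2_trunc l (U s)| ^+ 2) <= r ^+ 2 ->
    `|\int[p]_s f (U s) - \int[p]_s g (U s)| <= e.
  move=> mU iU UB Ut.
  have iT : p.-integrable [set: S] (EFin \o (fun s => `|U s - l2_trunc l (U s)| ^+ 2)).
    apply: (integrable_dominated _ iU) => [|s].
      apply: l2_norm_sqr_measurable => k.
      under eq_fun do rewrite l2_coordB l2_truncE.
      apply: measurable_funB; first exact: measurable_coord.
      by case: ltnP => _ //; exact: measurable_coord.
    rewrite ger0_norm ?exprn_ge0// -lee_fin l2_norm_tail l2_normE.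
    rewrite [leRHS](nneseries_split 0 l); last by move=> *; rewrite lee_fin sqr_ge0.
    by rewrite add0n leeDr// sume_ge0// => i _; rewrite lee_fin sqr_ge0.
  have i1 : p.-integrable [set: S] (EFin \o (fun=> r)).
    by apply: bmeas_integrable; exact: bmeas_cst.
  have iD := pintZ K (pintD (pintD i1 (pintZ r^-1 iT)) (pintZ (3 / L) iU)).
  rewrite (@le_trans _ _ (\int[p]_s D (U s)))//.
    apply: expect_dist => //; by apply: bmeas_integrable; apply: bmeas_comp.
  rewrite (expectZ K (pintD (pintD i1 (pintZ r^-1 iT)) (pintZ (3 / L) iU))).
  rewrite (expectD (pintD i1 (pintZ r^-1 iT)) (pintZ (3 / L) iU)).
  rewrite (expectD i1 (pintZ r^-1 iT)) expect_cst !expectZ//.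
  rewrite (@le_trans _ _ (K * (r + r + r)))//; last by lra.
  rewrite ler_wpM2l ?(ltW K0)// lerD//.
    rewrite lerD// [leRHS](_ : r = r^-1 * r ^+ 2); last by field; rewrite gt_eqF.
    by rewrite ler_wpM2l ?invr_ge0.
  apply: (le_trans _ L3); apply: ler_wpM2l => //.
  by rewrite divr_ge0// ltW.
exists g; split => //; last by case: Y_bound => iY YB; exact: ED.
near=> n.
have [iX XB] : (P n).-integrable [set: T n] (EFin \o (fun s => `|X n s| ^+ 2)) /\
  \int[P n]_s (`|X n s| ^+ 2) <= B by near: n.
by apply: ED => //; near: n.
Unshelve. all: by end_near. Qed.

Lemma levy_continuity (f : l2 R -> R) (M : R) :
  continuous f -> (forall x, `|f x| <= M) ->
  \int[P n]_s f (X n s) @[n --> \oo] --> \int[Q]_s f (Y s).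
Proof.
move=> cf fM.
(* Lipschitz minorants give one inequality; the other one follows by applying it to [- f]. *)
have H (h : l2 R -> R) (e : R) : continuous h -> (forall x, `|h x| <= M) -> 0 < e ->
    \forall n \near \oo, \int[Q]_s h (Y s) - e <= \int[P n]_s h (X n s).
  move=> ch hM e0; have e2 : 0 < e / 2 by rewrite divr_gt0.
  have bh : bmeas h by split; [exact: l2_continuous_measurable_fun|exists M].
  have bk k : bmeas (inf_conv h k).
    split; last by exists M => x; exact: inf_conv_norm.
    apply: l2_continuous_measurable_fun.
    exact: (lipschitz_continuous (inf_conv_lipschitz hM k)).
  have : \int[Q]_s inf_conv h k (Y s) @[k --> \oo] --> \int[Q]_s h (Y s).
    apply: (@expect_cvg_bounded _ _ _ _ _ _ M) => [k|s|k s].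
    - by case: (bmeas_comp mY (bk k)).
    - by apply: (inf_conv_cvg hM); exact: ch.
    - exact: inf_conv_norm.
  move=> /cvgrPdist_le/(_ _ e2)[k _ /(_ k (leqnn k)) hk].
  (* [k + 1] rather than [k], since [lipschitz_conv] wants a positive constant. *)
  have lk x y : `|inf_conv h k x - inf_conv h k y| <= k.+1%:R * `|x - y|.
    by rewrite (le_trans (inf_conv_lipschitz hM k _ _))// ler_wpM2r// ler_nat.
  have /cvgrPdist_le/(_ _ e2) := lipschitz_conv (ltr0Sn _ k) (inf_conv_norm hM k) lk.
  apply: filterS => n hn.
  have h3 : \int[P n]_s inf_conv h k (X n s) <= \int[P n]_s h (X n s).
    by apply: expect_le => [||s]; [exact: bcomp|exact: bcomp|exact: inf_conv_lef].
  by move: hk hn h3; rewrite !ler_norml => /andP[_ h1] /andP[_ h2]; lra.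
have bf : bmeas f by split; [exact: l2_continuous_measurable_fun|exists M].
apply/cvgrPdist_le => e e0.
have h1 := H f e cf fM e0.
have h2 : \forall n \near \oo, \int[Q]_s (-1 * f (Y s)) - e <= \int[P n]_s (-1 * f (X n s)).
  apply: (H (fun x => -1 * f x)) => // [x|x].
    exact: (continuousZr_fun cf).
  by rewrite mulN1r normrN.
near=> n.
have h1n : \int[Q]_s f (Y s) - e <= \int[P n]_s f (X n s) by near: n.
have : \int[Q]_s (-1 * f (Y s)) - e <= \int[P n]_s (-1 * f (X n s)) by near: n.
rewrite (expectZ _ (bcompY bf)) (expectZ _ (bcomp n bf)) => h2n.
by rewrite ler_norml; lra.
Unshelve. all: by end_near. Qed.

End levy.

(** * Normal laws *)

Section normal_density.
Context {R : realType}.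
Variable s : R.
Hypothesis s0 : 0 < s.

Local Notation leb := (@lebesgue_measure R).
Local Notation p := (normal_pdf 0 s).
Local Notation lint f := (leb.-integrable [set: R] (EFin \o f)).

Let sn0 : s != 0. Proof. by rewrite gt_eqF. Qed.

Let pE x : p x = normal_peak s * expR (- x ^+ 2 / (s ^+ 2 *+ 2)).
Proof. by rewrite normal_pdfE// /normal_fun subr0. Qed.

Let mp : measurable_fun [set: R] p. Proof. exact: measurable_normal_pdf. Qed.

Let ip : lint p. Proof. exact: integrable_normal_pdf. Qed.

(** [normal_prob] is given by its values on sets, where the formula is its definition; [bmeas_ind]
    carries it to functions, with [M * p] dominating on the Lebesgue side. *)
Lemma expect_normal (h : R -> R) : bmeas h ->
  \int[normal_prob 0 s]_x h x = \int[leb]_x (h x * p x).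
Proof.
move=> bh.
have ihp (g : R -> R) : bmeas g -> lint (fun x => g x * p x).
  move=> [mg [M gM]]; apply: (@integrable_dominated _ _ _ leb _ (fun x => M * p x)).
  - exact: measurable_funM.
  - exact: pintZ.
  - by move=> x; rewrite normrM (ger0_norm (normal_pdf_ge0 _ _ _)) ler_wpM2r// normal_pdf_ge0.
have ib (g : R -> R) : bmeas g -> (normal_prob 0 s).-integrable [set: R] (EFin \o g).
  exact: (@bmeas_integrable _ _ _ (normal_prob 0 s)).
pose H (g : R -> R) := bmeas g /\ \int[normal_prob 0 s]_x g x = \int[leb]_x (g x * p x).
suff : H h by case.
apply: bmeas_ind bh => [A mA|f g [bf Hf] [bg Hg]|c f [bf Hf]|f F HF fF].
- split; first exact: bmeas_indic.
  rewrite /Rintegral integral_indic// setIT; congr fine.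
  transitivity (\int[leb]_(x in A) (p x)%:E)%E; first by [].
  rewrite [LHS]integral_mkcond; apply: eq_integral => x _.
  by rewrite patchE indicE; case: ifP => _; rewrite ?mul1r ?mul0r.
- split; first exact: bmeasD.
  under [RHS]eq_Rintegral do rewrite mulrDl.
  by rewrite (expectD (ihp _ bf) (ihp _ bg)) (expectD (ib _ bf) (ib _ bg)) Hf Hg.
- split; first exact: bmeasZ.
  under [RHS]eq_Rintegral do rewrite -mulrA.
  by rewrite (expectZ c (ihp _ bf)) (expectZ c (ib _ bf)) Hf.
- have [bf [M FM] Ff] := bmeas_unif (fun n => (HF n).1) fF; split => //.
  have h1 : \int[normal_prob 0 s]_x F n x @[n --> \oo] --> \int[normal_prob 0 s]_x f x.
    apply: (@expect_cvg_bounded _ _ _ (normal_prob 0 s) _ _ M) => // n.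
    by case: (HF n) => -[].
  have h2 : \int[leb]_x (F n x * p x) @[n --> \oo] --> \int[leb]_x (f x * p x).
    apply: (@expect_cvg _ _ _ leb _ _ (fun x => M * p x)) => [n||x|n x].
    + by apply: measurable_funM => //; case: (HF n) => -[].
    + exact: pintZ.
    + by apply: cvgM; [exact: Ff|exact: cvg_cst].
    + rewrite normrM (ger0_norm (normal_pdf_ge0 _ _ _)) ler_wpM2r//.
      exact: normal_pdf_ge0.
  have e : (fun n => \int[normal_prob 0 s]_x F n x) = (fun n => \int[leb]_x (F n x * p x)).
    by apply/funext => n; case: (HF n).
  by rewrite e in h1; exact: (cvg_unique _ h1 h2).
Qed.

(* [|x| p x] is dominated by a multiple of the normal density of variance [2 s^2]. *)
Let r := Num.sqrt 2 * s.

Let r0 : 0 < r. Proof. by rewrite mulr_gt0// sqrtr_gt0. Qed.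

Let C := s * (normal_peak s / normal_peak r).

(** With [u = x^2 / (4 s^2)] the two exponentials are [exp (- 2 u)] and [exp (- u)], and
    [|x| <= s (1 + u) <= s exp u] by completing a square. [C] collects [s] and the ratio of the
    peaks. *)
Let xp_bound x : `|x| * p x <= C * normal_pdf 0 r x.
Proof.
rewrite pE normal_pdfE ?gt_eqF// /normal_fun subr0.
have rr : r ^+ 2 = 2 * s ^+ 2 by rewrite exprMn sqr_sqrtr.
have k0 : 0 < normal_peak r by rewrite normal_peak_gt0// gt_eqF.
have -> : C * (normal_peak r * expR (- x ^+ 2 / (r ^+ 2 *+ 2))) =
    normal_peak s * (s * expR (- x ^+ 2 / (r ^+ 2 *+ 2))).
  by rewrite /C; field; rewrite gt_eqF.
rewrite mulrCA ler_wpM2l ?normal_peak_ge0//.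
set u := x ^+ 2 / (r ^+ 2 *+ 2).
have uE : u = x ^+ 2 / (4 * s ^+ 2) by rewrite /u rr; field.
have -> : - x ^+ 2 / (s ^+ 2 *+ 2) = - u + - u by rewrite uE; field.
rewrite mulNr -/u expRD mulrA ler_wpM2r ?expR_ge0// expRN.
rewrite ler_pdivrMr ?expR_gt0//.
apply: (@le_trans _ _ (s * (1 + u))); last by rewrite ler_wpM2l ?expR_ge1Dx// ltW.
rewrite uE -(real_normK (num_real x)); move: `|x| => y.
have -> : s * (1 + y ^+ 2 / (4 * s ^+ 2)) = y + (y / 2 - s) ^+ 2 / s by field.
by rewrite lerDl divr_ge0 ?sqr_ge0// ltW.
Qed.

Let iCr : lint (fun x => C * normal_pdf 0 r x).
Proof. by apply: pintZ; exact: integrable_normal_pdf. Qed.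

Let mxp : measurable_fun [set: R] (fun x => x * p x).
Proof. exact: measurable_funM. Qed.

Let ixp (g : R -> R) : bmeas g -> lint (fun x => g x * (x * p x)).
Proof.
move=> [mg [M gM]].
apply: (@integrable_dominated _ _ _ leb _ (fun x => M * (C * normal_pdf 0 r x))).
- exact: measurable_funM.
- exact: pintZ.
- move=> x; rewrite normrM ler_pM//.
  by rewrite normrM (ger0_norm (normal_pdf_ge0 _ _ _)).
Qed.

Variable th : R.

(* Differentiation under the integral and integration by parts give [F' = - s^2 t F]. *)
Let F t := \int[leb]_x (cos (t * x + th) * p x).

Let is_derive_p (x : R) : is_derive x (1 : R) (p : R -> R) (- (x / s ^+ 2) * p x).
Proof.
have -> : p = (fun y => normal_peak s * (expR \o (fun y => - y ^+ 2 / (s ^+ 2 *+ 2))) y).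
  by apply/funext => y; rewrite pE.
have h : is_derive x (1 : R) (fun y : R => - y ^+ 2 / (s ^+ 2 *+ 2)) (- (x / s ^+ 2)).
  by apply: is_derive_eq; rewrite /GRing.scale/=; field.
have := @is_derive1_comp _ expR _ x _ _ (is_derive_expR _) h => h'.
apply: is_derive_eq; rewrite /GRing.scale/=; ring.
Qed.

Let is_derive_cosx (t x : R) : is_derive t (1 : R) (fun t => cos (t * x + th) * p x)
  (- sin (t * x + th) * (x * p x)).
Proof.
have h : is_derive t (1 : R) (fun t : R => t * x + th) x.
  by apply: is_derive_eq; rewrite /GRing.scale/=; ring.
have := @is_derive1_comp _ cos _ t _ _ (is_derive_cos _) h => h'.
apply: is_derive_eq; rewrite /GRing.scale/=; ring.
Qed.

Let is_derive_sinp (t x : R) : is_derive x (1 : R) (fun x => sin (t * x + th) * p x)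
  (t * (cos (t * x + th) * p x) - s ^- 2 * (sin (t * x + th) * (x * p x))).
Proof.
have h : is_derive x (1 : R) (fun x : R => t * x + th) t.
  by apply: is_derive_eq; rewrite /GRing.scale/=; ring.
have := @is_derive1_comp _ sin _ x _ _ (is_derive_sin _) h => h'.
have hp := is_derive_p x.
apply: is_derive_eq; rewrite /GRing.scale/=; field; exact: sn0.
Qed.

Let mlin t : measurable_fun [set: R] (fun x : R => t * x + th).
Proof. by apply: measurable_funD => //; apply: measurable_funM. Qed.

Let icosp t : lint (fun x => cos (t * x + th) * p x).
Proof.
have [mc _] := bmeas_cos (mlin t).
apply: (@integrable_dominated _ _ _ leb _ p) => // [|x].
  exact: measurable_funM.
by rewrite normrM (ger0_norm (normal_pdf_ge0 _ _ _)) ler_piMl ?normal_pdf_ge0// cos_max.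
Qed.

Let isinxp t : lint (fun x => sin (t * x + th) * (x * p x)).
Proof. by apply: ixp; exact: bmeas_sin (mlin t). Qed.

Let is_derive_F t : is_derive t (1 : R) F (- \int[leb]_x (sin (t * x + th) * (x * p x))).
Proof.
pose f t x := cos (t * x + th) * p x.
have a1 : t \in `]t - 1, t + 1[ by rewrite in_itv/= ltrBlDr ltrDl ltr01.
have dfE u x : partial1of2 f u x = - sin (u * x + th) * (x * p x).
  by rewrite partial1of2E; case: (is_derive_cosx u x).
have G0 x : 0 <= C * normal_pdf 0 r x.
  by rewrite (le_trans _ (xp_bound x))// mulr_ge0// normal_pdf_ge0.
have ub u x : `]t - 1, t + 1[%classic u -> [set: R] x -> `|partial1of2 f u x| <= C * normal_pdf 0 r x.
  move=> _ _; rewrite dfE normrM normrN (le_trans _ (xp_bound x))//.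
  rewrite normrM (ger0_norm (normal_pdf_ge0 _ _ _)) ler_piMl ?sin_max//.
  by rewrite mulr_ge0// normal_pdf_ge0.
have df u x : `]t - 1, t + 1[%classic u -> [set: R] x -> derivable (f ^~ x) u 1.
  by move=> _ _; case: (is_derive_cosx u x).
have intf u : `]t - 1, t + 1[%classic u -> lint (f u) by move=> _; exact: icosp.
apply: DeriveDef.
  exact: (derivable_under_integral measurableT a1 intf df G0 iCr ub).
rewrite -derive1E (differentiation_under_integral measurableT a1 intf df G0 iCr ub).
under eq_Rintegral do rewrite dfE mulNr -mulN1r.
by rewrite (expectZ (-1) (isinxp t)) mulN1r.
Qed.

(** The difference of the two sides is the integral of the derivative of [sin (t x + th) p x]. Its
    boundary values at [n + 1] and [- (n + 1)] tend to 0 because [|x| p x] is bounded. *)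
Let ibp t : t * F t = s ^- 2 * \int[leb]_x (sin (t * x + th) * (x * p x)).
Proof.
pose h x := t * (cos (t * x + th) * p x) - s ^- 2 * (sin (t * x + th) * (x * p x)).
have ih : lint h.
  rewrite /h; under eq_fun do rewrite -mulNr.
  by apply: pintD; exact: pintZ.
have hE : \int[leb]_x h x = t * F t - s ^- 2 * \int[leb]_x (sin (t * x + th) * (x * p x)).
  rewrite /h; under eq_Rintegral do rewrite -mulNr.
  rewrite (expectD (pintZ t (icosp t)) (pintZ _ (isinxp t))).
  by rewrite (expectZ _ (icosp t)) (expectZ _ (isinxp t)) mulNr.
suff : \int[leb]_x h x = 0 by move=> h0; apply/eqP; rewrite -subr_eq0 -hE h0.
pose H x := sin (t * x + th) * p x.
have clin : continuous (fun x : R => t * x + th).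
  by move=> x; apply: cvgD; [apply: cvgMr; exact: cvg_id|exact: cvg_cst].
have ccos : continuous (fun x : R => cos (t * x + th)).
  by move=> x; apply: (continuous_comp (clin x)); exact: continuous_cos.
have csin : continuous (fun x : R => sin (t * x + th)).
  by move=> x; apply: (continuous_comp (clin x)); exact: continuous_sin.
have cp : continuous p by exact: continuous_normal_pdf.
have ch : continuous h.
  move=> x; apply: cvgB; apply: cvgMr; apply: cvgM; [exact: ccos|exact: cp|exact: csin|].
  by apply: cvgM; [exact: cvg_id|exact: cp].
have cH : continuous H by move=> x; apply: cvgM; [exact: csin|exact: cp].
have ftc n : \int[leb]_(x in `[- n.+1%:R, n.+1%:R]) h x = H n.+1%:R - H (- n.+1%:R).
  rewrite /Rintegral (@continuous_FTC2 _ h H)//.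
  - by rewrite gtrN.
  - exact: continuous_subspaceT.
  - split.
    + by move=> x _; case: (is_derive_sinp t x).
    + by apply: cvg_at_right_filter; exact: cH.
    + by apply: cvg_at_left_filter; exact: cH.
  - by move=> x _; rewrite derive1E; case: (is_derive_sinp t x).
have lim1 : \int[leb]_(x in `[- n.+1%:R, n.+1%:R]) h x @[n --> \oo] --> \int[leb]_x h x.
  under eq_fun do rewrite Rintegral_mkcond.
  apply: (@expect_cvg _ _ _ leb _ _ (fun x => `|h x|)) => [n||x|n x].
  - apply/measurable_restrict => //; rewrite setTI; apply: measurable_funTS.
    exact: continuous_measurable_fun.
  - exact: (integrable_norm ih).
  - apply: cvg_near_cst; near=> n; rewrite patchE mem_set//= in_itv/= -ler_norml.
    by rewrite -natr1 ler_wpDr//; near: n; exact: nbhs_infty_ger.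
  - by rewrite patchE; case: ifP => _ //; rewrite normr0.
pose K := C * normal_peak r.
have C0 : 0 <= C by rewrite mulr_ge0 ?(ltW s0)// divr_ge0// normal_peak_ge0.
have xpK x : `|x| * p x <= K.
  by rewrite (le_trans (xp_bound x))// ler_wpM2l// normal_pdf_ub// gt_eqF.
have HK x : x != 0 -> `|H x| <= K / `|x|.
  move=> x0; rewrite ler_pdivlMr ?normr_gt0// mulrC (le_trans _ (xpK x))//.
  rewrite ler_wpM2l// /H normrM (ger0_norm (normal_pdf_ge0 _ _ _)).
  by rewrite ler_piMl ?normal_pdf_ge0// sin_max.
have lim2 : \int[leb]_(x in `[- n.+1%:R, n.+1%:R]) h x @[n --> \oo] --> (0 : R).
  apply/norm_cvg0P.
  apply: (@squeeze_cvgr _ _ _ _ (fun=> 0) (fun n => (K *+ 2) * n.+1%:R^-1)).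
  - apply: nearW => n; rewrite normr_ge0 /= ftc (le_trans (ler_normB _ _))//.
    rewrite mulrnAl mulr2n lerD//.
      by rewrite (le_trans (HK _ _))// ger0_norm.
    by rewrite (le_trans (HK _ _)) ?oppr_eq0// normrN ger0_norm.
  - exact: cvg_cst.
  - by rewrite -(mulr0 (K *+ 2)); apply: cvgMr; exact: cvg_harmonic.
exact: (cvg_unique _ lim1 lim2).
Unshelve. all: by end_near. Qed.

(** By the differential equation [F t * expR (s^2 t^2 / 2)] is constant, and its value at 0 is
    [cos th]. *)
Let FE t : F t = cos th * expR (- (s ^+ 2 * t ^+ 2 / 2)).
Proof.
pose G t := F t * expR (s ^+ 2 * t ^+ 2 / 2).
have dF u : is_derive u (1 : R) F (- (s ^+ 2 * u * F u)).
  have -> : s ^+ 2 * u * F u = \int[leb]_x (sin (u * x + th) * (x * p x)).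
    by rewrite -mulrA ibp mulrA divff ?mul1r// expf_neq0.
  exact: is_derive_F.
have dG u : is_derive u (1 : R) G 0.
  have h : is_derive u (1 : R) (fun u : R => s ^+ 2 * u ^+ 2 / 2) (s ^+ 2 * u).
    by apply: is_derive_eq; rewrite /GRing.scale/=; field.
  have h' := @is_derive1_comp _ expR _ u _ _ (is_derive_expR _) h.
  have hF := dF u.
  apply: is_derive_eq; rewrite /GRing.scale/=; ring.
have G0 : G 0 = cos th.
  rewrite /G expr0n mulr0 mul0r expR0 mulr1 /F.
  under eq_Rintegral do rewrite mul0r add0r.
  by rewrite (expectZ _ ip) /Rintegral integral_normal_pdf mulr1.
have := is_derive_0_is_cst t 0 dG; rewrite G0 => <-.
by rewrite /G expRN mulfK// gt_eqF// expR_gt0.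
Qed.

Lemma normal_char t : \int[normal_prob 0 s]_x cos (t * x + th) =
  cos th * expR (- (s ^+ 2 * t ^+ 2 / 2)).
Proof. by rewrite (expect_normal (bmeas_cos (mlin t))) -FE. Qed.

End normal_density.

Lemma centered_normal_char {R : realType} (nu : probability (measurableTypeR R) R)
    (s : R) : 0 <= s -> (forall A : set R, measurable A -> nu A = centered_normal s A) ->
  forall t th, \int[nu]_x cos (t * x + th) = cos th * expR (- (s ^+ 2 * t ^+ 2 / 2)).
Proof.
move=> s_ge0 nuE t th; move: nuE; rewrite /centered_normal; case: eqP => [->|/eqP sn0] nuE.
  have -> : \int[nu]_x cos (t * x + th) = \int[dirac (0 : measurableTypeR R)]_x cos (t * x + th).
    congr fine; apply: eq_measure_integral => A mA _; exact: nuE.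
  rewrite /Rintegral integral_dirac//=; last first.
    apply/measurable_EFinP; case: (@bmeas_cos _ _ (measurableTypeR R) (fun x => t * x + th)) => //.
    by apply: measurable_funD => //; apply: measurable_funM.
  by rewrite indicE in_setT mul1r mulr0 add0r expr0n !mul0r oppr0 expR0 mulr1.
have s0 : 0 < s by rewrite lt_neqAle eq_sym sn0.
rewrite -(normal_char s0); congr fine; apply: eq_measure_integral => A mA _; exact: nuE.
Qed.

(** The quotient [2 N^2 (1 - cos (x / N))] lies between 0 and [x^2] and tends to [x^2], while its
    mean tends to [v]. Fatou's lemma gives integrability of [X^2], then dominated convergence gives
    its value: a characteristic function alone yields a finite variance. *)
Lemma char_second_moment {R : realType} {d} {T : measurableType d}
    (P : probability T R) (X : T -> R) (v : R) :
  measurable_fun [set: T] X ->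
  (forall t, \int[P]_w cos (t * X w) = expR (- (v * t ^+ 2 / 2))) ->
  P.-integrable [set: T] (EFin \o (fun w => X w ^+ 2)) /\
  \int[P]_w (X w ^+ 2) = v.
Proof.
move=> mX XE.
pose q (n : nat) (x : R) := 2 * n.+1%:R ^+ 2 * (1 - cos (n.+1%:R^-1 * x)).
have N0 n : n.+1%:R != 0 :> R by [].
have qc x : q n x @[n --> \oo] --> x ^+ 2.
  apply/cvgrPdist_le => e e0.
  have h : x ^+ 4 * n.+1%:R^-1 @[n --> \oo] --> (0 : R).
    by rewrite -(mulr0 (x ^+ 4)); apply: cvgMr; exact: cvg_harmonic.
  near=> n.
  have -> : x ^+ 2 - q n x = 2 * n.+1%:R ^+ 2 *
      (cos (n.+1%:R^-1 * x) - (1 - (n.+1%:R^-1 * x) ^+ 2 / 2)).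
    by rewrite /q; field; rewrite nat1r.
  rewrite normrM ger0_norm ?mulr_ge0//.
  rewrite (le_trans (ler_wpM2l _ (cos_quartic _)))// ?mulr_ge0//.
  have -> : 2 * n.+1%:R ^+ 2 * ((n.+1%:R^-1 * x) ^+ 4 / 2) = x ^+ 4 * n.+1%:R^-1 / n.+1%:R.
    by field; rewrite nat1r.
  rewrite (@le_trans _ _ (x ^+ 4 * n.+1%:R^-1))//.
    by rewrite ler_pdivrMr// ler_peMr ?ler1n// mulr_ge0// (exprM x 2 2) sqr_ge0.
  by near: n; exact: (cvgr_le _ h).
have q0 n x : 0 <= q n x.
  by rewrite mulr_ge0// subr_ge0; have := cos_max (n.+1%:R^-1 * x); rewrite ler_norml => /andP[].
have qle n x : q n x <= x ^+ 2.
  have := cos_sub1_bound (n.+1%:R^-1 * x); rewrite ler_norml => /andP[h _].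
  have -> : x ^+ 2 = 2 * n.+1%:R ^+ 2 * ((n.+1%:R^-1 * x) ^+ 2 / 2).
    by field; rewrite nat1r.
  by rewrite /q ler_wpM2l ?mulr_ge0// -opprB lerNl.
have bq n : bmeas (fun w => q n (X w)).
  apply: bmeasZ; apply: bmeasD; first exact: bmeas_cst.
  under eq_fun do rewrite -mulN1r.
  by apply: bmeasZ; apply: bmeas_cos; apply: measurable_funM.
have Eq n : \int[P]_w q n (X w) =
    2 * n.+1%:R ^+ 2 * (1 - expR (- (v * n.+1%:R^-1 ^+ 2 / 2))).
  have bc : bmeas (fun w => cos (n.+1%:R^-1 * X w)).
    by apply: bmeas_cos; apply: measurable_funM.
  rewrite /q; under eq_Rintegral do rewrite -mulN1r.
  have ic := bmeas_integrable P bc.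
  have i1 : P.-integrable [set: T] (EFin \o (fun=> 1 : R)).
    by apply: bmeas_integrable; exact: bmeas_cst.
  rewrite (expectZ _ (pintD i1 (pintZ (-1) ic))) (expectD i1 (pintZ (-1) ic)).
  by rewrite (expectZ _ ic) expect_cst XE mulN1r.
have Eqc : \int[P]_w q n (X w) @[n --> \oo] --> v.
  (* The mean of a cosine is at most 1, which forces the sign of [v]. *)
  have v0 : 0 <= v.
    have : \int[P]_w cos (1 * X w) <= 1.
      rewrite (le_trans (ler_norm _))//; apply: expect_norm_le => [|w]; last exact: cos_max.
      by apply: bmeas_integrable; apply: bmeas_cos; apply: measurable_funM.
    by rewrite XE expR_le1 expr1n mulr1 oppr_le0 pmulr_lge0.
  apply/cvgrPdist_le => e e0.
  have h : v ^+ 2 * n.+1%:R^-1 @[n --> \oo] --> (0 : R).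
    by rewrite -(mulr0 (v ^+ 2)); apply: cvgMr; exact: cvg_harmonic.
  near=> n; rewrite Eq.
  set y := v * n.+1%:R^-1 ^+ 2 / 2.
  have y0 : 0 <= y by rewrite /y mulr_ge0// mulr_ge0// exprn_ge0.
  have -> : v - 2 * n.+1%:R ^+ 2 * (1 - expR (- y)) =
      - (2 * n.+1%:R ^+ 2 * (1 - y - expR (- y))).
    by rewrite /y; field; rewrite nat1r.
  rewrite normrN normrM ger0_norm ?mulr_ge0//.
  rewrite (le_trans (ler_wpM2l _ (expR_bound y0)))// ?mulr_ge0//.
  have -> : 2 * n.+1%:R ^+ 2 * y ^+ 2 = v ^+ 2 * n.+1%:R^-1 / (2 * n.+1%:R).
    by rewrite /y; field; rewrite nat1r.
  rewrite (@le_trans _ _ (v ^+ 2 * n.+1%:R^-1))//.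
    rewrite ler_pdivrMr ?mulr_gt0// ler_peMr ?mulr_ge0 ?sqr_ge0//.
    by rewrite -natrM ler1n.
  by near: n; exact: (cvgr_le _ h).
have iX : P.-integrable [set: T] (EFin \o (fun w => X w ^+ 2)).
  apply/integrableP; split; first by apply/measurable_EFinP; exact: measurable_funX.
  apply: (@le_lt_trans _ _ v%:E); last by rewrite ltry.
  have mq n : measurable_fun [set: T] (fun w => (q n (X w))%:E).
    by apply/measurable_EFinP; case: (bq n).
  have q0e n w : [set: T] w -> (0 <= (q n (X w))%:E)%E by rewrite lee_fin.
  have := fatou P measurableT mq q0e.
  rewrite (@eq_integral _ _ _ P _ (fun w => `|(X w ^+ 2)%:E|%E)); last first.
    move=> w _; rewrite gee0_abs ?lee_fin ?sqr_ge0//.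
    have h : (q n (X w))%:E @[n --> \oo] --> (X w ^+ 2)%:E.
      by apply: cvg_EFin; [exact: nearW|exact: qc].
    by rewrite (cvg_limn_einf_sup h).1.
  move=> h; rewrite (le_trans h)//.
  have h2 : (\int[P]_w (q n (X w))%:E)%E @[n --> \oo] --> v%:E.
    under eq_fun do rewrite -(fineK (integrable_fin_num measurableT (bmeas_integrable P (bq _)))).
    by apply: cvg_EFin; [exact: nearW|exact: Eqc].
  by rewrite (cvg_limn_einf_sup h2).1.
split => //.
have h : \int[P]_w q n (X w) @[n --> \oo] --> \int[P]_w (X w ^+ 2).
  apply: (@expect_cvg _ _ _ P _ _ (fun w => X w ^+ 2)) => // [n|n w].
    by case: (bq n).
  by rewrite ger0_norm.
exact: (cvg_unique _ h Eqc).
Unshelve. all: by end_near. Qed.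

(** * Extension from rays and from continuous functions to bounded measurable ones *)

Section ray_extension.
Context {R : realType} {d d'} {T : measurableType d} {T' : measurableType d'}.
Variables (P : probability T R) (X W : T -> R).
Variables (P' : probability T' R) (X' W' : T' -> R).
Hypothesis mX : measurable_fun [set: T] X.
Hypothesis mX' : measurable_fun [set: T'] X'.
Hypothesis bW : bmeas W.
Hypothesis bW' : bmeas W'.
Lemma expect_eq_cvg (F : nat -> R -> R) (f : R -> R) (M : R) :
  (forall n, measurable_fun [set: R] (F n)) -> (forall n x, `|F n x| <= M) ->
  (forall x, F n x @[n --> \oo] --> f x) ->
  (forall n, \int[P]_w (W w * F n (X w)) = \int[P']_w (W' w * F n (X' w))) ->
  \int[P]_w (W w * f (X w)) = \int[P']_w (W' w * f (X' w)).
Proof.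
move=> mF FM Ff FE; have [mW [K WK]] := bW; have [mW' [K' WK']] := bW'.
have h1 : \int[P]_w (W w * F n (X w)) @[n --> \oo] --> \int[P]_w (W w * f (X w)).
  apply: (@expect_cvg_bounded _ _ _ P _ _ (K * M)) => [n|w|n w].
  - by apply: measurable_funM => //; apply: measurableT_comp.
  - by apply: cvgMr; exact: Ff.
  - by rewrite normrM ler_pM.
have h2 : \int[P']_w (W' w * F n (X' w)) @[n --> \oo] --> \int[P']_w (W' w * f (X' w)).
  apply: (@expect_cvg_bounded _ _ _ P' _ _ (K' * M)) => [n|w|n w].
  - by apply: measurable_funM => //; apply: measurableT_comp.
  - by apply: cvgMr; exact: Ff.
  - by rewrite normrM ler_pM.
have e : (fun n => \int[P]_w (W w * F n (X w))) = (fun n => \int[P']_w (W' w * F n (X' w))).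
  exact/funext.
by rewrite e in h1; exact: (cvg_unique _ h1 h2).
Qed.

Let iWX (g : R -> R) : bmeas g -> P.-integrable [set: T] (EFin \o (fun w => W w * g (X w))).
Proof. by move=> bg; apply: bmeas_integrable; apply: bmeasM => //; exact: bmeas_comp. Qed.

Let iWX' (g : R -> R) : bmeas g -> P'.-integrable [set: T'] (EFin \o (fun w => W' w * g (X' w))).
Proof. by move=> bg; apply: bmeas_integrable; apply: bmeasM => //; exact: bmeas_comp. Qed.

Let eqf (g : R -> R) := \int[P]_w (W w * g (X w)) = \int[P']_w (W' w * g (X' w)).

Let eqfD (f g : R -> R) : bmeas f -> bmeas g -> eqf f -> eqf g -> eqf (fun x => f x + g x).
Proof.
move=> bf bg ef eg; rewrite /eqf.
under eq_Rintegral do rewrite mulrDr.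
under [RHS]eq_Rintegral do rewrite mulrDr.
rewrite (expectD (iWX bf) (iWX bg)) (expectD (iWX' bf) (iWX' bg)).
by rewrite ef eg.
Qed.

Let eqfZ (c : R) (f : R -> R) : bmeas f -> eqf f -> eqf (fun x => c * f x).
Proof.
move=> bf ef; rewrite /eqf.
under eq_Rintegral do rewrite mulrCA.
under [RHS]eq_Rintegral do rewrite mulrCA.
by rewrite (expectZ c (iWX bf)) (expectZ c (iWX' bf)) ef.
Qed.

Hypothesis eqf1 : \int[P]_w (W w * 1) = \int[P']_w (W' w * 1).
Hypothesis eqf_ray : forall b, 
  \int[P]_w (W w * \1_(`]b, +oo[) (X w)) = \int[P']_w (W' w * \1_(`]b, +oo[) (X' w)).

(** The open rays are stable under intersection and generate the Borel sets, so Dynkin's theorem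
    covers all indicators, and [bmeas_ind] the rest. The weights [W] and [W'] can carry a bounded
    function of a second variable, which is how joint laws are treated. *)
Lemma ray_extension (h : R -> R) : bmeas h ->
  \int[P]_w (W w * h (X w)) = \int[P']_w (W' w * h (X' w)).
Proof.
move=> bh; suff : bmeas h /\ eqf h by case.
have e1 : eqf (fun=> 1) by exact: eqf1.
have b1 (A : set R) : measurable A -> bmeas (\1_A : R -> R) by exact: bmeas_indic.
apply: (@bmeas_ind _ _ _ (fun h => bmeas h /\ eqf h)) bh => [A mA|f g [bf Hf] [bg Hg]|c f [bf Hf]|f F HF fF].
- split; first exact: b1.
  move: mA; rewrite [X in X A -> _](RGenOInfty.measurableE R).
  apply: (@dynkin_induction _ (measurableTypeR R) (@RGenOInfty.G R)
    (fun A => eqf \1_A) (RGenOInfty.measurableE R)) => //.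
  + move=> _ _ [x ->] [y ->]; exists (Num.max x y).
    apply/seteqP; split => z /=; rewrite !in_itv/= gt_max !andbT; first by case=> -> ->.
    by move=> /andP[-> ->].
  + have := e1; congr eqf; apply/funext => x; by rewrite indicE in_setT.
  + by move=> _ [x ->]; exact: eqf_ray.
  + move=> S mS eS; have := eqfD (bmeas_cst 1) (bmeasZ (-1) (b1 _ mS)) e1 (eqfZ (-1) (b1 _ mS) eS).
    congr eqf; apply/funext => x; rewrite !indicE in_setC.
    by case: (_ \in _) => /=; rewrite ?mulr1 ?mulr0 ?subrr ?addr0.
  + move=> F mF tF eF.
    have SE n x : \sum_(i < n) \1_(F i) x = \1_(\big[setU/set0]_(i < n) F i) x :> R.
      elim: n => [|n ih]; first by rewrite !big_ord0 indicE in_set0.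
      rewrite !big_ord_recr/= ih !indicE in_setU -natrD; congr (_%:R).
      case: (boolP (x \in F n)) => xn; rewrite ?orbF ?addn0// orbT.
      case: (boolP (x \in \big[setU/set0]_(i < n) F i)) => //.
      rewrite inE -bigcup_mkord => -[i /= ni Fi].
      have := tF i n I I (ex_intro _ x (conj Fi (set_mem xn))) => e.
      by move: ni; rewrite e ltnn.
    have H n : bmeas (fun x : R => \sum_(i < n) \1_(F i) x : R) /\
        eqf (fun x => \sum_(i < n) \1_(F i) x).
      elim: n => [|n [ihb ih]].
        under eq_fun do rewrite big_ord0; split; first exact: bmeas_cst.
        have := eqfZ 0 (bmeas_cst 1) e1; congr eqf; apply/funext => x; by rewrite mul0r.
      under eq_fun do rewrite big_ord_recr/=; split.
        by apply: bmeasD => //; apply: b1; exact: mF.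
      by apply: eqfD => //; apply: b1; exact: mF.
    apply: (@expect_eq_cvg (fun n => \1_(\big[setU/set0]_(i < n) F i)) _ 1) => [n|n x|x|n].
    * by apply: measurable_indic; apply: bigsetU_measurable => i _; exact: mF.
    * by rewrite indicE; case: (_ \in _); rewrite ?normr1// normr0.
    * apply: cvg_near_cst; have [[k _ Fk]|nF] := pselect ((\bigcup_k F k) x).
        near=> n; rewrite !indicE !mem_set//; first by exists k.
        by rewrite -bigcup_mkord; exists k => //=; near: n; exact: nbhs_infty_gt.
      apply: nearW => n; rewrite !indicE !memNset// -bigcup_mkord => -[k _ Fk].
      by apply: nF; exists k.
    * by case: (H n) => _; congr eqf; apply/funext => x; exact: SE.
- by split; [exact: bmeasD|exact: eqfD].
- by split; [exact: bmeasZ|exact: eqfZ].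
- have [bf [M FM] Ff] := bmeas_unif (fun n => (HF n).1) fF; split => //.
  apply: (@expect_eq_cvg F _ M) => // n; first by case: (HF n) => -[].
  by case: (HF n).
Unshelve. all: by end_near. Qed.

End ray_extension.

Section continuous_extension.
Context {R : realType} {d d'} {T : measurableType d} {T' : measurableType d'}.
Variables (P : probability T R) (X W : T -> R).
Variables (P' : probability T' R) (X' W' : T' -> R).
Hypothesis mX : measurable_fun [set: T] X.
Hypothesis mX' : measurable_fun [set: T'] X'.
Hypothesis bW : bmeas W.
Hypothesis bW' : bmeas W'.

(** The indicator of []b, +oo[] is the pointwise limit of the continuous functions
    [1 - exp (- n m)], where [m] is the positive part of [x - b]. *)
Lemma continuous_extension (h : R -> R) :
  (forall (g : R -> R) (M : R), continuous g -> (forall x, `|g x| <= M) ->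
    \int[P]_w (W w * g (X w)) = \int[P']_w (W' w * g (X' w))) ->
  bmeas h ->
  \int[P]_w (W w * h (X w)) = \int[P']_w (W' w * h (X' w)).
Proof.
move=> eq_cont; move=> bh; apply: ray_extension bh => //.
  by apply: (eq_cont (fun=> 1) 1) => [x|x]; [exact: cvg_cst|rewrite normr1].
move=> b.
pose m (x : R) := (x - b + `|x - b|) / 2.
have m0 x : 0 <= m x by rewrite divr_ge0// addrC -lerBlDr sub0r ler_normr lexx orbT.
pose F (n : nat) (x : R) := 1 - expR (- (n%:R * m x)).
have Fb n x : `|F n x| <= 1.
  rewrite /F; have h1 : expR (- (n%:R * m x)) <= 1.
    by rewrite expR_le1 oppr_le0 mulr_ge0.
  by rewrite ger0_norm ?subr_ge0// gerBl expR_ge0.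
have cF n : continuous (F n).
  have cb : continuous (fun x : R => x - b).
    by move=> x; apply: cvgB; [exact: cvg_id|exact: cvg_cst].
  have cm : continuous (fun x => - (n%:R * m x)).
    move=> x; apply: cvgN; apply: cvgMr; apply: cvgMl; apply: cvgD; first exact: cb.
    by apply: cvg_norm; exact: cb.
  move=> x; apply: cvgB; first exact: cvg_cst.
  exact: (continuous_comp (cm x) (@continuous_expR R _)).
apply: (@expect_eq_cvg _ _ _ _ _ P X W P' X' W' mX mX' bW bW' F _ 1) => // [n|x|n].
- exact: continuous_measurable_fun.
- rewrite indicE; have [xb|xb] := ltP b x.
    rewrite mem_set/= ?in_itv/= ?andbT//.
    have mx : 0 < m x by rewrite /m ger0_norm ?subr_ge0 ?ltW// divr_gt0// addr_gt0// subr_gt0.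
    rewrite -[X in _ --> X]subr0; apply: cvgB; first exact: cvg_cst.
    apply/cvgr0Pnorm_le => e e0; near=> n.
    rewrite ger0_norm ?expR_ge0// expRN -[leRHS]invrK lef_pV2 ?posrE ?expR_gt0 ?invr_gt0//.
    rewrite (le_trans _ (expR_ge1Dx _))// ler_wpDl//.
    by rewrite -ler_pdivrMr//; near: n; exact: nbhs_infty_ger.
  rewrite memNset/=; last by rewrite in_itv/= andbT ltNge xb.
  rewrite /F /m ler0_norm ?subr_le0// subrr mul0r.
  by under eq_fun do rewrite mulr0 oppr0 expR0 subrr; exact: cvg_cst.
- by apply: (eq_cont (F n) 1).
Unshelve. all: by end_near. Qed.

End continuous_extension.

(** The line is embedded in [l2] along the first unit vector and [levy_continuity] is applied to the
    constant sequence [nu] with limit [nu']. The second moments provide the bound required there,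
    and the tails beyond one coordinate are 0. *)
Lemma char_unique {R : realType} (nu nu' : probability (measurableTypeR R) R) :
  nu.-integrable [set: R] (EFin \o (fun x => x ^+ 2)) ->
  nu'.-integrable [set: R] (EFin \o (fun x => x ^+ 2)) ->
  (forall t th, \int[nu]_x cos (t * x + th) = \int[nu']_x cos (t * x + th)) ->
  forall A : set R, measurable A -> nu A = nu' A.
Proof.
move=> i1 i2 ch A mA.
pose e0 := @l2_unit R 0.
have e00 x : (x *: e0 : l2 R) 0%N = x by rewrite l2_coordZ l2_unitE eqxx mulr1.
have mX : measurable_fun [set: measurableTypeR R] (fun x : R => x *: e0).
  apply: measurable_l2 => k; under eq_fun do rewrite l2_coordZ.
  exact: measurable_funM.
have nX (x : R) : `|x *: e0| ^+ 2 = x ^+ 2.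
  by rewrite normrZ l2_norm_unit mulr1 real_normK ?num_real.
have tX (x : R) : `|x *: e0 - l2_trunc 1 (x *: e0)| ^+ 2 = 0.
  by rewrite /l2_trunc big_ord1 e00 subrr normr0 expr0n.
have H (g : R -> R) (M : R) : continuous g -> (forall x, `|g x| <= M) ->
    \int[nu]_x g x = \int[nu']_x g x.
  move=> cg gM.
  have cf : continuous (fun x : l2 R => g (x 0%N)).
    by move=> x; apply: (continuous_comp (@l2_coord_continuous R 0%N x)); exact: cg.
  pose B := Num.max (\int[nu]_x (x ^+ 2)) (\int[nu']_x (x ^+ 2)).
  have iX (m : probability (measurableTypeR R) R) :
      m.-integrable [set: R] (EFin \o (fun x => x ^+ 2)) ->
      m.-integrable [set: R] (EFin \o (fun x => `|x *: e0| ^+ 2)).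
    by have -> : (fun x : R => `|x *: e0| ^+ 2) = (fun x => x ^+ 2) by exact/funext.
  have EX (m : probability (measurableTypeR R) R) :
      \int[m]_x (`|x *: e0| ^+ 2) = \int[m]_x (x ^+ 2).
    by under eq_Rintegral do rewrite nX.
  have ET (m : probability (measurableTypeR R) R) :
      \int[m]_x (`|x *: e0 - l2_trunc 1 (x *: e0)| ^+ 2) = 0.
    by under eq_Rintegral do rewrite tX; rewrite expect_cst.
  have lin l (t : nat -> R) x th : \sum_(k < l) t k * (x *: e0 : l2 R) k + th =
      (if (0 < l)%N then t 0%N else 0) * x + th.
    case: l => [|l]; first by rewrite big_ord0 mul0r.
    under eq_bigr do rewrite l2_coordZ l2_unitE.
    by rewrite big_ord_recl/= mulr1 big1 ?addr0// => k _; rewrite !mulr0.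
  have linE (m : probability (measurableTypeR R) R) l (t : nat -> R) th :
      \int[m]_x cos (\sum_(k < l) t k * (x *: e0 : l2 R) k + th) =
      \int[m]_x cos ((if (0 < l)%N then t 0%N else 0) * x + th).
    by under eq_Rintegral do rewrite lin.
  have h : \int[nu]_x g ((x *: e0 : l2 R) 0%N) @[n --> \oo] -->
      \int[nu']_x g ((x *: e0 : l2 R) 0%N).
    apply: (@levy_continuity R _ (fun=> measurableTypeR R) _ (measurableTypeR R)
      (fun=> nu) (fun _ x => x *: e0) nu' (fun x => x *: e0) B (fun=> mX) mX _ _ _ _
      (fun x : l2 R => g (x 0%N)) M cf) => //.
    - by move=> l t th; rewrite !linE ch; exact: cvg_cst.
    - by apply: nearW => _; split; [exact: iX|rewrite EX le_max lexx].
    - by split; [exact: iX|rewrite EX le_max lexx orbT].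
    - by move=> e epos; exists 1%N; split; [apply: nearW => _|]; rewrite ET ltW.
  have e1 (m : probability (measurableTypeR R) R) :
      \int[m]_x g ((x *: e0 : l2 R) 0%N) = \int[m]_x g x.
    by under eq_Rintegral do rewrite e00.
  rewrite !e1 in h.
  have hc : \int[nu]_x g x @[_ --> \oo] --> \int[nu]_x g x by exact: cvg_cst.
  exact: (cvg_unique _ hc h).
have bA : bmeas (\1_A : measurableTypeR R -> R) by exact: bmeas_indic.
have ind (m : probability (measurableTypeR R) R) : \int[m]_x (1 * \1_A x) = fine (m A).
  by under eq_Rintegral do rewrite mul1r; rewrite /Rintegral integral_indic// setIT.
have := @continuous_extension R _ _ _ _ nu id (fun=> 1) nu' id (fun=> 1)
  (@measurable_id _ _ _) (@measurable_id _ _ _) (bmeas_cst 1) (bmeas_cst 1) _ _ bA.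
rewrite !ind => e; rewrite -(fineK (fin_num_measure nu _ mA)) -(fineK (fin_num_measure nu' _ mA)).
rewrite e// => g M cg gM.
under eq_Rintegral do rewrite mul1r.
by under [RHS]eq_Rintegral do rewrite mul1r; exact: H gM.
Qed.

(** * Independent normal variables on the unit interval *)

Section digit_sums.
Context {R : realType}.

(** A base 4 digit is a pair of binary digits: the quotient by 2 is the one at an even place,
    counted from 0 at the leading digit, and the remainder the one at an odd place. *)
Fixpoint even_digits k i : nat :=
  if k is k'.+1 then (even_digits k' (i %/ 4) * 2 + i %% 4 %/ 2)%N else 0%N.

Fixpoint odd_digits k i : nat :=
  if k is k'.+1 then (odd_digits k' (i %/ 4) * 2 + i %% 4 %% 2)%N else 0%N.

Lemma even_digits_lt k i : (even_digits k i < 2 ^ k)%N.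
Proof.
elim: k i => //= k ih i; have := ih (i %/ 4)%N.
have : (i %% 4 %/ 2 < 2)%N by rewrite ltn_divLR// ltn_mod.
by rewrite expnS; lia.
Qed.

Lemma odd_digits_lt k i : (odd_digits k i < 2 ^ k)%N.
Proof.
elim: k i => //= k ih i; have := ih (i %/ 4)%N.
have : (i %% 4 %% 2 < 2)%N by rewrite ltn_mod.
by rewrite expnS; lia.
Qed.

Lemma sum_split2 M (h : nat -> R) : \sum_(i < M * 2) h i =
  \sum_(i < M) (h (i * 2)%N + h (i * 2 + 1)%N).
Proof.
elim: M => [|M ih]; first by rewrite mul0n !big_ord0.
rewrite (_ : M.+1 * 2 = (M * 2).+2)%N; last by lia.
rewrite !big_ord_recr/= ih -addrA; congr (_ + (_ + _)); congr h; lia.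
Qed.

Lemma sum_split4 M (h : nat -> R) : \sum_(i < M * 4) h i =
  \sum_(i < M) (h (i * 4)%N + h (i * 4 + 1)%N + (h (i * 4 + 2)%N + h (i * 4 + 3)%N)).
Proof.
rewrite (_ : M * 4 = M * 2 * 2)%N; last by lia.
rewrite sum_split2 (sum_split2 M (fun i => h (i * 2)%N + h (i * 2 + 1)%N)).
apply: eq_bigr => i _.
by congr (h _ + h _ + (h _ + h _)); lia.
Qed.

(* Splitting the base 4 digits is a bijection from [0, 4^k) to [0, 2^k)^2. *)
Lemma sum_digits k (g : nat -> nat -> R) :
  \sum_(i < 4 ^ k) g (even_digits k i) (odd_digits k i) =
  \sum_(a < 2 ^ k) \sum_(b < 2 ^ k) g a b.
Proof.
elim: k g => [|k ih] g; first by rewrite !expn0 !big_ord1.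
rewrite [in LHS]expnSr (sum_split4 _ (fun i => g (even_digits k.+1 i) (odd_digits k.+1 i))).
rewrite (eq_bigr (fun i : 'I_(4 ^ k) => let a := even_digits k i in let b := odd_digits k i in
    g (a * 2)%N (b * 2)%N + g (a * 2)%N (b * 2 + 1)%N +
    (g (a * 2 + 1)%N (b * 2)%N + g (a * 2 + 1)%N (b * 2 + 1)%N))); last first.
  move=> i _.
  have eE d : (d < 4)%N -> even_digits k.+1 (i * 4 + d) = (even_digits k i * 2 + d %/ 2)%N.
    by move=> d4; rewrite /= divnMDl// modnMDl (divn_small d4) (modn_small d4) addn0.
  have oE d : (d < 4)%N -> odd_digits k.+1 (i * 4 + d) = (odd_digits k i * 2 + d %% 2)%N.
    by move=> d4; rewrite /= divnMDl// modnMDl (divn_small d4) (modn_small d4) addn0.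
  by rewrite -[X in g (even_digits k.+1 X)]addn0 -[X in odd_digits k.+1 X]addn0 !eE// !oE// !addn0.
rewrite /= (ih (fun a b => g (a * 2)%N (b * 2)%N + g (a * 2)%N (b * 2 + 1)%N +
    (g (a * 2 + 1)%N (b * 2)%N + g (a * 2 + 1)%N (b * 2 + 1)%N))).
rewrite [in RHS]expnSr (sum_split2 _ (fun a => \sum_(b < _) g a b)).
apply: eq_bigr => a _.
rewrite (sum_split2 _ (g (a * 2)%N)) (sum_split2 _ (g (a * 2 + 1)%N)) -big_split/=.
by apply: eq_bigr => b _.
Qed.

End digit_sums.

Section uniform_digits.
Context {R : realType}.

Definition unif : probability (measurableTypeR R) R := uniform_prob (@ltr01 R).

(* The number formed by the first [N] binary digits; [`|u|] rather than [u] only matters outside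
   the support [0, 1] of [unif]. *)
Definition digits N (u : R) : nat := Num.truncn (2 ^+ N * `|u|).

Let pow0 N : 0 < 2 ^+ N :> R. Proof. by rewrite exprn_gt0. Qed.

Let digits_itv N u : (digits N u)%:R <= 2 ^+ N * `|u| < (digits N u).+1%:R.
Proof. by rewrite truncn_itv// mulr_ge0// ltW. Qed.

Lemma digits_div4 N u : (digits N.+2 u %/ 4)%N = digits N u.
Proof.
have /andP[h1 h2] := digits_itv N u.
have e : 2 ^+ N.+2 * `|u| = 4 * (2 ^+ N * `|u|) by rewrite !exprS; ring.
have h3 : ((digits N u * 4)%N <= digits N.+2 u)%N.
  rewrite /digits e truncn_ge_nat ?mulr_ge0 ?(ltW (pow0 N))// natrM mulrC.
  by rewrite ler_pM2l.
have h4 : (digits N.+2 u < (digits N u).+1 * 4)%N.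
  rewrite [X in (X < _)%N]/digits e truncn_lt_nat ?mulr_ge0 ?(ltW (pow0 N))// natrM mulrC.
  by rewrite ltr_pM2r.
by apply/eqP; rewrite eqn_leq leq_divRL// h3 -ltnS ltn_divLR// h4.
Qed.

Let measurable_digits_eq N i : measurable [set u : measurableTypeR R | digits N u = i].
Proof.
have mf : measurable_fun [set: measurableTypeR R] (fun u : R => 2 ^+ N * `|u|).
  by apply: measurable_funM => //; exact: normr_measurable.
have -> : [set u | digits N u = i] =
    [set: R] `&` (fun u : R => 2 ^+ N * `|u|) @^-1` `[i%:R, i.+1%:R[.
  rewrite setTI; apply/seteqP; split => u /=; rewrite in_itv/=.
    by move=> <-; exact: digits_itv.
  by move=> h; apply/eqP; rewrite truncn_eq// mulr_ge0// ltW.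
exact: mf.
Qed.

Lemma measurable_digits N (g : nat -> R) :
  measurable_fun [set: measurableTypeR R] (fun u => g (digits N u)).
Proof.
move=> _ B mB; rewrite setTI.
have -> : (fun u => g (digits N u)) @^-1` B =
    \bigcup_(i in [set i | B (g i)]) [set u | digits N u = i].
  by apply/seteqP; split => u /=; [exists (digits N u)|case=> i /= Bi ui; rewrite ui].
by rewrite bigcup_mkcond; apply: bigcupT_measurable => i; case: ifP.
Qed.

Let digits_prob N i : (i < 2 ^ N)%N ->
  unif [set u | digits N u = i] = (2 ^- N)%:E.
Proof.
move=> iN.
have iN' : i.+1%:R <= 2 ^+ N :> R by rewrite -natrX ler_nat.
transitivity (\int[lebesgue_measure]_(x in [set u | digits N u = i] `&` `[(0%R : R), 1%R])
    (uniform_pdf 0%R 1%R x)%:E)%E.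
  by rewrite -integral_uniform_pdf.
have -> : [set u | digits N u = i] `&` `[(0 : R), 1] =
    `[i%:R / 2 ^+ N, i.+1%:R / 2 ^+ N[%classic.
  apply/seteqP; split => u /=; rewrite !in_itv/=.
    move=> [<- /andP[u0 u1]]; have := digits_itv N u; rewrite (ger0_norm u0).
    by rewrite ler_pdivrMr// ltr_pdivlMr// mulrC.
  rewrite ler_pdivrMr// ltr_pdivlMr// mulrC => h.
  have u0 : 0 <= u.
    by rewrite -(pmulr_rge0 _ (pow0 N)); case/andP: h => h _; exact: le_trans h.
  split; last first.
    rewrite u0 -(ler_pM2l (pow0 N)) mulr1; case/andP: h => _ h.
    exact: le_trans (ltW h) iN'.
  by apply/eqP; rewrite truncn_eq ?ger0_norm// mulr_ge0// ltW.
rewrite (eq_integral (fun=> 1%E)); last first.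
  move=> x; rewrite inE/= in_itv/= => /andP[h1 h2]; rewrite /uniform_pdf.
  have x0 : 0 <= x by apply: le_trans h1; rewrite divr_ge0// ltW.
  have x1 : x <= 1.
    by rewrite (le_trans (ltW h2))// ler_pdivrMr// mul1r.
  by rewrite x0 x1 subr0 invr1.
rewrite integral_cst//= mul1e lebesgue_measure_itv/= lte_fin.
rewrite ltr_pM2r ?invr_gt0// ltr_nat ltnSn -EFinD -mulrBl -natr1 [i%:R + 1]addrC addrK.
by rewrite mul1r.
Qed.

Lemma digits_expect N (g : nat -> R) (M : R) : (forall i, `|g i| <= M) ->
  \int[unif]_u g (digits N u) = 2 ^- N * \sum_(i < 2 ^ N) g i.
Proof.
move=> gM.
(* The exceptional event [|u| >= 1], which contains the endpoint 1 of the support. It is null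
   because the other [2^N] values, of mass [2^-N] each, exhaust the total mass. *)
pose A := [set u | (2 ^ N <= digits N u)%N].
pose S u := \sum_(i < 2 ^ N) g i * \1_[set u | digits N u = i] u.
have bI i : bmeas (\1_[set u : measurableTypeR R | digits N u = i] : _ -> R).
  exact: bmeas_indic.
have EI (B : set (measurableTypeR R)) : measurable B -> \int[unif]_u \1_B u = fine (unif B).
  by move=> mB; rewrite /Rintegral integral_indic// setIT.
have iI i := bmeas_integrable unif (bI i).
have ES : \int[unif]_u S u = 2 ^- N * \sum_(i < 2 ^ N) g i.
  rewrite /S expect_sum => [|i]; last by apply: pintZ; exact: iI.
  rewrite mulr_sumr; apply: eq_bigr => i _.
  by rewrite (expectZ _ (iI i)) EI// digits_prob//= mulrC.
have mA : measurable (A : set (measurableTypeR R)).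
  have -> : A = \bigcup_(i in [set i | (2 ^ N <= i)%N]) [set u | digits N u = i].
    by apply/seteqP; split => u /=; [exists (digits N u)|case=> i /= Bi ui; rewrite /A /= ui].
  by rewrite bigcup_mkcond; apply: bigcupT_measurable => i; case: ifP.
have iA : unif.-integrable [set: measurableTypeR R] (EFin \o (\1_A : _ -> R)).
  by apply: bmeas_integrable; exact: bmeas_indic.
have EA : \int[unif]_u \1_A u = 0.
  have : \int[unif]_u (\1_A u + \sum_(i < 2 ^ N) \1_[set u | digits N u = i] u) = 1.
    rewrite (@eq_Rintegral _ _ _ unif _ (fun=> 1)) ?expect_cst// => u _.
    rewrite indicE; case: (boolP (u \in A)) => [|nA].
      rewrite inE /A /= => Nu; rewrite big1 ?addr0// => i _.
      by rewrite indicE memNset//= => e; move: (ltn_ord i); rewrite -e ltnNge Nu.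
    have uN : (digits N u < 2 ^ N)%N.
      by rewrite ltnNge; apply/negP => h; move/negP: nA; apply; rewrite inE.
    rewrite (bigD1 (Ordinal uN))//= indicE mem_set// big1 ?addr0 ?add0r// => i iu.
    rewrite indicE memNset//= => e; move/eqP: iu; apply; apply: val_inj => /=.
    by rewrite e.
  rewrite (expectD iA); last by apply: pint_sum => i; exact: iI.
  rewrite expect_sum// (eq_bigr (fun=> 2 ^- N)); last first.
    by move=> i _; rewrite EI// digits_prob.
  rewrite sumr_const card_ord -[_ *+ (2 ^ N)%N]mulr_natr natrX mulVf ?gt_eqF//.
  by move=> e; lra.
have bg : bmeas (fun u : measurableTypeR R => g (digits N u)).
  by split; [exact: measurable_digits|exists M].
apply/eqP; rewrite -subr_eq0 -normr_le0 -ES.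
apply: (@le_trans _ _ (\int[unif]_u (M * \1_A u))); last by rewrite (expectZ _ iA) EA mulr0.
apply: expect_dist.
- exact: bmeas_integrable.
- by apply: pint_sum => i; apply: pintZ; exact: iI.
- exact: pintZ.
- move=> u; rewrite /S indicE; case: (boolP (u \in A)) => [|nA].
    rewrite inE /A /= => Nu; rewrite big1 ?subr0 ?mulr1// => i _.
    by rewrite indicE memNset ?mulr0//= => e; move: (ltn_ord i); rewrite -e ltnNge Nu.
  have uN : (digits N u < 2 ^ N)%N.
    by rewrite ltnNge; apply/negP => h; move/negP: nA; apply; rewrite inE.
  rewrite (bigD1 (Ordinal uN))//= indicE mem_set// mulr1 big1 ?addr0 ?subrr ?normr0 ?mulr0// => i iu.
  rewrite indicE memNset ?mulr0//= => e; move/eqP: iu; apply; apply: val_inj => /=.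
  by rewrite e.
Qed.

End uniform_digits.

(** * Independence of the even and the odd digits *)

Section splitting.
Context {R : realType}.
Local Notation U := (@unif R).
Local Notation RM := (measurableTypeR R).

Section digit_limit.
Variables (dig : nat -> nat -> nat) (bit : nat -> nat).
Hypothesis dig_lt : forall k i, (dig k i < 2 ^ k)%N.
Hypothesis digS : forall k i, dig k.+1 i = (dig k (i %/ 4) * 2 + bit (i %% 4))%N.

Definition digit_seq k (u : R) : R := (dig k (digits k.*2 u))%:R / 2 ^+ k.

Definition digit_lim (u : R) : R := limn (digit_seq ^~ u).

Lemma digit_seq_cvg u : digit_seq k u @[k --> \oo] --> digit_lim u.
Proof.
have p0 k : 0 < 2 ^+ k :> R by rewrite exprn_gt0.
apply: nondecreasing_is_cvgn.
  apply/nondecreasing_seqP => k; rewrite /digit_seq doubleS digS digits_div4.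
  rewrite exprS invfM mulrA ler_pM2r ?invr_gt0// natrD natrM.
  by rewrite -[leLHS](@mulfK _ 2)// ler_pM2r// lerDl.
exists 1 => _ [k _ <-]; rewrite /digit_seq ler_pdivrMr// mul1r -natrX ler_nat.
exact: ltnW.
Qed.

Lemma measurable_digit_seq k : measurable_fun [set: RM] (digit_seq k).
Proof. exact: (measurable_digits k.*2 (fun i => (dig k i)%:R / 2 ^+ k)). Qed.

Lemma measurable_digit_lim : measurable_fun [set: RM] digit_lim.
Proof.
by apply: (measurable_fun_cvg measurable_digit_seq) => u _; exact: digit_seq_cvg.
Qed.

Lemma digit_lim_norm u : digit_lim `|u| = digit_lim u.
Proof. by rewrite /digit_lim /digit_seq /digits; under eq_fun do rewrite normr_id. Qed.

End digit_limit.

Definition even_part := digit_lim even_digits.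
Definition odd_part := digit_lim odd_digits.

Let even_cvg u : digit_seq even_digits k u @[k --> \oo] --> even_part u.
Proof. by apply: (@digit_seq_cvg _ (fun j => j %/ 2)%N) => //; exact: even_digits_lt. Qed.

Let odd_cvg u : digit_seq odd_digits k u @[k --> \oo] --> odd_part u.
Proof. by apply: (@digit_seq_cvg _ (fun j => j %% 2)%N) => //; exact: odd_digits_lt. Qed.

Lemma measurable_even_part : measurable_fun [set: RM] even_part.
Proof. by apply: (@measurable_digit_lim _ (fun j => j %/ 2)%N) => //; exact: even_digits_lt. Qed.

Lemma measurable_odd_part : measurable_fun [set: RM] odd_part.
Proof. by apply: (@measurable_digit_lim _ (fun j => j %% 2)%N) => //; exact: odd_digits_lt. Qed.

Let p0 k : 0 < 2 ^+ k :> R. Proof. by rewrite exprn_gt0. Qed.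

Let digits_cvg (u : R) : (digits k u)%:R / 2 ^+ k @[k --> \oo] --> `|u|.
Proof.
apply/cvgrPdist_le => e e0; near=> k.
have : (digits k u)%:R <= 2 ^+ k * `|u| < (digits k u).+1%:R.
  by rewrite truncn_itv// mulr_ge0// ltW.
move=> /andP[h1 h2]; rewrite ger0_norm; last by rewrite subr_ge0 ler_pdivrMr// mulrC.
rewrite (@le_trans _ _ (2 ^- k))//.
  rewrite lerBlDr -(ler_pM2l (p0 k)) mulrDr mulrCA !mulfV ?gt_eqF// mulr1 addrC natr1.
  exact: ltW.
rewrite -[leRHS]invrK lef_pV2 ?posrE ?invr_gt0//.
rewrite (@le_trans _ _ k%:R)//; first by near: k; exact: nbhs_infty_ger.
by rewrite -natrX ler_nat ltnW// ltn_expl.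
Unshelve. all: by end_near. Qed.

(** On the first [2 k] digits, splitting is a bijection onto pairs of [k]-digit numbers and the mean
    factors exactly; continuity passes this to the limit. The right side has [|u|] because digits
    depend on [u] only through [|u|]. *)
Let even_odd_continuous (F K : R -> R) (M M' : R) : continuous F -> continuous K ->
  (forall x, `|F x| <= M) -> (forall x, `|K x| <= M') ->
  \int[U]_u (F (even_part u) * K (odd_part u)) =
  \int[U]_u F `|u| * \int[U]_u K `|u|.
Proof.
move=> cF cK FM KM.
have mF := continuous_measurable_fun cF; have mK := continuous_measurable_fun cK.
have h1 : \int[U]_u (F (digit_seq even_digits k u) * K (digit_seq odd_digits k u))
    @[k --> \oo] --> \int[U]_u (F (even_part u) * K (odd_part u)).
  apply: (@expect_cvg_bounded _ _ _ U _ _ (M * M')) => [k|u|k u].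
  - apply: measurable_funM; apply: measurableT_comp => //; exact: measurable_digit_seq.
  - apply: cvgM.
      by apply: continuous_cvg; [exact: cF|exact: even_cvg].
    by apply: continuous_cvg; [exact: cK|exact: odd_cvg].
  - by rewrite normrM ler_pM.
have h2 (G : R -> R) (N : R) : continuous G -> (forall x, `|G x| <= N) ->
    \int[U]_u G ((digits k u)%:R / 2 ^+ k) @[k --> \oo] --> \int[U]_u G `|u|.
  move=> cG GN; apply: (@expect_cvg_bounded _ _ _ U _ _ N) => // [k|u].
  - exact: (measurable_digits k (fun i => G (i%:R / 2 ^+ k))).
  - by apply: continuous_cvg; [exact: cG|exact: digits_cvg].
have h3 : \int[U]_u F ((digits k u)%:R / 2 ^+ k) * \int[U]_u K ((digits k u)%:R / 2 ^+ k)
    @[k --> \oo] --> \int[U]_u F `|u| * \int[U]_u K `|u|.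
  by apply: cvgM; [exact: h2 FM|exact: h2 KM].
suff e : (fun k => \int[U]_u (F (digit_seq even_digits k u) * K (digit_seq odd_digits k u))) =
    (fun k => \int[U]_u F ((digits k u)%:R / 2 ^+ k) * \int[U]_u K ((digits k u)%:R / 2 ^+ k)).
  by rewrite e in h1; exact: (cvg_unique _ h1 h3).
apply/funext => k.
rewrite (@digits_expect _ k (fun i => F (i%:R / 2 ^+ k)) M)//.
rewrite (@digits_expect _ k (fun i => K (i%:R / 2 ^+ k)) M')//.
rewrite (@digits_expect _ k.*2 (fun i => F ((even_digits k i)%:R / 2 ^+ k) *
  K ((odd_digits k i)%:R / 2 ^+ k)) (M * M')); last first.
  by move=> i; rewrite normrM ler_pM.
rewrite -muln2 mulnC expnM.
rewrite (sum_digits k (fun a b => F (a%:R / 2 ^+ k) * K (b%:R / 2 ^+ k))).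
rewrite (eq_bigr (fun a : 'I_(2 ^ k) => F (a%:R / 2 ^+ k) * \sum_(b < 2 ^ k) K (b%:R / 2 ^+ k))); last first.
  by move=> a _; rewrite mulr_sumr.
rewrite -mulr_suml mulrACA; congr (_ * _).
by rewrite exprM -invfM -expr2 -[in RHS]exprM mulnC exprM.
Qed.

(** [continuous_extension] is used twice, in the even part and then in the odd part, the function of
    the other part being the weight. *)
Lemma even_odd_expect (F K : R -> R) : bmeas F -> bmeas K ->
  \int[U]_u (F (even_part u) * K (odd_part u)) =
  \int[U]_u F `|u| * \int[U]_u K `|u|.
Proof.
move=> bF bK.
have mn : measurable_fun [set: RM] (fun u : R => `|u|) by exact: normr_measurable.
have bcomp (G : R -> R) (X : RM -> R) : measurable_fun [set: RM] X -> bmeas G ->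
    bmeas (fun u => G (X u)) by move=> mX bG; exact: (bmeas_comp mX bG).
have step1 (K' : R -> R) (M' : R) : continuous K' -> (forall x, `|K' x| <= M') ->
    \int[U]_u (K' (odd_part u) * F (even_part u)) = \int[U]_u (\int[U]_u K' `|u| * F `|u|).
  move=> cK KM.
  have bK' : bmeas K' by split; [exact: continuous_measurable_fun|exists M'].
  apply: (@continuous_extension _ _ _ _ _ U even_part (fun u => K' (odd_part u)) U Num.norm
     (fun=> \int[U]_u K' `|u|)) => //.
  - exact: measurable_even_part.
  - by apply: bcomp => //; exact: measurable_odd_part.
  - exact: bmeas_cst.
  move=> g M cg gM.
  have bg : bmeas g by split; [exact: continuous_measurable_fun|exists M].
  rewrite (expectZ _ (bmeas_integrable U (bcomp _ _ mn bg))) mulrC.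
  rewrite -(even_odd_continuous cg cK gM KM).
  by apply: eq_Rintegral => u _; rewrite mulrC.
have -> : \int[U]_u F `|u| * \int[U]_u K `|u| = \int[U]_u (\int[U]_u F `|u| * K `|u|).
  by rewrite (expectZ _ (bmeas_integrable U (bcomp _ _ mn bK))).
apply: (@continuous_extension _ _ _ _ _ U odd_part (fun u => F (even_part u)) U Num.norm
  (fun=> \int[U]_u F `|u|)) => //.
- exact: measurable_odd_part.
- by apply: bcomp => //; exact: measurable_even_part.
- exact: bmeas_cst.
move=> g M cg gM.
have bg : bmeas g by split; [exact: continuous_measurable_fun|exists M].
rewrite (expectZ _ (bmeas_integrable U (bcomp _ _ mn bg))) mulrC.
rewrite -(expectZ _ (bmeas_integrable U (bcomp _ _ mn bF))) -(step1 _ _ cg gM).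
by apply: eq_Rintegral => u _; rewrite mulrC.
Qed.

End splitting.

(** * The quantile transform *)

Section quantile.
Context {R : realType} (nu : probability (measurableTypeR R) R).
Local Notation RM := (measurableTypeR R).
Local Notation U := (@unif R).

Let idR : RM -> R := idfun.
#[local] HB.instance Definition _ :=
  @isMeasurableFun.Build _ _ _ _ idR (@measurable_id _ _ setT).

Let Phi (x : R) : R := fine (nu `]-oo, x]%classic).

Let PhiE x : cdf (idR : {RV nu >-> R}) x = (Phi x)%:E.
Proof. by rewrite /Phi fineK ?fin_num_measure. Qed.

Let Phi_le x y : x <= y -> Phi x <= Phi y.
Proof. by move=> xy; rewrite -lee_fin -!PhiE; exact: cdf_nondecreasing. Qed.

Let Phi_ge0 x : 0 <= Phi x. Proof. by rewrite /Phi fine_ge0. Qed.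

Let Phi_le1 x : Phi x <= 1.
Proof. by rewrite -lee_fin -PhiE; exact: cdf_le1. Qed.

Let Phi_cvg F (FF : ProperFilter F) (l : R) :
  cdf (idR : {RV nu >-> R}) x @[x --> F] --> l%:E -> Phi x @[x --> F] --> l.
Proof. by under eq_fun do rewrite PhiE; move=> /fine_cvg. Qed.

Let Phi_right b u : Phi b < u -> exists2 x, b < x & Phi x < u.
Proof.
move=> bu; have hP : Phi x @[x --> b^'+] --> Phi b.
  by apply: Phi_cvg; have := @cdf_right_continuous _ _ _ _ (idR : {RV nu >-> R}) b; rewrite PhiE.
have : \forall x \near b^'+, b < x /\ Phi x < u.
  near=> x; split; first by near: x; exact: nbhs_right_gt.
  by near: x; exact: (cvgr_lt _ hP).
by move=> /filter_ex[x [bx xu]]; exists x.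
Unshelve. all: by end_near. Qed.

Definition quantile (u : R) : R :=
  if 0 < u < 1 then sup [set x | Phi x < u] else 0.

(** The Galois connection between quantile and distribution function. The limits of [Phi] at both
    infinities make the supremum a genuine one; from right to left, right continuity supplies a
    point beyond [b]. *)
Let quantile_gt b u : 0 < u < 1 -> (b < quantile u) = (Phi b < u).
Proof.
move=> u01; rewrite /quantile u01; case/andP: u01 => u0 u1.
have ne : [set x | Phi x < u] !=set0.
  have : \forall x \near -oo%R, Phi x < u.
    by apply: cvgr_lt u0; apply: Phi_cvg; exact: (@cvg_cdfNy0 _ _ _ _ (idR : {RV nu >-> R})).
  by move=> /filter_ex[x]; exists x.
have ub : has_ubound [set x | Phi x < u].
  have : \forall x \near +oo%R, u < Phi x.
    by apply: cvgr_gt u1; apply: Phi_cvg; exact: (@cvg_cdfy1 _ _ _ _ (idR : {RV nu >-> R})).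
  move=> /filter_ex[x] ux; exists x => y /= yu.
  by rewrite leNgt; apply/negP => xy; have := Phi_le (ltW xy); lra.
apply/idP/idP => h.
  have [x /= xu bx] := @sup_gt _ [set x | Phi x < u] b ne h.
  exact: le_lt_trans (Phi_le (ltW bx)) xu.
have [x bx xu] := Phi_right h.
by apply: (lt_le_trans bx); apply: ub_le_sup.
Qed.

Lemma measurable_quantile : measurable_fun [set: RM] quantile.
Proof.
apply: (@measurability _ _ _ _ _ _ (@RGenOInfty.G R) (RGenOInfty.measurableE R)).
move=> _ [_ [b ->] <-]; rewrite setTI.
have -> : quantile @^-1` `]b, +oo[ =
    (`]0, 1[ `&` `]Phi b, +oo[) `|` (~` `]0, 1[ `&` [set _ | b < 0]).
  apply/seteqP; split => u /=; rewrite !in_itv/= !andbT.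
    case: (boolP (0 < u < 1)) => u01 h; [left|right]; split => //.
    - by rewrite -quantile_gt.
    - by move: h; rewrite /quantile (negbTE u01).
  case=> -[u01 h]; first by rewrite quantile_gt.
  by rewrite /quantile (negbTE (introN idP u01)).
apply: measurableU; first exact: measurableI.
apply: measurableI; first exact: measurableC.
by case: (boolP (b < 0)) => h; [rewrite (_ : mkset _ = setT)//|rewrite (_ : mkset _ = set0)//];
  apply/seteqP; split.
Qed.

Let unif_oo (x y : R) : 0 <= x -> x <= y -> y <= 1 -> unif `]x, y[%classic = (y - x)%:E.
Proof.
move=> x0 xy y1.
transitivity (\int[lebesgue_measure]_(z in `]x, y[) (uniform_pdf 0%R 1%R z)%:E)%E => //.
rewrite (eq_integral (fun=> 1%E)); last first.
  move=> z; rewrite inE/= in_itv/= => /andP[h1 h2]; rewrite /uniform_pdf.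
  by rewrite (ltW (le_lt_trans x0 h1)) (ltW (lt_le_trans h2 y1)) subr0 invr1.
rewrite integral_cst//= mul1e lebesgue_measure_itv/= lte_fin.
have [//|yx] := ltP x y.
by have -> : x = y; [lra|rewrite subrr].
Qed.

(** The event contains []Phi b, 1[] and its complement contains []0, Phi b[]. These masses already
    add up to 1, so the endpoints and the points off the support do not have to be examined. *)
Let quantile_ray b : unif ((fun u => quantile `|u|) @^-1` `]b, +oo[) = (1 - Phi b)%:E.
Proof.
set A := _ @^-1` _.
have mA : measurable (A : set RM).
  have : measurable_fun [set: RM] (fun u => quantile `|u|).
    by apply: measurableT_comp; [exact: measurable_quantile|exact: normr_measurable].
  by move=> /(_ measurableT `]b, +oo[%classic); rewrite setTI; apply; exact: measurable_itv.
apply/eqP; rewrite eq_le; apply/andP; split; last first.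
  rewrite -unif_oo//; apply: le_measure; rewrite ?inE//.
  move=> u /=; rewrite /A /= !in_itv/= andbT => /andP[bu u1].
  have u0 : 0 < u by exact: le_lt_trans (Phi_ge0 b) bu.
  by rewrite quantile_gt ger0_norm ?u0//= ltW.
have : (unif `]0%R, Phi b[%classic <= unif (~` A))%E.
  apply: le_measure; rewrite ?inE//; first exact: measurableC.
  move=> u /=; rewrite /A /= !in_itv/= andbT => /andP[u0 ub].
  rewrite quantile_gt ger0_norm ?u0//= ?(ltW u0)//; last first.
    exact: lt_le_trans ub (Phi_le1 b).
  by apply/negP; rewrite -leNgt ltW.
rewrite unif_oo// probability_setC//.
have -> : unif A = (fine (unif A))%:E by rewrite fineK// fin_num_measure.
by rewrite -EFinD !lee_fin subr0; lra.
Qed.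

Lemma expect_quantile (h : R -> R) : bmeas h ->
  \int[U]_u h (quantile `|u|) = \int[nu]_x h x.
Proof.
move=> bh.
have -> : \int[U]_u h (quantile `|u|) = \int[U]_u (1 * h (quantile `|u|)).
  by under [RHS]eq_Rintegral do rewrite mul1r.
have -> : \int[nu]_x h x = \int[nu]_x (1 * h x).
  by under [RHS]eq_Rintegral do rewrite mul1r.
have mq : measurable_fun [set: RM] (fun u => quantile `|u|).
  by apply: measurableT_comp; [exact: measurable_quantile|exact: normr_measurable].
have mid : measurable_fun [set: RM] (fun x : R => x) by [].
apply: (@ray_extension R _ _ _ _ U (fun u => quantile `|u|) (fun=> 1) nu (fun x => x)
  (fun=> 1) mq mid (bmeas_cst 1) (bmeas_cst 1)) => //.
  by rewrite !expect_cst.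
move=> b.
have E1 (m : probability RM R) (X : RM -> R) : measurable_fun [set: RM] X ->
    \int[m]_x (1 * \1_(`]b, +oo[) (X x)) = fine (m (X @^-1` `]b, +oo[)).
  move=> mX; under eq_Rintegral do rewrite mul1r.
  have := mX measurableT `]b, +oo[%classic (measurable_itv _); rewrite setTI => mXb.
  by rewrite -[LHS]/(\int[m]_x \1_(X @^-1` `]b, +oo[) x) /Rintegral integral_indic// setIT.
rewrite !E1// quantile_ray/=.
have -> : (fun x : R => x) @^-1` `]b, +oo[ = ~` `]-oo, b].
  by apply/seteqP; split => x /=; rewrite !in_itv/= andbT ltNge => /negP.
rewrite probability_setC; last exact: measurable_itv.
by rewrite fineB// fin_num_measure.
Qed.

End quantile.

Section iid_sequence.
Context {R : realType} (nu : probability (measurableTypeR R) R).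
Local Notation RM := (measurableTypeR R).
Local Notation U := (@unif R).

Definition iid_seq j (u : R) : R := quantile nu (even_part (iter j odd_part u)).

Lemma measurable_iid_seq j : measurable_fun [set: RM] (iid_seq j).
Proof.
apply: measurableT_comp; first exact: measurable_quantile.
elim: j => [|j ih]; first exact: measurable_even_part.
have -> : (fun u : R => even_part (iter j.+1 odd_part u)) =
    (fun u => even_part (iter j odd_part u)) \o odd_part.
  by apply/funext => u /=; rewrite -iterSr.
by apply: measurableT_comp => //; exact: measurable_odd_part.
Qed.

(** The even part of [u] produces the variable of index 0 and the odd part all later ones, so
    [even_odd_expect] peels off one factor. *)
Lemma expect_iid_seq m (g : nat -> R -> R) : (forall j, bmeas (g j)) ->
  \int[U]_u (\prod_(j < m) g j (iid_seq j u)) = \prod_(j < m) \int[nu]_x g j x.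
Proof.
elim: m g => [|m ih] g bg.
  by under eq_Rintegral do rewrite big_ord0; rewrite big_ord0 expect_cst.
have bq : bmeas (fun v : RM => g 0%N (quantile nu v)).
  by apply: bmeas_comp (bg _); exact: measurable_quantile.
have bK : bmeas (fun v : RM => \prod_(j < m) g j.+1 (iid_seq j v)).
  apply: bmeas_prod => j; apply: (bmeas_comp _ (bg _)); exact: measurable_iid_seq.
rewrite big_ord_recl -(expect_quantile _ (bg 0%N)).
rewrite -(ih (fun j => g j.+1))//.
(* [even_odd_expect] evaluates at [|u|], the induction hypothesis at [u]; both digit parts see only
   [|u|]. *)
have -> : \int[U]_u \prod_(j < m) g j.+1 (iid_seq j u) =
    \int[U]_u \prod_(j < m) g j.+1 (iid_seq j `|u|).
  apply: eq_Rintegral => u _; apply: eq_bigr => -[j _] _ /=; congr (g _ _).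
  rewrite /iid_seq; case: j => [|j]; first by rewrite /= /even_part digit_lim_norm.
  by rewrite !iterSr [in RHS]/odd_part digit_lim_norm.
rewrite -(even_odd_expect bq bK); apply: eq_Rintegral => u _.
rewrite big_ord_recl; congr (_ * _); apply: eq_bigr => j _.
by rewrite /iid_seq iterSr.
Qed.

End iid_sequence.

Section normal_sequence.
Context {R : realType}.
Local Notation RM := (measurableTypeR R).
Local Notation U := (@unif R).

Definition normal_seq : nat -> R -> R := iid_seq (normal_prob (0 : R) 1).

(** Every sine mean vanishes, being a normal characteristic function at phase [- (pi / 2)]. So the
    complex product [char_prod] stays real, and the exponents add up. *)
Lemma normal_seq_char m (t : nat -> R) th :
  \int[U]_u cos (\sum_(j < m) t j * normal_seq j u + th) =
  cos th * expR (- ((\sum_(j < m) t j ^+ 2) / 2)).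
Proof.
have mX (j : 'I_m) : measurable_fun [set: RM] (normal_seq j) by exact: measurable_iid_seq.
have mlin (a : R) : measurable_fun [set: RM] (fun x : R => a * x) by exact: measurable_funM.
have prodE (g : 'I_m -> RM -> R) : (forall i, bmeas (g i)) ->
    \int[U]_u \prod_i g i (normal_seq i u) = \prod_i \int[normal_prob 0 1]_x g i x.
  move=> bg; pose g' (j : nat) := if insub j is Some i then g i else fun=> 0.
  have g'E (i : 'I_m) : g' i = g i by rewrite /g' valK.
  have := @expect_iid_seq R (normal_prob 0 1) m g' _.
  under eq_Rintegral do under eq_bigr do rewrite g'E.
  under [in RHS]eq_bigr do rewrite g'E.
  by apply => j; rewrite /g'; case: (insub j) => // ; exact: bmeas_cst.
have oneE (g : RM -> R) (i : 'I_m) : bmeas g ->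
    \int[U]_u g (normal_seq i u) = \int[normal_prob 0 1]_x g x.
  move=> bg; pose h k := if k == i then g else fun=> 1.
  have hE (F : 'I_m -> R) : (forall k, k != i -> F k = 1) -> \prod_k F k = F i.
    by move=> F1; rewrite (bigD1 i erefl)/= big1 ?mulr1.
  have bh k : bmeas (h k) by rewrite /h; case: (k == i) => //; exact: bmeas_cst.
  transitivity (\int[U]_u \prod_k h k (normal_seq k u)).
    apply: eq_Rintegral => u _; rewrite hE /h ?eqxx// => k /negbTE ->.
    by [].
  rewrite prodE// hE /h ?eqxx// => k /negbTE ->; exact: expect_cst.
have prodX (g : 'I_m -> RM -> R) : (forall i, bmeas (g i)) ->
    \int[U]_u \prod_i g i (normal_seq i u) = \prod_i \int[U]_u g i (normal_seq i u).
  by move=> bg; rewrite (prodE _ bg); apply: eq_bigr => i _; rewrite (oneE _ _ (bg i)).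
have cE (i : 'I_m) : \int[U]_u cos (t i * normal_seq i u) = expR (- (t i ^+ 2 / 2)).
  rewrite (oneE (fun x => cos (t i * x))); last exact: bmeas_cos (mlin _).
  transitivity (\int[normal_prob 0 1]_x cos (t i * x + 0)).
    by apply: eq_Rintegral => x _; rewrite addr0.
  by rewrite normal_char// cos0 mul1r expr1n mul1r.
have sE (i : 'I_m) : \int[U]_u sin (t i * normal_seq i u) = 0.
  rewrite (oneE (fun x => sin (t i * x))); last exact: bmeas_sin (mlin _).
  transitivity (\int[normal_prob 0 1]_x cos (t i * x + - (pi / 2))).
    by apply: eq_Rintegral => x _; rewrite cosB cos_pihalf sin_pihalf mulr0 mulr1 add0r.
  by rewrite normal_char// cosN cos_pihalf mul0r.
have cpE (l : seq 'I_m) : char_prod (fun i : 'I_m => \int[U]_u cos (t i * normal_seq i u))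
    (fun i : 'I_m => \int[U]_u sin (t i * normal_seq i u)) l =
    (expR (- ((\sum_(i <- l) t i ^+ 2) / 2)), 0).
  elim: l => [|i l ihl]; first by rewrite big_nil mul0r oppr0 expR0.
  rewrite /= ihl /= big_cons cE sE mulr0 subr0 mul0r add0r mulr0 -expRD; congr (expR _, _); lra.
have mS : measurable_fun [set: RM] (fun u => \sum_(j < m) t j * normal_seq j u).
  apply: measurable_sum => j; apply: measurableT_comp => //; exact: mX.
under eq_Rintegral do rewrite cosD [X in X - _]mulrC [X in _ - X]mulrC -mulNr.
have ic := bmeas_integrable U (bmeas_cos mS).
have iS := bmeas_integrable U (bmeas_sin mS).
rewrite (expectD (pintZ _ ic) (pintZ _ iS)) (expectZ _ ic) (expectZ _ iS).
rewrite (@expect_cos_sum R _ _ _ _ U _ _ mX (fun i x => t i * x) (fun i => mlin _) prodX)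
  ?index_enum_uniq//.
rewrite (@expect_sin_sum R _ _ _ _ U _ _ mX (fun i x => t i * x) (fun i => mlin _) prodX)
  ?index_enum_uniq//.
by rewrite cpE /= mulr0 addr0.
Qed.

End normal_sequence.

(** * Gaussian measures on l2 *)

Section cholesky.
Context {R : realType}.
Implicit Types (G : nat -> nat -> R) (r : seq (R * nat)).

(** A vector is a list of pairs (coefficient, index), repetitions allowed: no dimension is fixed,
    and a cons adds one entry. *)
Definition quad_form G r : R := \sum_(p <- r) \sum_(q <- r) p.1 * q.1 * G p.2 q.2.

Definition psd G := (forall a b, G a b = G b a) /\ forall r, 0 <= quad_form G r.

(* If [G c c = 0] the quotient is 0 and [schur c G = G], as it should be: then the row [c] of a
   positive semidefinite [G] is already null. *)
Definition schur (c : nat) G a b : R := G a b - G a c * G b c / G c c.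

Let quad_form_cons G x r : (forall a b, G a b = G b a) -> quad_form G (x :: r) =
  quad_form G r + x.1 * (\sum_(p <- r) p.1 * G p.2 x.2) *+ 2 + x.1 ^+ 2 * G x.2 x.2.
Proof.
move=> sG; rewrite /quad_form big_cons big_cons.
under [X in _ + X = _]eq_bigr do rewrite big_cons.
rewrite big_split/= [X in _ + (X + _) = _](eq_bigr (fun p => x.1 * (p.1 * G p.2 x.2))); last first.
  by move=> p _; ring.
rewrite [X in _ + X + _ = _](eq_bigr (fun p => x.1 * (p.1 * G p.2 x.2))); last first.
  by move=> p _; rewrite (sG p.2); ring.
by rewrite -mulr_sumr; ring.
Qed.

Lemma psd_diag_ge0 G c : psd G -> 0 <= G c c.
Proof.
move=> [sG pG]; have := pG [:: (1, c)].
by rewrite /quad_form !big_seq1 /= !mul1r.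
Qed.

Lemma psd_diag0 G c b : psd G -> G c c = 0 -> G c b = 0.
Proof.
move=> [sG pG] c0; apply/eqP; case: (eqVneq (G c b) 0) => // cb.
(* With this coefficient the form takes the value -1. *)
have := pG [:: (- (G b b + 1) / (2 * G c b), c); (1, b)].
rewrite quad_form_cons// {1}/quad_form !big_seq1 /= c0 mulr0 addr0 !mul1r (sG b c).
have -> : - (G b b + 1) / (2 * G c b) * G c b = - (G b b + 1) / 2 by field.
lra.
Qed.

(** Completing the square: the form of the complement at [r] is the form of [G] at [r] with index
    [c] added with the minimizing coefficient [- B / G c c]. *)
Lemma schur_psd c G : psd G -> psd (schur c G).
Proof.
move=> GG; have [sG pG] := GG; split.
  by move=> a b; rewrite /schur sG [G b c * _]mulrC.
move=> r; have [c0|c0] := eqVneq (G c c) 0.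
  have -> : schur c G = G; last exact: pG.
  by apply/funext => a; apply/funext => b; rewrite /schur c0 invr0 mulr0 subr0.
pose B := \sum_(p <- r) p.1 * G p.2 c.
have -> : quad_form (schur c G) r = quad_form G r - B ^+ 2 / G c c.
  rewrite /quad_form expr2 {1}/B mulr_suml mulr_suml -sumrB; apply: eq_bigr => p _.
  rewrite /B mulr_sumr mulr_suml -sumrB; apply: eq_bigr => q _.
  by rewrite /schur; ring.
have := pG ((- B / G c c, c) :: r); rewrite quad_form_cons//= -/B.
by congr (0 <= _); field.
Qed.

Lemma schur_row c G b : psd G -> schur c G c b = 0.
Proof.
move=> GG; rewrite /schur; have [c0|c0] := eqVneq (G c c) 0.
  by rewrite c0 mul0r mul0r subr0; exact: psd_diag0.
by rewrite (proj1 GG b c); field.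
Qed.

Fixpoint schur_iter G j := if j is j'.+1 then schur j' (schur_iter G j') else G.

(** Division by 0 gives 0, so a vanishing pivot produces a null column. *)
Definition cholesky G a j : R := schur_iter G j a j / Num.sqrt (schur_iter G j j j).

Let schur_iter_psd G j : psd G -> psd (schur_iter G j).
Proof. by move=> pG; elim: j => //= j; exact: schur_psd. Qed.

Let schur_iter0 G j a b : psd G -> (a < j)%N -> schur_iter G j a b = 0.
Proof.
move=> pG; elim: j b => // j ih b; rewrite ltnS leq_eqVlt => /predU1P[->|aj] /=.
  by apply: schur_row; exact: schur_iter_psd.
by rewrite /schur !ih// !mul0r subr0.
Qed.

Lemma cholesky0 G a j : psd G -> (a < j)%N -> cholesky G a j = 0.
Proof. by move=> pG aj; rewrite /cholesky schur_iter0// mul0r. Qed.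

(** The product of two entries of column [j] is exactly what the [j]-th Schur step subtracts. The
    sum therefore telescopes to [G a b] minus a residual, which has lost row [a] after [m > a]
    steps. *)
Lemma cholesky_sum G m a b : psd G -> (a < m)%N ->
  \sum_(j < m) cholesky G a j * cholesky G b j = G a b.
Proof.
move=> pG am.
suff -> : \sum_(j < m) cholesky G a j * cholesky G b j = G a b - schur_iter G m a b.
  by rewrite schur_iter0// subr0.
elim: m {am} => [|m ih]; first by rewrite big_ord0 subrr.
rewrite big_ord_recr/= ih /schur /cholesky mulrACA -invfM -expr2 sqr_sqrtr; first by ring.
by apply: psd_diag_ge0; exact: schur_iter_psd.
Qed.

End cholesky.

Section law.
Context {R : realType} {d d'} {T : measurableType d} {T' : measurableType d'}.
Variables (P : probability T R) (X : T -> T').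
Hypothesis mX : measurable_fun [set: T] X.

Definition law : probability T' R := distribution P (mfun_Sub (mem_set mX)).

Lemma law_expect (f : T' -> R) : measurable_fun [set: T'] f ->
  P.-integrable [set: T] (EFin \o (fun t => f (X t))) ->
  \int[law]_y f y = \int[P]_t f (X t).
Proof.
move=> mf fi; rewrite /Rintegral integral_distribution//.
exact/measurable_EFinP.
Qed.

End law.

(** [char_unique] against the actual normal law; the second moments it asks for are themselves
    extracted from the characteristic functions. *)
Lemma centered_normal_of_char {R : realType} {d} {T : measurableType d}
    (P : probability T R) (Y : T -> R) (v : R) :
  measurable_fun [set: T] Y -> 0 <= v ->
  (forall t th, \int[P]_w cos (t * Y w + th) = cos th * expR (- (v * t ^+ 2 / 2))) ->
  forall A : set R, measurable A -> P (Y @^-1` A) = centered_normal (Num.sqrt v) A.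
Proof.
move=> mY v0 YE.
have mlin (t th : R) : measurable_fun [set: measurableTypeR R] (fun x : R => t * x + th).
  by apply: measurable_funD => //; apply: measurable_funM.
pose nu : probability (measurableTypeR R) R := @law R _ _ T (measurableTypeR R) P Y mY.
have nuE t th : \int[nu]_x cos (t * x + th) = cos th * expR (- (v * t ^+ 2 / 2)).
  have bc := bmeas_cos (mlin t th).
  rewrite -YE; apply: law_expect; first by case: bc.
  exact: (bmeas_integrable P (bmeas_comp mY bc)).
have [nu' nu'E] : exists nu' : probability (measurableTypeR R) R,
    forall A : set R, measurable A -> nu' A = centered_normal (Num.sqrt v) A.
  rewrite /centered_normal; case: eqP => _; first by exists (dirac (0 : measurableTypeR R)).
  by exists (normal_prob 0 (Num.sqrt v)).
have nu'c t th : \int[nu']_x cos (t * x + th) = cos th * expR (- (v * t ^+ 2 / 2)).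
  by rewrite (centered_normal_char _ nu'E)// sqr_sqrtr.
have sq (m : probability (measurableTypeR R) R) :
    (forall t th, \int[m]_x cos (t * x + th) = cos th * expR (- (v * t ^+ 2 / 2))) ->
    m.-integrable [set: R] (EFin \o (fun x => x ^+ 2)).
  move=> mE; have [|t|//] := @char_second_moment _ _ _ m id v; first exact: measurable_id.
  transitivity (\int[m]_x cos (t * x + 0)); last by rewrite mE cos0 mul1r.
  by apply: eq_Rintegral => x _; rewrite addr0.
move=> A mA; rewrite -nu'E// -[LHS]/(nu A); apply: char_unique => //; [exact: sq|exact: sq|].
by move=> t th; rewrite nuE nu'c.
Qed.

Section l2_second_moments.
Context {R : realType} {d} {T : measurableType d}.
Variables (P : probability T R) (X : T -> l2 R).
Hypothesis mX : forall k : nat, measurable_fun [set: T] (fun t => X t k : R).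
Hypothesis iX : forall k : nat, P.-integrable [set: T] (EFin \o (fun t => (X t k : R) ^+ 2)).

Lemma l2_norm_tailE l (x : l2 R) :
  `|x - l2_trunc l x| ^+ 2 = `|x| ^+ 2 - \sum_(k < l) x k ^+ 2.
Proof.
apply/eqP; rewrite eq_sym subr_eq addrC; apply/eqP/EFin_inj.
rewrite EFinD l2_norm_tail l2_normE (nneseries_split 0 l); last first.
  by move=> *; rewrite lee_fin sqr_ge0.
by rewrite add0n big_mkord sumEFin.
Qed.

Lemma integral_l2_norm : (\int[P]_t (`|X t| ^+ 2)%:E =
  \sum_(k <oo) (\int[P]_t ((X t k : R) ^+ 2))%:E)%E.
Proof.
transitivity (\int[P]_t (\sum_(k <oo) ((X t k : R) ^+ 2)%:E))%E.
  by apply: eq_integral => t _; rewrite l2_normE.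
rewrite integral_nneseries//.
- apply: eq_eseriesr => k _.
  by rewrite /Rintegral fineK//; exact: (integrable_fin_num measurableT (iX k)).
- by move=> k; apply/measurable_EFinP; exact: measurable_funX.
- by move=> k t _; rewrite lee_fin sqr_ge0.
Qed.

Hypothesis X_fin : (\sum_(k <oo) (\int[P]_t ((X t k : R) ^+ 2))%:E < +oo)%E.

Lemma l2_norm_integrable : P.-integrable [set: T] (EFin \o (fun t => `|X t| ^+ 2)).
Proof.
apply/integrableP; split.
  by apply/measurable_EFinP; exact: l2_norm_sqr_measurable.
apply: le_lt_trans X_fin; rewrite -integral_l2_norm.
by under eq_integral do rewrite gee0_abs ?lee_fin ?sqr_ge0//.
Qed.

(** Total minus finite head: in this form a bound on the trace and the convergence of finitely many
    variances control the tail. *)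
Lemma expect_l2_tail l : \int[P]_t (`|X t - l2_trunc l (X t)| ^+ 2) =
  \int[P]_t (`|X t| ^+ 2) - \sum_(k < l) \int[P]_t ((X t k : R) ^+ 2).
Proof.
have iN := l2_norm_integrable.
have iS : P.-integrable [set: T] (EFin \o (fun t => \sum_(k < l) (X t k : R) ^+ 2)).
  by apply: pint_sum => k; exact: iX.
have -> : \int[P]_t (`|X t - l2_trunc l (X t)| ^+ 2) =
    \int[P]_t (`|X t| ^+ 2 + -1 * \sum_(k < l) (X t k : R) ^+ 2).
  by apply: eq_Rintegral => t _; rewrite l2_norm_tailE mulN1r.
by rewrite (expectD iN (pintZ (-1) iS)) (expectZ (-1) iS) mulN1r expect_sum.
Qed.

End l2_second_moments.

Lemma sum_delta {R : realType} m k (F : nat -> R) : (k < m)%N ->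
  \sum_(i < m) (nat_of_ord i == k)%:R * F i = F k.
Proof.
move=> km; rewrite (bigD1 (Ordinal km))//= eqxx mul1r big1 ?addr0// => i ik.
have /negbTE -> : (nat_of_ord i != k) by apply: contra ik => /eqP ik; apply/eqP/val_inj.
by rewrite mul0r.
Qed.

(** * Gaussian measures from their characteristic functions *)

Section gaussian_characterization.
Context {R : realType} (mu : probability (l2 R) R) (G : nat -> nat -> R).
Implicit Types (t : nat -> R) (x : l2 R).

Definition lin_comb l t x : R := \sum_(k < l) t k * x k.
Definition lin_var l t : R := \sum_(a < l) \sum_(b < l) t a * t b * G a b.

Lemma lin_comb_delta m k l (a b : R) x : (k < m)%N -> (l < m)%N ->
  lin_comb m (fun i => a * (i == k)%:R + b * (i == l)%:R) x = a * x k + b * x l.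
Proof.
move=> km lm; rewrite /lin_comb.
under eq_bigr do rewrite mulrDl -!mulrA.
by rewrite big_split/= -!mulr_sumr !(sum_delta (fun i => x i : R)).
Qed.

Lemma lin_var_delta m k l (a b : R) : (k < m)%N -> (l < m)%N ->
  lin_var m (fun i => a * (i == k)%:R + b * (i == l)%:R) =
  a ^+ 2 * G k k + a * b * G k l + a * b * G l k + b ^+ 2 * G l l.
Proof.
move=> km lm; rewrite /lin_var.
have inner i : \sum_(j < m) (a * (i == k)%:R + b * (i == l)%:R) *
     (a * (nat_of_ord j == k)%:R + b * (nat_of_ord j == l)%:R) * G i j =
   (a * (i == k)%:R + b * (i == l)%:R) * (a * G i k + b * G i l).
  under eq_bigr do rewrite -mulrA.
  rewrite -mulr_sumr; under eq_bigr do rewrite mulrDl -!mulrA.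
  by rewrite big_split/= -!mulr_sumr !(sum_delta (G i)).
under eq_bigr => i _ do rewrite inner mulrDl -!mulrA.
rewrite big_split/= -!mulr_sumr (sum_delta (fun i => a * G i k + b * G i l))//.
by rewrite (sum_delta (fun i => a * G i k + b * G i l))//; ring.
Qed.

Lemma measurable_lin_comb l t : measurable_fun [set: l2 R] (lin_comb l t).
Proof.
apply: measurable_sum => k; apply: measurable_funM => //.
exact: l2_coord_measurable.
Qed.

End gaussian_characterization.

Section gaussian_of_char.
Context {R : realType} (mu : probability (l2 R) R) (G : nat -> nat -> R).
Hypothesis G_sym : forall a b, G a b = G b a.
Hypothesis G_fin : (\sum_(k <oo) (G k k)%:E < +oo)%E.
Hypothesis mu_char : forall l t th,
  \int[mu]_x cos (lin_comb l t x + th) = cos th * expR (- (lin_var G l t / 2)).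

Let second_moment l t : mu.-integrable [set: l2 R] (EFin \o (fun x => lin_comb l t x ^+ 2)) /\
  \int[mu]_x (lin_comb l t x ^+ 2) = lin_var G l t.
Proof.
apply: char_second_moment; first exact: measurable_lin_comb.
move=> s; transitivity (\int[mu]_x cos (lin_comb l (fun k => s * t k) x + 0)).
  apply: eq_Rintegral => x _; rewrite addr0 /lin_comb mulr_sumr.
  by congr cos; apply: eq_bigr => k _; rewrite mulrA.
rewrite mu_char cos0 mul1r /lin_var; congr (expR (- (_ / 2))).
rewrite mulr_suml; apply: eq_bigr => a _; rewrite mulr_suml; apply: eq_bigr => b _.
by rewrite expr2; ring.
Qed.

Let pair_moment (k l : nat) (a b : R) :
  mu.-integrable [set: l2 R] (EFin \o (fun x : l2 R => (a * x k + b * x l) ^+ 2)) /\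
  \int[mu]_x ((a * x k + b * x l) ^+ 2) =
  a ^+ 2 * G k k + a * b * G k l + a * b * G l k + b ^+ 2 * G l l.
Proof.
have [km lm] : (k < (maxn k l).+1)%N /\ (l < (maxn k l).+1)%N.
  by rewrite !ltnS leq_maxl leq_maxr.
have := second_moment (maxn k l).+1 (fun i => a * (i == k)%:R + b * (i == l)%:R).
rewrite lin_var_delta//.
under eq_Rintegral do rewrite lin_comb_delta//.
by under eq_fun do rewrite lin_comb_delta//.
Qed.

Lemma char_coord_moment (k : nat) :
  mu.-integrable [set: l2 R] (EFin \o (fun x : l2 R => (x k : R) ^+ 2)) /\
  \int[mu]_x ((x k : R) ^+ 2) = G k k.
Proof.
have := pair_moment k k 1 0; rewrite !mulr0 expr0n !mul0r !addr0 expr1n mul1r.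
have -> // : (fun x : l2 R => (1 * x k + 0 * x k) ^+ 2) = (fun x => (x k : R) ^+ 2).
by apply/funext => x; rewrite mul0r addr0 mul1r.
Qed.

Let mcoord (k : nat) : measurable_fun [set: l2 R] (fun x : l2 R => x k : R).
Proof. exact: l2_coord_measurable. Qed.

Let norm_int : mu.-integrable [set: l2 R] (EFin \o (fun x => `|x| ^+ 2)).
Proof.
apply: (@l2_norm_integrable _ _ _ mu id mcoord) => [k|].
  by case: (char_coord_moment k).
rewrite (eq_eseriesr (fun k _ => _ : _ = (G k k)%:E))// => k _.
by rewrite (char_coord_moment k).2.
Qed.

Lemma char_mixed_moment k l : mixed_moment mu idfun k l = (G k l)%:E.
Proof.
have [ik Ek] := char_coord_moment k; have [il El] := char_coord_moment l.
have [iS Es] := pair_moment k l 1 1.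
have iN (m : nat) := pintZ (- 2^-1) (char_coord_moment m).1.
(* Polarization, into squares whose integrability and means are known. *)
have E : (fun x : l2 R => (x k : R) * x l) = (fun x : l2 R => 2^-1 * (1 * x k + 1 * x l) ^+ 2 +
    (- 2^-1 * x k ^+ 2 + - 2^-1 * x l ^+ 2)).
  by apply/funext => x; field.
rewrite /mixed_moment expectE; last by rewrite E; exact: (pintD (pintZ _ iS) (pintD (iN k) (iN l))).
congr EFin; rewrite E (expectD (pintZ _ iS) (pintD (iN k) (iN l))).
rewrite (expectD (iN k) (iN l)) (expectZ _ iS) (expectZ _ ik) (expectZ _ il) Es Ek El.
by rewrite (G_sym l k) expr1n; field.
Qed.

(** A continuous functional is the limit of the finite combinations with coefficients
    [phi (l2_unit k)]. Its operator bound [C] dominates their squares, so their variances converge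
    to the second moment of [phi]. *)
Let char_functional (phi : {linear l2 R -> R^o}) : continuous phi ->
  forall t th, \int[mu]_x cos (t * phi x + th) =
    cos th * expR (- (\int[mu]_x (phi x ^+ 2) * t ^+ 2 / 2)).
Proof.
move=> cphi t th.
have mphi : measurable_fun [set: l2 R] phi by exact: l2_continuous_measurable_fun.
have [C C0 phiC] : exists2 C : R, 0 <= C & forall x, `|phi x| <= C * `|x|.
  have /linear_boundedP h : bounded_near phi (nbhs (0 : l2 R)).
    by apply: continuous_linear_bounded; exact: cphi.
  have : \forall C \near +oo, 0 <= C /\ forall x, `|phi x : R^o| <= C * `|x|.
    near=> C; split; last by near: C.
    by near: C; exact: nbhs_pinfty_ge.
  by move=> /filter_ex[C [C0 hC]]; exists C.
pose f (k : nat) : R := phi (l2_unit k).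
have phi_trunc l x : phi (l2_trunc l x) = lin_comb l f x.
  rewrite /l2_trunc linear_sum; apply: eq_bigr => k _.
  by rewrite linearZ /= mulrC.
have trunc_le l (x : l2 R) : `|l2_trunc l x| <= `|x|.
  rewrite -(@ler_pXn2r _ 2)// ?nnegrE// -lee_fin !l2_normE; apply: lee_nneseries => k _.
    by rewrite lee_fin sqr_ge0.
  by rewrite lee_fin l2_truncE; case: ifP => // _; rewrite expr0n sqr_ge0.
have lin_cvg x : lin_comb l f x @[l --> \oo] --> (phi x : R).
  under eq_fun do rewrite -phi_trunc.
  by apply: continuous_cvg; [exact: cphi|exact: l2_trunc_cvg].
have var_cvg : lin_var G l f @[l --> \oo] --> \int[mu]_x (phi x ^+ 2).
  have -> : lin_var G ^~ f = (fun l => \int[mu]_x (lin_comb l f x ^+ 2)).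
    by apply/funext => l; rewrite (second_moment l f).2.
  apply: (@expect_cvg _ _ _ mu _ _ (fun x => C ^+ 2 * `|x| ^+ 2)).
  - by move=> l; apply: measurable_funX; exact: measurable_lin_comb.
  - exact: pintZ.
  - by move=> x; apply: cvgM; exact: lin_cvg.
  - move=> l x; rewrite ger0_norm ?sqr_ge0// -exprMn -phi_trunc -[leLHS]real_normK ?num_real//.
    rewrite ler_pXn2r// ?nnegrE ?mulr_ge0//.
    exact: (le_trans (phiC _) (ler_wpM2l C0 (trunc_le l x))).
have lin_scale l x : t * lin_comb l f x = lin_comb l (fun k => t * f k) x.
  by rewrite /lin_comb mulr_sumr; apply: eq_bigr => k _; rewrite mulrA.
have h1 : \int[mu]_x cos (t * lin_comb l f x + th) @[l --> \oo] -->
    \int[mu]_x cos (t * phi x + th).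
  apply: (@expect_cvg_bounded _ _ _ mu _ _ 1).
  - move=> l; have [|//] := @bmeas_cos _ _ _ (fun x => t * lin_comb l f x + th).
    by apply: measurable_funD => //; apply: measurable_funM => //; exact: measurable_lin_comb.
  - move=> x; apply: continuous_cvg; first exact: continuous_cos.
    by apply: cvgD; [apply: cvgMr; exact: lin_cvg|exact: cvg_cst].
  - by move=> l x; exact: cos_max.
have h2 : \int[mu]_x cos (t * lin_comb l f x + th) @[l --> \oo] -->
    cos th * expR (- (\int[mu]_x (phi x ^+ 2) * t ^+ 2 / 2)).
  have -> : (fun l => \int[mu]_x cos (t * lin_comb l f x + th)) =
      (fun l => cos th * expR (- (lin_var G l f * t ^+ 2 / 2))).
    apply/funext => l; under eq_Rintegral do rewrite lin_scale.
    rewrite mu_char /lin_var; congr (_ * expR (- (_ / 2))).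
    rewrite mulr_suml; apply: eq_bigr => a _; rewrite mulr_suml; apply: eq_bigr => b _.
    by rewrite expr2; ring.
  apply: cvgMr; apply: continuous_cvg; first exact: continuous_expR.
  by apply: cvgN; apply: cvgMl; apply: cvgMl.
exact: (cvg_unique _ h1 h2).
Unshelve. all: by end_near. Qed.

Lemma char_centered_gaussian : centered_gaussian mu G.
Proof.
split; last exact: char_mixed_moment.
move=> phi cphi; exists (Num.sqrt (\int[mu]_x (phi x ^+ 2))); first exact: sqrtr_ge0.
move=> A mA; apply: (@centered_normal_of_char _ _ _ mu phi) mA.
- exact: l2_continuous_measurable_fun.
- by apply: Rintegral_ge0 => x _; exact: sqr_ge0.
- exact: char_functional.
Qed.

End gaussian_of_char.

(** * Construction of a Gaussian measure *)

Section gaussian_existence.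
Context {R : realType} (G : nat -> nat -> R).
Hypothesis G_psd : psd G.
Hypothesis G_fin : (\sum_(k <oo) (G k k)%:E < +oo)%E.
Local Notation U := (@unif R).
Local Notation RM := (measurableTypeR R).

Let Y (k : nat) (u : RM) : R := \sum_(j < k.+1) cholesky G k j * normal_seq j u.

Let mY k : measurable_fun [set: RM] (Y k).
Proof.
apply: measurable_sum => j; apply: measurable_funM => //; exact: measurable_iid_seq.
Qed.

(** The Cholesky matrix is lower triangular, so the coordinates below [l] are all combinations of
    the same [l] variables. *)
Let Y_widen k l u : (k < l)%N -> Y k u = \sum_(j < l) cholesky G k j * normal_seq j u.
Proof.
move=> kl; rewrite /Y (big_ord_widen l (fun j => cholesky G k j * normal_seq j u))//.
rewrite big_mkcond; apply: eq_bigr => j _; case: ltnP => // kj.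
by rewrite cholesky0// mul0r.
Qed.

Let Y_char l (t : nat -> R) th : \int[U]_u cos (\sum_(k < l) t k * Y k u + th) =
  cos th * expR (- (lin_var G l t / 2)).
Proof.
transitivity (\int[U]_u cos (\sum_(j < l) (\sum_(k < l) t k * cholesky G k j) *
    normal_seq j u + th)).
  apply: eq_Rintegral => u _; congr (cos (_ + _)).
  under [RHS]eq_bigr do rewrite mulr_suml.
  rewrite exchange_big; apply: eq_bigr => k _; rewrite (Y_widen u (ltn_ord k)) mulr_sumr.
  by apply: eq_bigr => j _; rewrite mulrA.
rewrite (normal_seq_char _ (fun j => \sum_(k < l) t k * cholesky G k j)).
congr (_ * expR (- (_ / 2))).
under eq_bigr do rewrite expr2 mulr_suml.
rewrite exchange_big; apply: eq_bigr => a _.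
under eq_bigr do rewrite mulr_sumr.
rewrite exchange_big; apply: eq_bigr => b _.
rewrite -(cholesky_sum b G_psd (ltn_ord a)) mulr_sumr.
by apply: eq_bigr => j _; ring.
Qed.

Let Y_moment k : U.-integrable [set: RM] (EFin \o (fun u => Y k u ^+ 2)) /\
  \int[U]_u (Y k u ^+ 2) = G k k.
Proof.
apply: char_second_moment => // s.
have := Y_char k.+1 (fun i => s * (i == k)%:R + 0 * (i == k)%:R) 0.
rewrite cos0 mul1r lin_var_delta// !mulr0 !mul0r expr0n mul0r !addr0 [s ^+ 2 * _]mulrC => <-.
apply: eq_Rintegral => u _; rewrite addr0; congr cos.
under eq_bigr do rewrite mul0r addr0 -mulrA.
by rewrite -mulr_sumr (sum_delta (Y ^~ u)).
Qed.

Let S (u : RM) : \bar R := (\sum_(k <oo) (Y k u ^+ 2)%:E)%E.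

Let mS : measurable_fun [set: RM] S.
Proof.
apply: ge0_emeasurable_sum => [k u _ _|k _]; first by rewrite lee_fin sqr_ge0.
by apply/measurable_EFinP; exact: measurable_funX.
Qed.

Let S_ae : {ae U, forall u, (S u < +oo)%E}.
Proof.
have iS : U.-integrable [set: RM] S.
  apply/integrableP; split => //.
  apply: le_lt_trans G_fin.
  rewrite (_ : integral _ _ _ = (\int[U]_u S u)%E); last first.
    apply: eq_integral => u _; rewrite gee0_abs//.
    by apply: nneseries_ge0 => k _ _; rewrite lee_fin sqr_ge0.
  rewrite integral_nneseries//.
  - apply: lee_nneseries => [k _ _|k _]; first by apply: integral_ge0 => u _; rewrite lee_fin sqr_ge0.
    rewrite -(Y_moment k).2 /Rintegral fineK//.
    exact: (integrable_fin_num measurableT (Y_moment k).1).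
  - by move=> k; apply/measurable_EFinP; exact: measurable_funX.
  - by move=> k u _; rewrite lee_fin sqr_ge0.
have := integrable_ae measurableT iS; apply: filterS => u /(_ I).
by rewrite fin_numElt => /andP[].
Qed.

(** Putting 0 where the series diverges makes the sequence square summable for every [u], so [to_l2]
    never takes its default value and the coordinates are known everywhere. *)
Let X (u : RM) : l2 R := to_l2 (fun k => if (S u < +oo)%E then Y k u else 0).

Let XE u (k : nat) : X u k = if (S u < +oo)%E then Y k u else 0.
Proof.
rewrite /X to_l2E//; case: (boolP (S u < +oo)%E) => [//|_].
by rewrite eseries0 ?ltry// => i _ _ /=; rewrite expr0n.
Qed.

Let mX : measurable_fun [set: RM] X.
Proof.
apply: measurable_l2 => k; under eq_fun do rewrite XE.
apply: measurable_fun_ifT => //.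
exact: measurable_fun_lte.
Qed.

Lemma gaussian_exists : exists mu : probability (l2 R) R, centered_gaussian mu G.
Proof.
exists (law U mX); apply: char_centered_gaussian => //; first by case: G_psd.
move=> l t th.
have mc : measurable_fun [set: l2 R] (fun x => lin_comb l t x + th).
  by apply: measurable_funD => //; exact: measurable_lin_comb.
have bc := bmeas_cos mc.
rewrite (law_expect mX (proj1 bc) (bmeas_integrable U (bmeas_comp mX bc))) -Y_char.
congr fine; apply: ae_eq_integral => //.
- apply/measurable_EFinP; exact: (proj1 (bmeas_comp mX bc)).
- apply/measurable_EFinP; apply: (proj1 (bmeas_cos _)).
  apply: measurable_funD => //; apply: measurable_sum => k; exact: measurable_funM.
move: S_ae; apply: filterS => u Su _; congr (cos (_ + _))%:E.
by apply: eq_bigr => k _; rewrite XE Su.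
Qed.

End gaussian_existence.

(** * Second moments of linear combinations *)

Section square_integrable.
Context {R : realType} {d} {T : measurableType d} (P : probability T R).
Local Notation pint f := (P.-integrable [set: T] (EFin \o f)).

Lemma sqr_integrableM (u v : T -> R) :
  measurable_fun [set: T] u -> measurable_fun [set: T] v ->
  pint (fun t => u t ^+ 2) -> pint (fun t => v t ^+ 2) -> pint (fun t => u t * v t).
Proof.
move=> mu mv iu iv; apply: (integrable_dominated _ (pintD iu iv)).
  exact: measurable_funM.
move=> t; rewrite ler_norml; apply/andP; split.
  by have := sqr_ge0 (u t + v t); have := sqr_ge0 (u t); have := sqr_ge0 (v t); rewrite sqrrD; lra.
by have := sqr_ge0 (u t - v t); have := sqr_ge0 (u t); have := sqr_ge0 (v t); rewrite sqrrB; lra.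
Qed.

Lemma sqr_integrable (u : T -> R) : measurable_fun [set: T] u ->
  pint (fun t => u t ^+ 2) -> pint u.
Proof.
move=> mu iu; have i1 : pint (fun=> 1) by apply: bmeas_integrable; exact: bmeas_cst.
have -> : u = (fun t => u t * 1) by apply/funext => t; rewrite mulr1.
by apply: sqr_integrableM => //; under eq_fun do rewrite expr1n.
Qed.

Lemma expect_sqr_fin (u : T -> R) : measurable_fun [set: T] u ->
  ('E_P[fun t => (u t ^+ 2)%R] < +oo)%E -> pint (fun t => u t ^+ 2).
Proof.
move=> mu; rewrite unlock => h; apply/integrableP; split.
  by apply/measurable_EFinP; exact: measurable_funX.
by under eq_integral do rewrite gee0_abs ?lee_fin ?sqr_ge0//.
Qed.

End square_integrable.

Section lin_comb_moments.
Context {R : realType} {d} {T : measurableType d}.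
Variables (P : probability T R) (X : T -> l2 R).
Hypothesis mX : forall k : nat, measurable_fun [set: T] (fun t => X t k : R).
Hypothesis iX : forall k : nat, P.-integrable [set: T] (EFin \o (fun t => (X t k : R) ^+ 2)).

Definition covariance_of (k l : nat) : R := \int[P]_t ((X t k : R) * X t l).

Lemma covariance_integrable k l :
  P.-integrable [set: T] (EFin \o (fun t => (X t k : R) * X t l)).
Proof. exact: sqr_integrableM. Qed.

Lemma mixed_momentE k l : mixed_moment P X k l = (covariance_of k l)%:E.
Proof. by rewrite /mixed_moment expectE//; exact: covariance_integrable. Qed.

(** The general index list serves both [lin_var], indexed by ordinals, and [quad_form], indexed by
    pairs. *)
Lemma expect_sum_sqr I (s : seq I) (c : I -> R) (k : I -> nat) :
  P.-integrable [set: T] (EFin \o (fun t => (\sum_(i <- s) c i * X t (k i)) ^+ 2)) /\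
  \int[P]_t ((\sum_(i <- s) c i * X t (k i)) ^+ 2) =
  \sum_(i <- s) \sum_(j <- s) c i * c j * covariance_of (k i) (k j).
Proof.
have E : (fun t => (\sum_(i <- s) c i * X t (k i)) ^+ 2) =
    (fun t => \sum_(i <- s) \sum_(j <- s) c i * c j * ((X t (k i) : R) * X t (k j))).
  apply/funext => t; rewrite expr2 mulr_suml; apply: eq_bigr => i _.
  by rewrite mulr_sumr; apply: eq_bigr => j _; ring.
have iC (i j : I) := pintZ (c i * c j) (covariance_integrable (k i) (k j)).
have iS (i : I) := pint_sum s (iC i).
rewrite E; split; first exact: pint_sum.
rewrite (expect_sum _ iS); apply: eq_bigr => i _; rewrite (expect_sum _ (iC i)).
by apply: eq_bigr => j _; rewrite (expectZ _ (covariance_integrable _ _)).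
Qed.

Lemma lin_comb_moment l (t : nat -> R) :
  P.-integrable [set: T] (EFin \o (fun w => lin_comb l t (X w) ^+ 2)) /\
  \int[P]_w (lin_comb l t (X w) ^+ 2) = lin_var covariance_of l t.
Proof. exact: (expect_sum_sqr _ (fun k : 'I_l => t k) val). Qed.

Lemma covariance_psd : psd covariance_of.
Proof.
split; first by move=> a b; apply: eq_Rintegral => t _; exact: mulrC.
move=> r; rewrite /quad_form -(expect_sum_sqr r fst snd).2.
by apply: Rintegral_ge0 => t _; exact: sqr_ge0.
Qed.

End lin_comb_moments.

Section lin_comb_continuity.
Context {R : realType} (l : nat) (t : nat -> R).

Lemma lin_comb_le (x : l2 R) (M : R) : (forall k, (k < l)%N -> `|x k| <= M) ->
  `|lin_comb l t x| <= (\sum_(k < l) `|t k|) * M.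
Proof.
move=> xM; rewrite (le_trans (ler_norm_sum _ _ _))// mulr_suml.
by apply: ler_sum => k _; rewrite normrM ler_wpM2l// xM.
Qed.

(** [lin_comb] prepared for bundling as a linear map, the kind of object over which
    [centered_gaussian] quantifies. *)
Definition lin_map : l2 R -> R^o := lin_comb l t.

Lemma lin_map_linear : linear lin_map.
Proof.
move=> a x y; rewrite /lin_map /lin_comb scaler_sumr -big_split/=; apply: eq_bigr => k _.
by rewrite -[LHS]/(t k * (a * x k + y k)) mulrDr mulrCA.
Qed.

HB.instance Definition _ := GRing.isLinear.Build R (l2 R) R^o _ lin_map lin_map_linear.

Lemma lin_map_continuous : continuous lin_map.
Proof.
apply: (@lipschitz_continuous _ _ _ (\sum_(k < l) `|t k|)) => x y.
rewrite -[_ - _](linearB lin_map); apply: lin_comb_le => k _; exact: l2_coord_le.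
Qed.

(** The definition provides a normal law with some unknown [s]. Its second moment is [s^2] by the
    characteristic function and [lin_var G l t] by the covariances, which determines [s^2]. *)
Lemma gaussian_char (mu : probability (l2 R) R) (G : nat -> nat -> R) :
  centered_gaussian mu G -> forall th,
  \int[mu]_x cos (lin_comb l t x + th) = cos th * expR (- (lin_var G l t / 2)).
Proof.
move=> [muG muM] th.
have mc (k : nat) : measurable_fun [set: l2 R] (fun x : l2 R => x k : R).
  exact: l2_coord_measurable.
have ic (k : nat) : mu.-integrable [set: l2 R] (EFin \o (fun x : l2 R => (x k : R) ^+ 2)).
  by apply: expect_sqr_fin => //; rewrite [X in (X < _)%E](muM k k) ltry.
have covE : covariance_of mu id = G.
  apply/funext => a; apply/funext => b; apply/EFin_inj.
  by rewrite -(mixed_momentE mc ic) -muM.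
have [s s0 sE] := muG lin_map lin_map_continuous.
have ml := measurable_lin_comb l t.
have lawcos a b : \int[mu]_x cos (a * lin_comb l t x + b) =
    cos b * expR (- (s ^+ 2 * a ^+ 2 / 2)).
  pose nu : probability (measurableTypeR R) R := @law R _ _ _ (measurableTypeR R) mu _ ml.
  have bc : bmeas (fun x : measurableTypeR R => cos (a * x + b)).
    by apply: bmeas_cos; apply: measurable_funD => //; apply: measurable_funM.
  rewrite -(centered_normal_char (nu := nu) s0)//.
  symmetry; apply: law_expect; first by case: bc.
  exact: (bmeas_integrable mu (bmeas_comp ml bc)).
have s2 : lin_var G l t = s ^+ 2.
  rewrite -covE -(lin_comb_moment mc ic l t).2.
  have [|a|_ //] := @char_second_moment _ _ _ mu (lin_comb l t) (s ^+ 2); first exact: ml.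
  transitivity (\int[mu]_x cos (a * lin_comb l t x + 0)); last by rewrite lawcos cos0 mul1r.
  by apply: eq_Rintegral => x _; rewrite addr0.
rewrite s2; transitivity (\int[mu]_x cos (1 * lin_comb l t x + th)).
  by apply: eq_Rintegral => x _; rewrite mul1r.
by rewrite lawcos expr1n mulr1.
Qed.

End lin_comb_continuity.

(** * Triangular arrays *)

(** Independent centered variables are orthogonal, so only the diagonal terms remain. Consequently
    the scaled row sum has the same variances as a single entry. *)
Lemma iid_sum_sqr {R : realType} {d d'} {T : measurableType d} {T' : measurableType d'}
    (P : probability T R) (I : finType) (X : I -> {RV P >-> T'}) (i0 : I) (u : T' -> R) :
  iid X -> measurable_fun [set: T'] u ->
  P.-integrable [set: T] (EFin \o (fun t => u (X i0 t) ^+ 2)) ->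
  \int[P]_t u (X i0 t) = 0 ->
  P.-integrable [set: T] (EFin \o (fun t => (\sum_i u (X i t)) ^+ 2)) /\
  \int[P]_t ((\sum_i u (X i t)) ^+ 2) = #|I|%:R * \int[P]_t (u (X i0 t) ^+ 2).
Proof.
move=> [indX idX] mu iu0 Eu0.
have muX i : measurable_fun [set: T] (fun t => u (X i t)).
  by apply: measurableT_comp => //; exact: measurable_funPT.
have mu2 : measurable_fun [set: T'] (fun x => u x ^+ 2) by exact: measurable_funX.
have iu i : P.-integrable [set: T] (EFin \o (fun t => u (X i t) ^+ 2)).
  apply/integrableP; split; first by apply/measurable_EFinP; exact: measurable_funX.
  have /integrableP[_] := iu0.
  rewrite (_ : integral _ _ _ = \int[P]_t `|(u (X i t) ^+ 2)%:E|)%E//.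
  rewrite (id_integral idX i0 i (h := fun x => `|(u x ^+ 2)%:E|%E))//.
  by apply: measurableT_comp => //; exact/measurable_EFinP.
have Eu i : \int[P]_t u (X i t) = 0.
  rewrite -Eu0; apply: (id_expect_integrable idX i i0 mu) => k; exact: sqr_integrable.
have E : (fun t => (\sum_i u (X i t)) ^+ 2) =
    (fun t => \sum_i \sum_j (u (X i t) * u (X j t))).
  by apply/funext => t; rewrite expr2 mulr_suml; apply: eq_bigr => i _; rewrite mulr_sumr.
have iM i j : P.-integrable [set: T] (EFin \o (fun t => u (X i t) * u (X j t))).
  exact: sqr_integrableM.
have iS i := pint_sum (index_enum I) (iM i).
rewrite E; split; first exact: pint_sum.
rewrite (expect_sum _ iS) (eq_bigr (fun=> \int[P]_t (u (X i0 t) ^+ 2))).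
  by rewrite sumr_const mulr_natl.
move=> i _; rewrite (expect_sum _ (iM i)) (bigD1 i)//= big1 ?addr0.
  by apply: (id_expect_integrable idX i i0 (h := fun x => u x ^+ 2)).
move=> j ji; rewrite (indep_expectM indX (u := u) (v := u))// ?Eu ?mul0r// eq_sym //.
Qed.

Lemma limn_esup_lt {R : realType} (u : (\bar R)^nat) (a : \bar R) :
  (limn_esup u < a)%E -> \forall n \near \oo, (u n < a)%E.
Proof.
rewrite limn_esup_lim (cvg_lim _ (ereal_nonincreasing_cvgn (nonincreasing_esups u)))//.
move=> /ereal_inf_lt[_ [N _ <-] uN]; near=> n.
apply: le_lt_trans uN; apply: ereal_sup_ubound; exists n => //=.
by near: n; exact: nbhs_infty_ge.
Unshelve. all: by end_near. Qed.

Section euclidean_norm.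
Context {R : realType}.

Lemma euclidean_normE l (x : l2 R) :
  euclidean_norm (gamma l x) ^+ 2 = \sum_(k < l) x k ^+ 2.
Proof.
rewrite sqr_sqrtr; last by apply: sumr_ge0 => k _; exact: sqr_ge0.
by apply: eq_bigr => k _; rewrite mxE.
Qed.

Lemma coord_le_euclidean_norm l (x : l2 R) k : (k < l)%N ->
  `|x k| <= euclidean_norm (gamma l x).
Proof.
move=> kl; rewrite -(@ler_pXn2r _ 2)// ?nnegrE ?sqrtr_ge0// euclidean_normE.
rewrite real_normK ?num_real// (bigD1 (Ordinal kl))//= lerDl.
by apply: sumr_ge0 => i _; exact: sqr_ge0.
Qed.

Lemma measurable_euclidean_norm l :
  measurable_fun [set: l2 R] (fun x => euclidean_norm (gamma l x)).
Proof.
apply: (@measurableT_comp _ _ _ _ _ _ (@Num.sqrt R)).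
  by apply: continuous_measurable_fun; exact: sqrt_continuous.
apply: measurable_sum => k; apply: measurable_funX.
under eq_fun do rewrite mxE; exact: l2_coord_measurable.
Qed.

End euclidean_norm.

Lemma cvgn_sum {R : realType} {I : Type} (s : seq I) (u : nat -> I -> R) (l : I -> R) :
  (forall i, u n i @[n --> \oo] --> l i) ->
  \sum_(i <- s) u n i @[n --> \oo] --> \sum_(i <- s) l i.
Proof.
move=> ul; elim: s => [|i s ih].
  by under eq_fun do rewrite big_nil; rewrite big_nil; exact: cvg_cst.
by under eq_fun do rewrite big_cons; rewrite big_cons; exact: cvgD.
Qed.

Section triangular_array.
Local Unset Implicit Arguments.
Context {R : realType} {d : nat -> measure_display} {T : forall n, measurableType (d n)}.
Variables (P : forall n, probability (T n) R).
Variables (Z : forall n, 'I_n.+1 -> {RV (P n) >-> l2 R}) (G : nat -> nat -> R).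
Hypothesis Z_iid : forall n, iid (Z n).
Hypothesis Z_moments : forall n i : nat,
  ('E_(P n)[fun t => Z n ord0 t i] = 0)%E /\
  ('E_(P n)[fun t => (Z n ord0 t i ^+ 2)%R] < +oo)%E.
Hypothesis cov_cvg : forall k l : nat,
  mixed_moment (P n) (Z n ord0) k l @[n --> \oo] --> (G k l)%:E.
Hypothesis trace_limsup :
  (limn_esup (fun n => \sum_(k <oo) mixed_moment (P n) (Z n ord0) k k)
    <= \sum_(k <oo) (G k k)%:E)%E.
Hypothesis trace_fin : (\sum_(k <oo) (G k k)%:E < +oo)%E.
Hypothesis lindeberg : forall (l : nat) (eps : rat), 0 < eps ->
  ('E_(P n)[fun t => (euclidean_norm (gamma l (Z n ord0 t)) ^+ 2 *
    \1_[set u | (ratr eps * Num.sqrt n.+1%:R <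
                 euclidean_norm (gamma l (Z n ord0 u)))%R] t)%R]
    @[n --> \oo] --> 0)%E.

Let mZ n (i : 'I_n.+1) : measurable_fun [set: T n] (Z n i).
Proof. exact: measurable_funPT. Qed.

Let mZc n (i : 'I_n.+1) (k : nat) : measurable_fun [set: T n] (fun t => Z n i t k : R).
Proof. exact: measurable_coord. Qed.

Let iZ n k : (P n).-integrable [set: T n] (EFin \o (fun t => (Z n ord0 t k : R) ^+ 2)).
Proof. by apply: expect_sqr_fin => //; case: (Z_moments n k). Qed.

Let EZ n (k : nat) : \int[P n]_t (Z n ord0 t k : R) = 0.
Proof.
have := (Z_moments n k).1; rewrite expectE; last exact: sqr_integrable.
by case.
Qed.

Let C n := covariance_of (P n) (Z n ord0).

Let C_psd n : psd (C n).
Proof. exact: (covariance_psd (mZc n ord0) (iZ n)). Qed.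

Let C_cvg k l : C n k l @[n --> \oo] --> G k l.
Proof.
have := cov_cvg k l; under eq_fun do rewrite mixed_momentE//.
by move=> /fine_cvg.
Qed.

Let quad_form_cvg r : quad_form (C n) r @[n --> \oo] --> quad_form G r.
Proof.
apply: cvgn_sum => p; apply: cvgn_sum => q; apply: cvgMr; exact: C_cvg.
Qed.

Let G_psd : psd G.
Proof.
split.
  move=> a b; have h := C_cvg a b; have h' := C_cvg b a.
  have e : (fun n => C n a b) = (fun n => C n b a).
    by apply/funext => n; exact: (C_psd n).1.
  by rewrite e in h; exact: (cvg_unique _ h h').
move=> r; have h := quad_form_cvg r; rewrite -(cvg_lim _ h)//.
apply: limr_ge; first exact: cvgP h.
apply: nearW => n; exact: (C_psd n).2.
Qed.

Lemma limit_gaussian_exists : exists mu : probability (l2 R) R, centered_gaussian mu G.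
Proof. exact: gaussian_exists. Qed.

Let X n t : l2 R := (Num.sqrt n.+1%:R)^-1 *: \sum_(i < n.+1) Z n i t.

Let XE n t (k : nat) : X n t k = (Num.sqrt n.+1%:R)^-1 * \sum_(i < n.+1) (Z n i t k : R).
Proof. by rewrite /X l2_coordZ l2_coord_sum. Qed.

Let mX n : measurable_fun [set: T n] (X n).
Proof.
apply: measurable_l2 => k; under eq_fun do rewrite XE.
by apply: measurable_funM => //; apply: measurable_sum.
Qed.

Let mXc n (k : nat) : measurable_fun [set: T n] (fun t => X n t k : R).
Proof. exact: measurable_coord. Qed.

Let X_moment n (k : nat) : (P n).-integrable [set: T n] (EFin \o (fun t => (X n t k : R) ^+ 2)) /\
  \int[P n]_t ((X n t k : R) ^+ 2) = C n k k.
Proof.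
have [iS ES] := iid_sum_sqr (Z_iid n) (l2_coord_measurable k) (iZ n k) (EZ n k).
have E : (fun t => (X n t k : R) ^+ 2) =
    (fun t => n.+1%:R^-1 * (\sum_(i < n.+1) (Z n i t k : R)) ^+ 2).
  by apply/funext => t; rewrite XE exprMn exprVn sqr_sqrtr.
rewrite E; split; first exact: pintZ.
rewrite (expectZ _ iS) ES card_ord mulrA mulVf// mul1r.
by apply: eq_Rintegral => t _; rewrite expr2.
Qed.

Let lin_comb_X n l (t : nat -> R) w : lin_comb l t (X n w) =
  (Num.sqrt n.+1%:R)^-1 * \sum_(i < n.+1) lin_comb l t (Z n i w).
Proof.
rewrite /lin_comb exchange_big mulr_sumr; apply: eq_bigr => k _.
by rewrite XE mulrCA mulr_sumr.
Qed.

(** The combination is at most [K] times the Euclidean norm of the first [l] coordinates. Where it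
    exceeds [e sqrt (n + 1)], the norm exceeds [q sqrt (n + 1)] for any rational [q < e / K]. The 1
    added in [K] keeps it positive. *)
Let lin_comb_lindeberg l (t : nat -> R) (e : R) : 0 < e ->
  \int[P n]_w (lin_comb l t (Z n ord0 w) ^+ 2 *
    (e * Num.sqrt n.+1%:R < `|lin_comb l t (Z n ord0 w)|)%R%:R) @[n --> \oo] --> (0 : R).
Proof.
move=> e0; pose K := \sum_(k < l) `|t k| + 1.
have K0 : 0 < K by rewrite ltr_wpDl// sumr_ge0.
have [q] := rat_in_itvoo (divr_gt0 e0 K0); rewrite in_itv/= => /andP[q0 qe].
have {}q0 : 0 < q by rewrite ltr0q in q0.
pose N n w := euclidean_norm (gamma l (Z n ord0 w)).
have N0 n w : 0 <= N n w by exact: sqrtr_ge0.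
pose A n := [set w | ratr q * Num.sqrt n.+1%:R < N n w].
have zN n w : `|lin_comb l t (Z n ord0 w)| <= K * N n w.
  rewrite (le_trans (lin_comb_le _ (@coord_le_euclidean_norm _ l _)))//.
  by rewrite (ler_wpM2r (N0 n w))// lerDl.
have mN n : measurable_fun [set: T n] (N n).
  exact: (measurableT_comp (measurable_euclidean_norm l) (mZ n ord0)).
have mA n : measurable (A n).
  have -> : A n = [set: T n] `&` N n @^-1` `]ratr q * Num.sqrt n.+1%:R, +oo[%classic.
    by rewrite setTI; apply/seteqP; split => w /=; rewrite in_itv/= andbT.
  exact: (mN n measurableT _ (measurable_itv _)).
have iN n : (P n).-integrable [set: T n] (EFin \o (fun w => N n w ^+ 2)).
  have -> : (fun w => N n w ^+ 2) = (fun w => \sum_(k < l) (Z n ord0 w k : R) ^+ 2).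
    by apply/funext => w; rewrite /N euclidean_normE.
  by apply: pint_sum => k; exact: iZ.
have iNA n : (P n).-integrable [set: T n] (EFin \o (fun w => N n w ^+ 2 * \1_(A n) w)).
  apply: (integrable_dominated _ (iN n)).
    by apply: measurable_funM; [exact: measurable_funX|exact: measurable_indic].
  move=> w; rewrite ger0_norm ?mulr_ge0 ?sqr_ge0// ler_piMr ?sqr_ge0// indicE.
have lim0 : K ^+ 2 * \int[P n]_w (N n w ^+ 2 * \1_(A n) w) @[n --> \oo] --> (0 : R).
  rewrite -(mulr0 (K ^+ 2)); apply: cvgMr.
  have := lindeberg l _ q0.
  by under eq_fun => n do rewrite (expectE (iNA n)); move=> /fine_cvg.
have ml n : measurable_fun [set: T n] (fun w => lin_comb l t (Z n ord0 w)).
  exact: (measurableT_comp (measurable_lin_comb l t) (mZ n ord0)).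
have bound n w : lin_comb l t (Z n ord0 w) ^+ 2 * (e * Num.sqrt n.+1%:R <
    `|lin_comb l t (Z n ord0 w)|)%R%:R <= K ^+ 2 * (N n w ^+ 2 * \1_(A n) w).
  case: (boolP (e * _ < _)) => /= [zl|_]; last first.
    by rewrite mulr0 mulr_ge0 ?sqr_ge0// mulr_ge0 ?sqr_ge0.
  rewrite indicE mem_set; last first.
    rewrite /A /= -(ltr_pM2l K0); apply: lt_le_trans (zN n w).
    apply: le_lt_trans zl; rewrite mulrA ler_wpM2r ?sqrtr_ge0// mulrC -ler_pdivlMr//.
    exact: ltW.
  rewrite !mulr1 -exprMn -[leLHS]real_normK ?num_real// ler_pXn2r ?nnegrE//.
  by rewrite mulr_ge0// ltW.
have ge0 n w : 0 <= lin_comb l t (Z n ord0 w) ^+ 2 * (e * Num.sqrt n.+1%:R <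
    `|lin_comb l t (Z n ord0 w)|)%R%:R by rewrite mulr_ge0 ?sqr_ge0.
apply: (squeeze_cvgr _ (cvg_cst 0) lim0); apply: nearW => n; apply/andP; split.
  by apply: Rintegral_ge0.
rewrite -(expectZ _ (iNA n)); apply: expect_le => //; last exact: pintZ.
apply: (integrable_dominated _ (pintZ (K ^+ 2) (iNA n))) => [|w].
  apply: measurable_funM; first exact: measurable_funX.
  apply: (measurableT_comp (f := fun b : bool => b%:R : R)) => //.
  apply: measurable_fun_ltr => //; exact: measurableT_comp.
by rewrite ger0_norm.
Qed.

Let X_char_cvg (mu : probability (l2 R) R) : centered_gaussian mu G ->
  forall l (t : nat -> R) th,
  \int[P n]_w cos (\sum_(k < l) t k * (X n w : l2 R) k + th) @[n --> \oo] -->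
  \int[mu]_x cos (\sum_(k < l) t k * x k + th).
Proof.
move=> muG l t th; rewrite [X in _ --> X](gaussian_char l t muG).
have -> : (fun n => \int[P n]_w cos (\sum_(k < l) t k * (X n w : l2 R) k + th)) =
    (fun n => \int[P n]_w cos ((Num.sqrt n.+1%:R)^-1 * (\sum_(i < n.+1)
      lin_comb l t (Z n i w)) + th)).
  by apply/funext => n; apply: eq_Rintegral => w _; rewrite -lin_comb_X.
apply: (clt_array (z := lin_comb l t) (v := lin_var G l t) (th := th) Z_iid).
- exact: measurable_lin_comb.
- by move=> n; case: (lin_comb_moment (mZc n ord0) (iZ n) l t).
- move=> n; rewrite /lin_comb expect_sum => [|k].
    by rewrite big1// => k _; rewrite expectZ ?EZ ?mulr0//; exact: sqr_integrable.
  by apply: pintZ; exact: sqr_integrable.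
- have -> : (fun n => \int[P n]_w (lin_comb l t (Z n ord0 w) ^+ 2)) =
      (fun n => lin_var (C n) l t).
    by apply/funext => n; rewrite (lin_comb_moment (mZc n ord0) (iZ n) l t).2.
  apply: cvgn_sum => a; apply: cvgn_sum => b; apply: cvgMr; exact: C_cvg.
- exact: lin_comb_lindeberg.
Qed.

Let S : R := fine (\sum_(k <oo) (G k k)%:E)%E.

Let SE : (\sum_(k <oo) (G k k)%:E)%E = S%:E.
Proof.
rewrite /S fineK// fin_numElt trace_fin andbT (@lt_le_trans _ _ 0%E)// ?ltNyr//.
by apply: nneseries_ge0 => k _ _; rewrite lee_fin; exact: psd_diag_ge0.
Qed.

Let trace_lt (e : R) : 0 < e -> \forall n \near \oo,
  (\sum_(k <oo) (C n k k)%:E < (S + e)%:E)%E.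
Proof.
move=> e0; apply: limn_esup_lt.
have <- : (fun n => \sum_(k <oo) mixed_moment (P n) (Z n ord0) k k)%E =
    (fun n => \sum_(k <oo) (C n k k)%:E)%E.
  by apply/funext => n; apply: eq_eseriesr => k _; rewrite mixed_momentE.
by apply: le_lt_trans trace_limsup _; rewrite SE lte_fin ltrDl.
Qed.

Let X_series n : (\sum_(k <oo) (\int[P n]_t ((X n t k : R) ^+ 2))%:E)%E =
  (\sum_(k <oo) (C n k k)%:E)%E.
Proof. by apply: eq_eseriesr => k _; rewrite (X_moment n k).2. Qed.

(** The second moment of the norm is the trace of [C n]. The statement is asymptotic because a bound
    on the limsup allows finitely many rows to have an infinite trace. *)
Let X_norm (e : R) : 0 < e -> \forall n \near \oo,
  (P n).-integrable [set: T n] (EFin \o (fun t => `|X n t| ^+ 2)) /\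
  \int[P n]_t (`|X n t| ^+ 2) <= S + e.
Proof.
move=> e0; have := trace_lt e e0; apply: filterS => n Sn.
have iX k := (X_moment n k).1.
split; first by apply: l2_norm_integrable => //; rewrite X_series (lt_trans Sn)// ltry.
rewrite -lee_fin fineK; rewrite integral_l2_norm// X_series; first exact: ltW.
rewrite fin_numElt (lt_trans Sn) ?ltry// andbT (@lt_le_trans _ _ 0%E) ?ltNyr//.
apply: nneseries_ge0 => k _ _; rewrite lee_fin.
by exact: psd_diag_ge0.
Qed.

(** Three thirds of [e]: the head of [G] misses [S] by at most one, the head of [C n] falls short of
    that of [G] by at most one, and the trace of [C n] exceeds [S] by at most one. *)
Let X_tail (e : R) : 0 < e -> exists l, S - \sum_(k < l) G k k <= e /\
  \forall n \near \oo, \int[P n]_t (`|X n t - l2_trunc l (X n t)| ^+ 2) <= e.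
Proof.
move=> e0; have e3 : 0 < e / 3 by rewrite divr_gt0.
have hS : \sum_(k < l) G k k @[l --> \oo] --> S.
  have : (\sum_(0 <= k < l) (G k k)%:E)%E @[l --> \oo] --> S%:E.
    rewrite -SE; apply: is_cvg_nneseries => k _ _.
    by rewrite lee_fin; exact: psd_diag_ge0.
  by under eq_fun do rewrite sumEFin big_mkord; move=> /fine_cvg.
have [l _ /(_ l (leqnn l)) hl] : \forall l \near \oo, S - e / 3 <= \sum_(k < l) G k k.
  by apply: (cvgr_ge _ hS); rewrite ltrBlDr ltrDl.
exists l; split; first by lra.
have hC : \sum_(k < l) C n k k @[n --> \oo] --> \sum_(k < l) G k k.
  by apply: cvgn_sum => k; exact: C_cvg.
near=> n.
have [iN EN] : (P n).-integrable [set: T n] (EFin \o (fun t => `|X n t| ^+ 2)) /\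
  \int[P n]_t (`|X n t| ^+ 2) <= S + e / 3 by near: n; exact: X_norm.
have : \sum_(k < l) G k k - e / 3 <= \sum_(k < l) C n k k.
  by near: n; apply: (cvgr_ge _ hC); rewrite ltrBlDr ltrDl.
have Sn : (\sum_(k <oo) (C n k k)%:E < (S + e / 3)%:E)%E by near: n; exact: trace_lt.
rewrite expect_l2_tail => //; first last.
- by rewrite X_series (lt_trans Sn)// ltry.
- by move=> k; case: (X_moment n k).
rewrite [X in _ -> _ - X <= _](eq_bigr (fun k : 'I_l => C n k k)); first by lra.
by move=> k _; rewrite (X_moment n k).2.
Unshelve. all: by end_near. Qed.

(** An arbitrary [mu] with the defining property is enough, since [G] determines its characteristic
    function and the mean of its squared norm, which is [S]. *)
Lemma array_cvg (mu : probability (l2 R) R) : centered_gaussian mu G ->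
  cvg_in_distribution P X mu.
Proof.
move=> muG; split => // f cf [M fM].
have mc (k : nat) : measurable_fun [set: l2 R] (fun x : l2 R => x k : R).
  exact: l2_coord_measurable.
have ic (k : nat) : mu.-integrable [set: l2 R] (EFin \o (fun x : l2 R => (x k : R) ^+ 2)).
  by apply: expect_sqr_fin => //; rewrite [X in (X < _)%E](muG.2 k k) ltry.
have covE k : \int[mu]_x ((x k : R) ^+ 2) = G k k.
  transitivity (covariance_of mu id k k).
    by apply: eq_Rintegral => x _; rewrite expr2.
  by apply/EFin_inj; rewrite -muG.2 -(mixed_momentE mc ic).
have serE : (\sum_(k <oo) (\int[mu]_x ((x k : R) ^+ 2))%:E)%E = S%:E.
  by rewrite -SE; apply: eq_eseriesr => k _; rewrite covE.
have finE : (\sum_(k <oo) (\int[mu]_x ((x k : R) ^+ 2))%:E < +oo)%E by rewrite serE ltry.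
have imu := l2_norm_integrable mc ic finE.
have Emu : \int[mu]_x (`|x| ^+ 2) = S.
  apply/EFin_inj; rewrite -serE -integral_l2_norm// fineK//.
  exact: (integrable_fin_num measurableT imu).
have bf : bmeas f by split; [exact: l2_continuous_measurable_fun|exists M].
(* Rows approach the trace [S] only in the limsup sense, hence the slack 1 in the common bound. *)
have h := @levy_continuity _ _ _ _ _ P X mu id (S + 1) mX (@measurable_id _ _ _)
  (X_char_cvg mu muG) (X_norm 1 ltr01) _ _ f M cf fM.
rewrite (expectE (bmeas_integrable mu bf)).
rewrite (_ : (fun n => 'E_(P n)[f \o X n])%E = (fun n => (\int[P n]_t f (X n t))%:E)); last first.
  by apply/funext => n; rewrite expectE//; exact: (bmeas_integrable (P n) (bmeas_comp (mX n) bf)).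
apply: cvg_EFin; first by apply: nearW.
apply: h; first by rewrite Emu lerDl.
move=> e e0; have [l [Sl Xl]] := X_tail e e0; exists l; split => //.
rewrite (expect_l2_tail mc ic finE) Emu.
by under eq_bigr do rewrite covE.
Qed.

End triangular_array.

(* Row n of the array has n.+1 entries, Z n ord0 being the first of them. *)
Theorem proposition4 (R : realType)
    (d : nat -> measure_display) (T : forall n, measurableType (d n))
    (P : forall n, probability (T n) R)
    (Z : forall n, 'I_n.+1 -> {RV (P n) >-> l2 R})
    (Gamma : nat -> nat -> R)
    (Z_iid : forall n, iid (Z n))
    (Z_moments : forall n i : nat,
      ('E_(P n)[fun t => Z n ord0 t i] = 0)%E /\
      ('E_(P n)[fun t => (Z n ord0 t i ^+ 2)%R] < +oo)%E)
    (cov_cvg : forall k l : nat,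
      mixed_moment (P n) (Z n ord0) k l @[n --> \oo] --> (Gamma k l)%:E)
    (trace_limsup :
      (limn_esup (fun n => \sum_(k <oo) mixed_moment (P n) (Z n ord0) k k)
        <= \sum_(k <oo) (Gamma k k)%:E)%E)
    (trace_fin : (\sum_(k <oo) (Gamma k k)%:E < +oo)%E)
    (lindeberg : forall (l : nat) (eps : rat), 0 < eps ->
      ('E_(P n)[fun t => (euclidean_norm (gamma l (Z n ord0 t)) ^+ 2 *
        \1_[set u | (ratr eps * Num.sqrt n.+1%:R <
                     euclidean_norm (gamma l (Z n ord0 u)))%R] t)%R]
        @[n --> \oo] --> 0)%E) :
  (exists mu : probability (l2 R) R, centered_gaussian mu Gamma) /\
  (forall mu : probability (l2 R) R, centered_gaussian mu Gamma ->
    cvg_in_distribution P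
      (fun n t => (Num.sqrt n.+1%:R)^-1 *: \sum_(i < n.+1) Z n i t) mu).
Proof.
split; first exact: (limit_gaussian_exists P Z Gamma Z_moments cov_cvg trace_fin).
exact: (array_cvg P Z Gamma Z_iid Z_moments cov_cvg trace_limsup trace_fin lindeberg).
Qed.
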